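(* Given a composition $\overline{w}=(w_1,\ldots,w_{q-1})$ with at least two components. Let $\lambda=\lceil\frac{w}{w_1}\rceil$ and $s=\lambda w_1-w$. Then \[N_{ccc}(\overline{w})\geq \lambda(\lambda-1)w_1^2-2(\lambda-1)sw_1+w_1-\lfloor\frac{2s}{\lambda}\rfloor.\] In particular, equality holds for all $\overline{w}$ provided that $3w_1\geq w$, and $\overline{w}$ is not a refinement of any composition in $\{(4,4,2), (4,3,3), (5,5,3), (5,4,4)\}$.
   Context: A $q$-ary code of length $n$ is a subset of $\mathbb{Z}_q^n$ with Hamming distance. The composition of a vector $u$ is the tuple $(w_1,\ldots,w_{q-1})$ where $w_i$ is the number of coordinates of $u$ equal to $i$; compositions are written with positive components in non-increasing order $w_1\geq w_2\geq\cdots\geq w_{q-1}\geq 1$, and $w=\sum_i w_i$ is the total weight. $A_q(n,d,\overline{w})$ is the maximum size of a $q$-ary code of length $n$, minimum distance $d$, in which every codeword has composition $\overline{w}$. $N_{ccc}(\overline{w})=\min\{n_0: A_q(n,2w-1,\overline{w})=\lfloor n/w_1\rfloor \text{ for all } n\geq n_0\}$. A composition $(w_1,\ldots,w_q)$ is a refinement of $(v_1,\ldots,v_{q'})$ ($q>q'$) if $[q]$ can be partitioned into sets $S_1,\ldots,S_{q'}$ with $\sum_{i\in S_j}w_i=v_j$ for each $j$. *)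

(* Defs.v *)
From mathcomp Require Import all_boot all_order all_algebra.

Set Implicit Arguments.
Unset Strict Implicit.
Unset Printing Implicit Defensive.

Import Order.TTheory GRing.Theory Num.Theory.

(* Words over Z_q are functions into 'I_q rather than 'Z_q: only equality of
   letters matters, and 'Z_q is not Z_q for q < 2. *)
Definition word (q n : nat) := {ffun 'I_n -> 'I_q}.

Definition hamming_dist (q n : nat) (u v : word q n) : nat :=
  #|[set x | u x != v x]|.

(* Lists the multiplicities of the letters 1, ..., q - 1 (not of 0). *)
Definition word_composition (q n : nat) (u : word q n) : seq nat :=
  [seq #|[set x | u x == i :> nat]| | i <- iota 1 q.-1].

(* "Minimum distance d" means at least d, so that codes with at most one word
   are admitted for every d. *)
Definition is_ccc (q n d : nat) (w : seq nat) (C : {set word q n}) : bool :=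
  [forall u in C, word_composition u == w] &&
  [forall u in C, forall v in C, (u != v) ==> (d <= hamming_dist u v)].

Definition max_ccc (q n d : nat) (w : seq nat) : nat :=
  \max_(C : {set word q n} | is_ccc d w C) #|C|.

Definition is_composition (w : seq nat) : bool :=
  sorted geq w && all (leq 1) w.

(* The largest component w_1 of a composition. *)
Definition comp1 (w : seq nat) : nat := nth 0 w 0.

(* A composition with q - 1 components has alphabet size q = size w + 1. *)
Definition meets_johnson_from (w : seq nat) (n0 : nat) : Prop :=
  forall n : nat, n0 <= n ->
    max_ccc (size w).+1 n (2 * sumn w - 1) w = n %/ comp1 w.

(* N is the minimum of { n0 | meets_johnson_from w n0 }. *)
Definition is_Nccc (w : seq nat) (N : nat) : Prop :=
  meets_johnson_from w N /\
  forall n0 : nat, meets_johnson_from w n0 -> N <= n0.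

(* The fibre of f over j is the part S_j of the partition; parts are nonempty
   as soon as the components of v are positive. *)
Definition is_refinement (w v : seq nat) : Prop :=
  size v < size w /\
  exists f : 'I_(size w) -> 'I_(size v),
    forall j : 'I_(size v), \sum_(i | f i == j) nth 0 w i = nth 0 v j.

Local Open Scope ring_scope.

Definition comp_lambda (w : seq nat) : int :=
  Num.ceil ((sumn w)%:R / (comp1 w)%:R : rat).

Definition comp_s (w : seq nat) : int :=
  comp_lambda w * (comp1 w)%:Z - (sumn w)%:Z.

Definition Nccc_bound (w : seq nat) : int :=
  let l := comp_lambda w in
  let s := comp_s w in
  let w1 := (comp1 w)%:Z in
  l * (l - 1) * w1 ^+ 2 - 2 * (l - 1) * s * w1 + w1
    - Num.floor ((2 * s)%:~R / l%:~R : rat).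

(* Main.v *)
Require Import Defs.
From mathcomp Require Import all_boot all_order all_algebra.
From mathcomp Require Import zify.

(** Read the codewords as points and the coordinates as blocks: each word labels
    the blocks through it with its nonzero letters, two words share at most one
    block, and the labels occurring at a block are distinct.

    Lower bound.  Let M be the size of a code with minimum distance 2w - 1.  A
    coordinate covered by d words accounts for d(d-1) ordered pairs of words, and
    d(d-1) >= 2(L-1)d - L(L-1) for every L.  Summing over the coordinates with L
    the lambda of the statement and comparing with M(M-1) bounds n from below.
    For large n the size M = n %/ w1 is reached by translates of powers of 2 in
    Z_M.

    Upper bound on N_ccc, for lambda at most 3. It suffices to find blocks of
    size at most 3 whose points carry positions 0, 1, 2, every point having
    position 0 in w1 blocks and the other positions in suitable numbers of
    blocks: letter 1 is read at position 0, and Koenig's edge colouring theorem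
    splits the positions 1 and 2 into the remaining letters. For lambda = 2 such
    blocks come from cyclic graphs and complete graphs. For lambda = 3 put a = w
    - 2 w1 = w1 - s. Codes of size M >= max(6a + 3, 6a + 2s + 1) come from
    difference triples over Z_M, those of size 6a + 1 and 6a + 2 from Steiner
    triple systems, and those of size 6a + 2s, which for s >= 2 occur below n =
    (6a + 2s + 1) w1, from blocks over Z_D x Z_3 and at most two points at
    infinity. *)

Set Implicit Arguments.
Unset Strict Implicit.
Unset Printing Implicit Defensive.

Import GRing.Theory Num.Theory Order.TTheory.

(** * Codes from linear spaces *)

(** In the constructions for lambda = 3 the composition enters only through w1 and the sum of the
    other components: the remaining letters take consecutive numbers, and none of them occurs more
    than w1 times, so numbers at distance w1 always carry different letters.

    There the bound is (6a + 2s + 1) w1 - floor(2s/3), and for s >= 2 the hard codes have size M =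
    6a + 2s at exactly this length. The inequality (d - 2)(d - 3) >= 0 behind the pair count is then
    almost an equality: a block of d points costs (d - 2)(d - 3), an uncovered pair costs 2, and the
    total cost is 2 (2s mod 3). Up to this slack every pair must be covered and every block must
    have 2 or 3 points; the constructions spend the slack on 2s mod 3 blocks with a single point.
    Since M is congruent to 2s modulo 3, this remainder is also the number of points at infinity.
    Moreover only w1 - floor(2s/3) coordinates are left without the letter 1, so blocks lacking
    position 0 have to be counted exactly. *)

Lemma sumn_nth (w : seq nat) : sumn w = \sum_(i < size w) nth 0 w i.
Proof. by rewrite sumnE (big_nth 0) big_mkord. Qed.

Lemma card_support_labels (B : finType) (k : nat) (c : B -> nat) :
  (forall b, c b <= k) ->
  #|[set b | c b != 0]| = \sum_(i < k) #|[set b | c b == i.+1]|.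
Proof.
move=> ck; under eq_bigr do rewrite -sum1dep_card big_mkcond.
rewrite exchange_big -sum1dep_card big_mkcond; apply: eq_bigr => b _ /=.
case E: (c b) => [|m] /=; first by rewrite big1.
have mk : m < k by have := ck b; rewrite E.
rewrite (bigD1 (Ordinal mk)) //= eqxx big1 ?addn0 // => i /eqP ne.
by case: eqP => // -[mi]; case: ne; apply/val_inj.
Qed.

(** At a shared block the labels differ, so two words differ on the whole union of their supports,
    and this has at least 2w - 1 elements. *)
Lemma code_of_labels (w : seq nat) (n : nat) (V B : finType)
    (lab : V -> B -> nat) :
  0 < sumn w ->
  (forall v b, lab v b <= size w) ->
  (forall v (i : 'I_(size w)), #|[set b | lab v b == i.+1]| = nth 0 w i) ->
  (forall u v b, lab u b != 0 -> lab v b = lab u b -> u = v) ->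
  (forall u v b b', u != v -> lab u b != 0 -> lab v b != 0 ->
     lab u b' != 0 -> lab v b' != 0 -> b = b') ->
  #|[set b | [exists v, lab v b != 0]]| <= n ->
  #|V| <= max_ccc (size w).+1 n (2 * sumn w - 1) w.
Proof.
move=> w0 lab_le lab_card lab_inj lab_lin; set S := [set b | _] => Sn.
(* The covered blocks become the first #|S| coordinates; every later coordinate carries the letter
   0. *)
pose lab' v (x : 'I_n) : nat :=
  if (insub (val x) : option 'I_#|S|) is Some i then lab v (enum_val i) else 0.
pose wd v : word (size w).+1 n := [ffun x => inord (lab' v x)].
have wdE v x : wd v x = lab' v x :> nat.
  rewrite ffunE inordK // /lab'; case: insub => // i; exact: lab_le.
have lab'w v (i : 'I_#|S|) : lab' v (widen_ord Sn i) = lab v (enum_val i).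
  by rewrite /lab' /=; case: insubP => [j _ /val_inj ->|]; rewrite ?ltn_ord.
have card_img (P : pred B) (Q : pred 'I_n) : (forall b, P b -> b \in S) ->
    (forall i : 'I_#|S|, Q (widen_ord Sn i) = P (enum_val i)) ->
    (forall x : 'I_n, Q x -> x < #|S|) -> #|[set x | Q x]| = #|[set b | P b]|.
  move=> PS QP Qlt.
  have -> : [set x | Q x] = widen_ord Sn @: [set i | P (enum_val i)].
    apply/setP => x; rewrite inE; apply/idP/imsetP => [Qx|[i]]; last first.
      by rewrite inE -QP => ? ->.
    exists (Ordinal (Qlt _ Qx)); last exact/val_inj.
    by rewrite inE -QP (_ : widen_ord _ _ = x) //; apply/val_inj.
  have -> : [set b | P b] = enum_val @: [set i : 'I_#|S| | P (enum_val i)].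
    apply/setP => b; rewrite inE; apply/idP/imsetP => [Pb|[i]]; last first.
      by rewrite inE => ? ->.
    by exists (enum_rank_in (PS _ Pb) b); rewrite ?inE enum_rankK_in // PS.
  rewrite !card_imset //; first exact: enum_val_inj.
  by move=> i j /(congr1 val) /= /val_inj.
have lab'0 v x : lab' v x != 0 -> x < #|S|.
  by rewrite /lab'; case: insubP => [i ->|].
have suppE v : #|[set b | lab v b != 0]| = sumn w.
  rewrite (@card_support_labels _ (size w)) // sumn_nth.
  by apply: eq_bigr => i _.
have dist u v : u != v -> 2 * sumn w - 1 <= hamming_dist (wd u) (wd v).
  move=> uv.
  rewrite /hamming_dist (card_img (fun b => lab u b != lab v b)); first last.
  - move=> x; rewrite -val_eqE /= !wdE => ne; case: (posnP (lab' u x)) => [u0|].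
      by apply: (lab'0 v); rewrite -u0 eq_sym.
    by rewrite lt0n => /lab'0.
  - by move=> i; rewrite -val_eqE /= !wdE !lab'w.
  - move=> b; rewrite inE; case: (posnP (lab u b)) => [->|u0] ne.
      by apply/existsP; exists v; rewrite eq_sym.
    by apply/existsP; exists u; rewrite -lt0n.
  set U := [set b | lab u b != 0]; set W := [set b | lab v b != 0].
  have -> : [set b | lab u b != lab v b] = U :|: W.
    apply/setP => b; rewrite !inE; case: (eqVneq (lab u b) 0) => [->|u0] /=.
      by rewrite eq_sym.
    by apply: contraNneq uv => E; apply/eqP; apply: (lab_inj u v b).
  rewrite cardsU !suppE.
  suff : #|U :&: W| <= 1 by lia.
  apply/card_le1_eqP => b b'; rewrite !inE => /andP[ub vb] /andP[ub' vb'].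
  exact: (lab_lin u v).
have wd_inj : injective wd.
  move=> u v E; apply/eqP; apply: contraTT w0 => /dist.
  rewrite E /hamming_dist; have -> : [set x | wd v x != wd v x] = set0.
    by apply/setP => x; rewrite !inE eqxx.
  by rewrite cards0; lia.
rewrite -cardsT -(card_imset setT wd_inj).
apply: (@leq_bigmax_cond _ _ (fun C : {set word _ n} => #|C|)).
apply/andP; split.
  apply/forall_inP => _ /imsetP[v _ ->]; apply/eqP.
  apply: (@eq_from_nth _ 0) => [|i]; rewrite size_map size_iota // => iw.
  rewrite (nth_map 0) ?size_iota // nth_iota // add1n.
  rewrite (card_img (fun b => lab v b == i.+1)) ?(lab_card v (Ordinal iw)) //.
  - by move=> b /eqP E; rewrite inE; apply/existsP; exists v; rewrite E.
  - by move=> j; rewrite wdE lab'w.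
  - by move=> x /eqP; rewrite wdE => E; apply: (lab'0 v); rewrite E.
apply/forall_inP => _ /imsetP[u _ ->]; apply/forall_inP => _ /imsetP[v _ ->].
by apply/implyP => ne; apply: dist; apply: contraNneq ne => ->.
Qed.

Lemma missing_color (E : finType) (S : {set E}) (c : E -> nat) (k : nat) :
  #|S| < k -> exists2 i, i < k & forall e, e \in S -> c e != i.
Proof.
move=> Sk; pose T := [set i : 'I_k | [exists e in S, c e == i]].
have /subsetPn[i _ iT] : ~~ ([set: 'I_k] \subset T).
  apply: contraL Sk => /subset_leq_card; rewrite cardsT card_ord -leqNgt.
  move/leq_trans; apply; pose f e : option 'I_k := insub (c e).
  rewrite -(card_imset (mem T) (@Some_inj _)).
  apply: leq_trans (leq_imset_card f _).
  apply/subset_leq_card/subsetP => _ /imsetP[i + ->]; rewrite inE.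
  case/exists_inP => e eS /eqP ce; apply/imsetP; exists e => //.
  by rewrite /f ce valK.
exists i => // e eS; apply: contraNneq iT => ce; rewrite inE.
by apply/exists_inP; exists e => //; apply/eqP.
Qed.

Lemma connect_last (T : finType) (r : rel T) (u v : T) :
  connect r u v -> u = v \/ exists2 t, connect r u t & r t v.
Proof.
case/connectP => p; case/lastP: p => [|p t] /=; first by left.
rewrite rcons_path last_rcons => /andP[pp rt] ->; right.
by exists (last u p) => //; apply/connectP; exists p.
Qed.

(* Koenig's edge colouring theorem for bipartite multigraphs.  If i is missing
   at the source and j at the target of the new edge, swapping i and j on the
   vertices reachable from the target, along i-edges backwards and j-edges
   forwards, frees i at both ends. *)
Lemma konig (E X Y : finType) (src : E -> X) (tgt : E -> Y) (k : nat) :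
  (forall x, #|[set e | src e == x]| <= k) ->
  (forall y, #|[set e | tgt e == y]| <= k) ->
  exists col : E -> nat, [/\ forall e, col e < k,
    forall e e', src e = src e' -> col e = col e' -> e = e' &
    forall e e', tgt e = tgt e' -> col e = col e' -> e = e'].
Proof.
move=> degX degY.
suff main m (A : {set E}) : #|A| = m -> exists col : E -> nat,
    [/\ {in A, forall e, col e < k},
     {in A &, forall e e', src e = src e' -> col e = col e' -> e = e'} &
     {in A &, forall e e', tgt e = tgt e' -> col e = col e' -> e = e'}].
  have [col [c1 c2 c3]] := main _ setT erefl; exists col.
  split=> [e|e e'|e e']; [exact: c1|exact: c2|exact: c3].
elim: m => [|m IHm] in A *.
  by move/cards0_eq => ->; exists (fun=> 0); split=> e; rewrite inE.
case: (set_0Vmem A) => [->|[e0 e0A] Am]; first by rewrite cards0.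
have [|col [colk colX colY]] := IHm (A :\ e0).
  by move: Am; rewrite (cardsD1 e0) e0A => -[].
set A' := A :\ e0 in colk colX colY.
have A'sub e : e \in A -> e != e0 -> e \in A' by rewrite in_setD1 => -> ->.
have e0A' : e0 \notin A' by rewrite in_setD1 eqxx.
have [i ik mi] : exists2 i, i < k &
    forall e, e \in A' -> src e = src e0 -> col e != i.
  have [|i ik mi] := @missing_color E [set e in A' | src e == src e0] col k.
    apply: leq_trans (degX (src e0)); apply/proper_card/properP; split.
      by apply/subsetP => e; rewrite !inE => /andP[_].
    by exists e0; rewrite !inE ?eqxx.
  by exists i => // e eA se; apply: mi; rewrite inE eA se eqxx.
have [j jk mj] : exists2 j, j < k &
    forall e, e \in A' -> tgt e = tgt e0 -> col e != j.
  have [|j jk mj] := @missing_color E [set e in A' | tgt e == tgt e0] col k.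
    apply: leq_trans (degY (tgt e0)); apply/proper_card/properP; split.
      by apply/subsetP => e; rewrite !inE => /andP[_].
    by exists e0; rewrite !inE ?eqxx.
  by exists j => // e eA se; apply: mj; rewrite inE eA se eqxx.
pose r (u v : X + Y) := match u, v with
  | inr y, inl x => [exists e in A', [&& tgt e == y, src e == x & col e == i]]
  | inl x, inr y => [exists e in A', [&& src e == x, tgt e == y & col e == j]]
  | _, _ => false end.
pose R u := connect r (inr (tgt e0)) u.
(* Reachability is constant along edges coloured i or j: as the colouring is proper, the edge by
   which a vertex was entered is the only one of its colour there. *)
have RE e : e \in A' -> (col e == i) || (col e == j) ->
    R (inl (src e)) = R (inr (tgt e)).
  move=> eA /orP[/eqP ci|/eqP cj]; apply/idP/idP => Re.
  - case: (connect_last Re) => // -[[x|y] Ry] //=.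
    case/exists_inP => e' e'A /and3P[/eqP ty /eqP sx /eqP c'].
    by rewrite -(colX e' e) ?ty // c' ci.
  - apply: connect_trans Re (connect1 _) => /=.
    by apply/exists_inP; exists e; rewrite // !eqxx ci eqxx.
  - apply: connect_trans Re (connect1 _) => /=.
    by apply/exists_inP; exists e; rewrite // !eqxx cj eqxx.
  - case: (connect_last Re) => [[/esym ty]|[[x|y] Ry] //=].
      by have := mj e eA ty; rewrite cj eqxx.
    case/exists_inP => e' e'A /and3P[/eqP sx /eqP ty /eqP c'].
    by rewrite -(colY e' e) ?sx // c' cj.
pose sw c := if c == i then j else if c == j then i else c.
have sw_inj : injective sw.
  by move=> c d; rewrite /sw; case: (c =P i); case: (d =P i); case: (c =P j); case: (d =P j); lia.
have swk c : c < k -> sw c < k by rewrite /sw; do !case: eqP.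
pose col' e := if e == e0 then i else
  if R (inl (src e)) then sw (col e) else col e.
have col'Y e : e \in A' ->
    col' e = if R (inr (tgt e)) then sw (col e) else col e.
  move=> eA; rewrite /col'; case: (e =P e0) => [ee0|_]; first by rewrite -ee0 eA in e0A'.
  case cij : ((col e == i) || (col e == j)); first by rewrite (RE _ eA cij).
  have -> : sw (col e) = col e.
    by rewrite /sw; case/norP: (negbT cij) => /negbTE -> /negbTE ->.
  by rewrite !if_same.
(* The source of [e0] could only be entered along an edge coloured i, and that colour is missing
   there, so its colours are not swapped. *)
have col'i e : e \in A' -> src e = src e0 -> col' e != i.
  move=> eA se; rewrite /col'; case: (e =P e0) => [ee0|_]; first by rewrite -ee0 eA in e0A'.
  case: ifP => [|_]; last exact: mi.
  rewrite se => /connect_last[//|[[x|y] _] //=].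
  case/exists_inP => e' e'A /and3P[_ /eqP sx /eqP c'].
  by have := mi e' e'A sx; rewrite c' eqxx.
have col'j e : e \in A' -> tgt e = tgt e0 -> col' e != i.
  move=> eA te; rewrite col'Y // te /R connect0 /sw.
  by have /negbTE cj := mj e eA te; rewrite cj; case: (eqVneq (col e) i) => // <-; rewrite eq_sym cj.
have col'0 : col' e0 = i by rewrite /col' eqxx.
exists col'; split.
- move=> e eA; rewrite /col'; case: (eqVneq e e0) => // ne.
  by have := colk e (A'sub e eA ne); case: ifP => // _ /swk.
- move=> e e' eA e'A.
  case: (eqVneq e e0) => [->|ne]; case: (eqVneq e' e0) => [->|ne'] // se cE.
  + by have := col'i e' (A'sub _ e'A ne') (esym se); rewrite -cE col'0 eqxx.
  + by have := col'i e (A'sub _ eA ne) se; rewrite cE col'0 eqxx.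
  + move: cE; rewrite /col' (negbTE ne) (negbTE ne') se.
    by case: ifP => _ => [/sw_inj|]; apply: colX; rewrite ?A'sub.
- move=> e e' eA e'A.
  case: (eqVneq e e0) => [->|ne]; case: (eqVneq e' e0) => [->|ne'] // se cE.
  + by have := col'j e' (A'sub _ e'A ne') (esym se); rewrite -cE col'0 eqxx.
  + by have := col'j e (A'sub _ eA ne) se; rewrite cE col'0 eqxx.
  + move: cE; rewrite !col'Y ?A'sub // se.
    by case: ifP => _ => [/sw_inj|]; apply: colY; rewrite ?A'sub.
Qed.

Fixpoint fill (k : nat) (s : seq nat) : seq nat :=
  if s is m :: s' then nseq m k ++ fill k.+1 s' else [::].

Lemma size_fill k s : size (fill k s) = sumn s.
Proof. by elim: s k => //= m s IHs k; rewrite size_cat size_nseq IHs. Qed.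

Lemma nth_fill_bound k s i : i < sumn s -> k <= nth 0 (fill k s) i < k + size s.
Proof.
elim: s k i => //= m s IHs k i lt_i; rewrite nth_cat size_nseq nth_nseq.
case: ltnP => im; first by lia.
by have := IHs k.+1 (i - m); lia.
Qed.

Lemma nth_fill_mono k s i j :
  i <= j -> j < sumn s -> nth 0 (fill k s) i <= nth 0 (fill k s) j.
Proof.
elim: s k i j => //= m s IHs k i j ij lt_j; rewrite !nth_cat size_nseq !nth_nseq.
case: (ltnP i m) (ltnP j m) => im [] jm; rewrite ?leqnn //; try lia.
  by have := @nth_fill_bound k.+1 s (j - m); lia.
by apply: IHs; lia.
Qed.

Lemma count_fill k s i : count_mem (k + i) (fill k s) = nth 0 s i.
Proof.
elim: s k i => [|m s IHs] k i /=; first by rewrite nth_nil.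
rewrite count_cat count_nseq /=; case: i => [|i] /=.
  rewrite addn0 eqxx mul1n; apply/eqP; rewrite -[X in _ == X]addn0 eqn_add2l.
  apply/eqP/count_memPn; apply/negP => /(nthP 0)[j]; rewrite size_fill => lt_j.
  by move: (@nth_fill_bound k.+1 s j lt_j) => /[swap] ->; rewrite ltnn.
by rewrite -addSnnS IHs; case: eqP => //; lia.
Qed.

(** By monotonicity all entries between two equal ones are equal, and a letter has at most m
    copies. *)
Lemma fill_gap k s m i j : all (fun x => x <= m) s -> i <= j -> j < sumn s ->
  nth 0 (fill k s) i = nth 0 (fill k s) j -> j - i < m.
Proof.
move=> s_le ij lt_j E; set x := nth 0 _ j in E.
have := nth_fill_bound k lt_j; rewrite -/x => /andP[kx xs].
have lt_x : x - k < size s by lia.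
have : count_mem x (fill k s) <= m.
  rewrite -{1}(subnKC kx) count_fill; exact: (allP s_le) (mem_nth 0 lt_x).
apply: leq_trans; set t := take (j - i).+1 (drop i (fill k s)).
have t_sub : subseq t (fill k s).
  exact: subseq_trans (take_subseq _ _) (drop_subseq _ _).
apply: leq_trans (leq_count_subseq _ t_sub).
have szt : size t = (j - i).+1.
  by rewrite size_take size_drop size_fill; case: ltnP; lia.
suff : all (pred1 x) t by rewrite all_count => /eqP ->; rewrite szt.
apply/(all_nthP 0) => l; rewrite szt => lt_l.
rewrite nth_take // nth_drop /=; apply/eqP/anti_leq/andP; split.
  by apply: nth_fill_mono; lia.
by rewrite -E; apply: nth_fill_mono; lia.
Qed.

(** Extends the edge colours, which only number the blocks holding both positions 1 and 2, to a
    numbering of all blocks where a point has a given position. *)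
Lemma extend_inj (T : finType) (S S0 : {set T}) (f : T -> nat) (k : nat) :
  S0 \subset S -> #|S| = k ->
  {in S0 &, injective f} -> {in S0, forall x, f x < k} ->
  exists g : T -> nat, [/\ {in S0, g =1 f}, {in S &, injective g} &
    {in S, forall x, g x < k}].
Proof.
elim: #|S :\: S0| {-2}S0 f (erefl #|S :\: S0|) => [|m IHm] {}S0 f.
  move/cards0_eq/eqP; rewrite setD_eq0 => S_S0 S0_S _.
  have -> : S = S0 by apply/eqP; rewrite eqEsubset S_S0.
  by exists f; split.
move=> Dm S0S cS f_inj fk.
have /card_gt0P[x] : 0 < #|S :\: S0| by rewrite Dm.
rewrite inE => /andP[xS0 xS].
have [i ik mi] : exists2 i, i < k & forall y, y \in S0 -> f y != i.
  apply: missing_color; rewrite -cS; apply/proper_card/properP.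
  by split=> //; exists x.
pose f' y := if y == x then i else f y.
have [|||y z|y|g [gf gi gk]] := IHm (x |: S0) f' => //.
- by move: Dm; rewrite (cardsD1 x) inE xS xS0 setDDl setUC => -[].
- by rewrite subUset sub1set xS.
- rewrite !inE /f'; case: eqP => [->|_] /=; case: eqP => [->|_] //= yS zS E.
  + by have := mi _ zS; rewrite -E eqxx.
  + by have := mi _ yS; rewrite E eqxx.
  + exact: f_inj.
- by rewrite !inE /f'; case: eqP => //= _ /fk.
exists g; split=> // y yS0; rewrite gf ?inE ?yS0 ?orbT // /f'.
by case: eqP => // yx; rewrite yx (negbTE xS0) in yS0.
Qed.

Lemma card_bij_index (T : finType) (S : {set T}) (g : T -> nat) (k : nat)
    (P : pred nat) :
  #|S| = k -> {in S &, injective g} -> {in S, forall x, g x < k} ->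
  #|[set x in S | P (g x)]| = \sum_(i < k) P i.
Proof.
move=> cS g_inj gk.
have perm_g : perm_eq [seq g x | x <- enum S] (iota 0 k).
  apply: uniq_perm; rewrite ?iota_uniq //.
    by rewrite map_inj_in_uniq ?enum_uniq // => x y; rewrite !mem_enum; apply: g_inj.
  apply/(uniq_min_size _ _ _).2 => //.
  - by rewrite map_inj_in_uniq ?enum_uniq // => x y; rewrite !mem_enum; apply: g_inj.
  - by move=> _ /mapP[x + ->]; rewrite mem_enum mem_iota => /gk.
  - by rewrite size_iota size_map -cardE cS.
have -> : #|[set x in S | P (g x)]| = count P [seq g x | x <- enum S].
  rewrite count_map -size_filter cardE.
  apply/perm_size/uniq_perm => [||x]; rewrite ?enum_uniq //.
    exact: (filter_uniq _ (enum_uniq _)).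
  by rewrite mem_enum inE mem_filter mem_enum andbC.
rewrite (permP perm_g) -sum1_count big_mkcond /=.
by rewrite -{1}[k]subn0 -/(index_iota 0 k) big_mkord.
Qed.

Lemma uniq_map_inj (T1 T2 : eqType) (f : T1 -> T2) (s : seq T1) :
  uniq (map f s) -> {in s &, injective f}.
Proof.
elim: s => //= x s IHs /andP[xs us] y z; rewrite !inE.
case/predU1P => [->|ys]; case/predU1P => [->|zs] // E.
- by rewrite E map_f in xs.
- by rewrite -E map_f in xs.
- exact: IHs.
Qed.

(* The words of a code are read off a system of blocks whose points carry a
   position 0, 1 or 2.  Position 0 becomes the letter 1; positions 1 and 2 at a
   point are numbered so that the two numbers agree in every block containing
   both, and the remaining letters are spread over the consecutive numbers. *)
Lemma code_of_positions (w1 nb na n : nat) (w' : seq nat) (V B : finType)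
    (cont : B -> seq (V * nat)) :
  0 < w1 -> all (fun x => x <= w1) w' -> sumn w' = nb + na ->
  na <= nb -> nb = w1 \/ na = 0 ->
  (forall b, [&& uniq (unzip1 (cont b)), uniq (unzip2 (cont b)) &
                all (fun p => p < 3) (unzip2 (cont b))]) ->
  (forall v p, p < 3 ->
     #|[set b | (v, p) \in cont b]| = nth 0 [:: w1; nb; na] p) ->
  (forall v,
     #|[set b | ((v, 1) \in cont b) && (2 \in unzip2 (cont b))]| <= na) ->
  (forall u v b b', u != v ->
     u \in unzip1 (cont b) -> v \in unzip1 (cont b) ->
     u \in unzip1 (cont b') -> v \in unzip1 (cont b') -> b = b') ->
  w1 * #|V| + #|[set b | (cont b != [::]) && (0 \notin unzip2 (cont b))]| <= n ->
  #|V| <= max_ccc (size w').+2 n (2 * sumn (w1 :: w') - 1) (w1 :: w').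
Proof.
move=> w1_gt0 w'_le sum_w' na_nb nbna cont_ok cnt cnt12 lin size_B.
have vtx_uniq b p u v : (u, p) \in cont b -> (v, p) \in cont b -> u = v.
  case/and3P: (cont_ok b) => _ u2 _ ub vb.
  by have [] := uniq_map_inj u2 ub vb erefl.
have pos_uniq b p q u : (u, p) \in cont b -> (u, q) \in cont b -> p = q.
  case/and3P: (cont_ok b) => u1 _ _ ub vb.
  by have [] := uniq_map_inj u1 ub vb erefl.
have in_pos b v : v \in unzip1 (cont b) ->
    [\/ (v, 0) \in cont b, (v, 1) \in cont b | (v, 2) \in cont b].
  case/mapP => -[x p] xp ->; case/and3P: (cont_ok b) => _ _ /allP/(_ p).
  rewrite (map_f snd xp) => /(_ isT); case: p xp => [|[|[|]]] //= *.
  - exact: Or31.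
  - exact: Or32.
  - exact: Or33.
pose vtx p b := ohead [seq x.1 | x <- cont b & x.2 == p].
have vtxP p b v : (v, p) \in cont b -> vtx p b = Some v.
  move=> vb; rewrite /vtx.
  have : v \in [seq x.1 | x <- cont b & x.2 == p].
    by apply/mapP; exists (v, p); rewrite // mem_filter eqxx.
  case E: [seq x.1 | x <- cont b & x.2 == p] => [//|u s] _ /=; congr Some.
  have : u \in [seq x.1 | x <- cont b & x.2 == p] by rewrite E mem_head.
  case/mapP => -[y q]; rewrite mem_filter /= => /andP[/eqP -> yb] ->.
  exact: vtx_uniq yb vb.
have vtxN p b : p \in unzip2 (cont b) -> exists2 v, vtx p b = Some v & (v, p) \in cont b.
  by case/mapP => -[v q] vq /= ->; exists v => //; apply: vtxP.
pose both b := (1 \in unzip2 (cont b)) && (2 \in unzip2 (cont b)).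
have both1 b v : both b -> vtx 1 b = Some v -> (v, 1) \in cont b.
  by case/andP => /vtxN[u -> ub] _ [<-].
have both2 b v : both b -> vtx 2 b = Some v -> (v, 2) \in cont b.
  by case/andP => _ /vtxN[u -> ub] [<-].
have in2 (b : B) (v : V) p : (v, p) \in cont b -> p \in unzip2 (cont b).
  by move=> vb; rewrite (map_f snd vb).
(* The graph to colour: a block with positions 1 and 2 is an edge from the point at 1 to the point
   at 2. Its degrees are at most [na], on one side by the bound on such blocks, on the other by the
   number of positions 2. *)
have [col [col_lt col1 col2]] : exists col : {b | both b} -> nat,
    [/\ forall e, col e < na,
      forall e e', vtx 1 (val e) = vtx 1 (val e') -> col e = col e' -> e = e' &
      forall e e', vtx 2 (val e) = vtx 2 (val e') -> col e = col e' -> e = e'].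
  have card_sub (P : pred B) : #|[set e : {b | both b} | P (val e)]| <=
      #|[set b | both b && P b]|.
    rewrite -(card_imset _ val_inj); apply/subset_leq_card/subsetP => b.
    by case/imsetP => e; rewrite !inE => Pe ->; rewrite (valP e).
  apply: konig => -[v|].
  - apply: leq_trans (card_sub (fun b => vtx 1 b == Some v)) _.
    apply: leq_trans (cnt12 v); apply/subset_leq_card/subsetP => b.
    rewrite !inE => /andP[bb /eqP/(both1 _ _ bb) ->].
    by case/andP: bb.
  - apply: leq_trans (card_sub (fun b => vtx 1 b == None)) _.
    rewrite eq_card0 // => b; rewrite !inE.
    by apply/negP => /andP[/andP[/vtxN[u ->]]].
  - apply: leq_trans (card_sub (fun b => vtx 2 b == Some v)) _.
    have := cnt v 2 isT => /= <-; apply/subset_leq_card/subsetP => b.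
    by rewrite !inE => /andP[bb /eqP/(both2 _ _ bb) ->].
  - apply: leq_trans (card_sub (fun b => vtx 2 b == None)) _.
    rewrite eq_card0 // => b; rewrite !inE.
    by apply/negP => /andP[/andP[_ /vtxN[u ->]]].
pose c b : nat := if insub b is Some e then col e else 0.
have cE b (bb : both b) : c b = col (exist _ b bb).
  by rewrite /c insubT.
have index p v : 0 < p < 3 -> exists g : B -> nat,
    [/\ forall b, both b -> (v, p) \in cont b -> g b = c b,
      {in [set b | (v, p) \in cont b] &, injective g} &
      {in [set b | (v, p) \in cont b],
        forall b, g b < nth 0 [:: w1; nb; na] p}].
  move=> p3; set S := [set b | _].
  have S0S : [set b in S | both b] \subset S.
    by apply/subsetP => b; rewrite inE => /andP[].
  have [||g [gf gi gk]] := extend_inj S0S (cnt v p (andP p3).2) (f := c).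
  - move=> b b'; rewrite !inE => /andP[vb bb] /andP[vb' bb'].
    rewrite !cE => cc; suff [] : exist both b bb = exist both b' bb' by [].
    case: p p3 {S S0S} vb vb' => [|[|[|//]]] // _ vb vb'.
    + by apply: col1 => //=; rewrite !(vtxP _ _ v).
    + by apply: col2 => //=; rewrite !(vtxP _ _ v).
  - move=> b; rewrite !inE => /andP[vb bb]; rewrite cE.
    apply: leq_trans (col_lt _) _.
    by case: p p3 {S S0S vb} => [|[|[|//]]] //=.
  - exists g; split=> // b bb vb; apply: gf; rewrite !inE vb bb //.
have [gb gbP] := fin_all_exists (fun v => @index 1 v isT).
have [ga gaP] := fin_all_exists (fun v => @index 2 v isT).
pose F := fill 2 w'.
pose lab v b := if (v, 0) \in cont b then 1
  else if (v, 1) \in cont b then nth 0 F (gb v b)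
  else if (v, 2) \in cont b then nth 0 F (nb + ga v b) else 0.
have lab0 v b : (v, 0) \in cont b -> lab v b = 1 by rewrite /lab => ->.
have lab1 v b : (v, 1) \in cont b -> lab v b = nth 0 F (gb v b).
  by move=> vb; rewrite /lab vb; case: ifP => // /(pos_uniq _ _ _ _ vb).
have lab2 v b : (v, 2) \in cont b -> lab v b = nth 0 F (nb + ga v b).
  move=> vb; rewrite /lab vb; case: ifP => [/(pos_uniq _ _ _ _ vb) //|_].
  by case: ifP => // /(pos_uniq _ _ _ _ vb).
have gb_lt v b : (v, 1) \in cont b -> gb v b < nb.
  by move=> vb; have [_ _] := gbP v; apply; rewrite inE.
have ga_lt v b : (v, 2) \in cont b -> ga v b < na.
  by move=> vb; have [_ _] := gaP v; apply; rewrite inE.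
have F_bound i : i < nb + na -> 1 < nth 0 F i < 2 + size w'.
  by rewrite -sum_w'; apply: nth_fill_bound.
have labF v b l : lab v b = l.+2 ->
    (v, 1) \in cont b \/ (v, 2) \in cont b.
  by rewrite /lab; case: ifP => // _; case: ifP => [|_]; [left|case: ifP; right].
have lab_nz v b : (lab v b != 0) = (v \in unzip1 (cont b)).
  apply/idP/idP => [|/in_pos[]vb].
  - by rewrite /lab; do 3?[case: ifP => [vb _|_]; first exact: (map_f fst vb)].
  - by rewrite lab0.
  - by rewrite lab1 //; have := F_bound (gb v b); have := gb_lt v b vb; lia.
  - by rewrite lab2 //; have := F_bound (nb + ga v b); have := ga_lt v b vb; lia.
apply: (@code_of_labels (w1 :: w') n V B lab) => [|v b|v|u v b|u v b b'|].
- by rewrite /=; lia.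
- rewrite /lab /=; case: ifP => // _; case: ifP => [/gb_lt|_].
    by move=> lt_g; have := F_bound (gb v b); lia.
  case: ifP => // /ga_lt lt_g; have := F_bound (nb + ga v b); lia.
- case=> [[|i] /= lt_i].
    rewrite -[RHS](cnt v 0 isT); apply: eq_card => b; rewrite !inE.
    apply/idP/idP => [|/lab0 -> //]; rewrite /lab; case: ifP => // _.
    case: ifP => [/gb_lt|_].
      by move=> lt_g; have := F_bound (gb v b); lia.
    by case: ifP => // /ga_lt lt_g; have := F_bound (nb + ga v b); lia.
  pose S p := [set b | (v, p) \in cont b].
  have -> : [set b | lab v b == i.+2] =
      [set b in S 1 | nth 0 F (gb v b) == i.+2] :|:
      [set b in S 2 | nth 0 F (nb + ga v b) == i.+2].
    apply/setP => b; rewrite !inE; apply/idP/orP => [/eqP E|[]/andP[vb]].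
    - case: (labF _ _ _ E) => vb; [left|right]; rewrite vb -E.
        by rewrite lab1 ?eqxx.
      by rewrite lab2 ?eqxx.
    - by rewrite lab1.
    - by rewrite lab2.
  rewrite cardsU (_ : _ :&: _ = set0) ?cards0 ?subn0; last first.
    apply/setP => b; rewrite !inE; apply/negP => /andP[/andP[v1 _] /andP[v2 _]].
    by have := pos_uniq _ _ _ _ v1 v2.
  have [_ gb_inj gb_k] := gbP v; have [_ ga_inj ga_k] := gaP v.
  rewrite (card_bij_index (fun j => nth 0 F j == i.+2) (cnt v 1 isT)) //.
  rewrite (card_bij_index (fun j => nth 0 F (nb + j) == i.+2) (cnt v 2 isT)) //=.
  rewrite -(count_fill 2) add2n -/F -sum1_count (big_nth 0) size_fill sum_w'.
  rewrite big_mkord big_split_ord /=.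
  by congr (_ + _); rewrite [RHS]big_mkcond; apply: eq_bigr => j _; case: ifP.
- have gap x y : (x, 1) \in cont b -> (y, 2) \in cont b -> lab x b <> lab y b.
    move=> xb yb; have bb : both b by rewrite /both (in2 _ _ _ xb) (in2 _ _ _ yb).
    rewrite lab1 // lab2 //; have [-> // _ _] := gbP x; have [-> // _ _] := gaP y.
    have c_na : c b < na by rewrite cE.
    case: nbna => [nbw|na0]; last by rewrite na0 in c_na.
    by move/(fill_gap w'_le); rewrite sum_w'; lia.
  have gt1 x p : (x, p) \in cont b -> 0 < p < 3 -> 1 < lab x b.
    case: p => [|[|[|//]]] // xb _.
      by rewrite lab1 //; have := F_bound (gb x b); have := gb_lt _ _ xb; lia.
    by rewrite lab2 //; have := F_bound (nb + ga x b); have := ga_lt _ _ xb; lia.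
  rewrite lab_nz => ub E; have : v \in unzip1 (cont b) by rewrite -lab_nz E lab_nz.
  case/in_pos: ub => ub /in_pos[] vb; try exact: vtx_uniq ub vb.
  + by have := gt1 _ _ vb isT; rewrite E lab0.
  + by have := gt1 _ _ vb isT; rewrite E lab0.
  + by have := gt1 _ _ ub isT; rewrite -E lab0.
  + by case: (gap u v).
  + by have := gt1 _ _ ub isT; rewrite -E lab0.
  + by case: (gap v u).
- by rewrite !lab_nz; apply: lin.
- apply: leq_trans size_B.
  apply: (@leq_trans (#|[set b | 0 \in unzip2 (cont b)]| +
      #|[set b | (cont b != [::]) && (0 \notin unzip2 (cont b))]|)).
    apply: leq_trans (leq_card_setU _ _); apply/subset_leq_card/subsetP => b.
    rewrite !inE => /existsP[v]; rewrite lab_nz; case: (0 \in _) => //=.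
    by case: (cont b).
  rewrite leq_add2r mulnC -sum_nat_const.
  have -> : \sum_(v : V) w1 = \sum_v \sum_b (if (v, 0) \in cont b then 1 else 0).
    by apply: eq_bigr => v _; rewrite -big_mkcond sum1dep_card cnt.
  rewrite exchange_big -sum1dep_card big_mkcond /=; apply: leq_sum => b _.
  by case: ifP => // /vtxN[v _ vb]; rewrite (bigD1 v) //= vb.
Qed.

Lemma card_le_index (T : finType) (S : {set T}) (g : T -> nat) (k : nat) :
  {in S &, injective g} -> {in S, forall x, g x < k} -> #|S| <= k.
Proof.
move=> g_inj gk; rewrite cardE -(size_map g) -(size_iota 0 k).
apply: uniq_leq_size => [|_ /mapP[x + ->]].
  by rewrite map_inj_in_uniq ?enum_uniq // => x y; rewrite !mem_enum; apply: g_inj.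
by rewrite mem_enum mem_iota => /gk.
Qed.

(** * Regular linear triple systems *)

Section RegularTriples.

Variables (V T : finType) (tr : T -> 'I_3 -> V).

Hypothesis tr_inj : forall t, injective (tr t).
Hypothesis tr_lin : forall t t' k l k' l',
  tr t k = tr t' k' -> tr t l = tr t' l' -> k != l -> t = t'.

Let deg v := [set e : T * 'I_3 | tr e.1 e.2 == v].

(** Each triple at [v] supplies two further points, and linearity makes all of these distinct. *)
Lemma triple_degree_double v : 2 * #|deg v| < #|V|.
Proof.
pose nx (i : bool) (k : 'I_3) : 'I_3 := if i then ordS k else ordS (ordS k).
have nxk i k : k != nx i k.
  by case: i; case: k => -[|[|[|k]]] kk.
have nx_inj k i j : nx i k = nx j k -> i = j.
  by case: i; case: j => //; case: k => -[|[|[|k]]] kk // /(congr1 val).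
pose f (x : T * 'I_3 * bool) := tr x.1.1 (nx x.2 x.1.2).
have f_inj : {in setX (deg v) setT &, injective f}.
  move=> [[t k] i] [[t' k'] j]; rewrite !inE /f /= !andbT => /eqP vk /eqP vk' E.
  have tt' : t = t'.
    exact: (tr_lin (etrans vk (esym vk')) E (nxk i k)).
  subst t'; have kk' : k = k' by apply: (@tr_inj t); rewrite vk vk'.
  by subst k'; have /nx_inj -> := tr_inj E.
have : #|f @: setX (deg v) setT| <= #|[set~ v]|.
  apply/subset_leq_card/subsetP => _ /imsetP[[[t k] i] + ->].
  rewrite !inE /f /= andbT => /eqP <-; apply: contra_neq (nxk i k).
  by move/tr_inj.
have V_gt0 : 0 < #|V| by apply/card_gt0P; exists v.
rewrite card_in_imset // cardsX cardsT card_bool cardsC1; lia.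
Qed.

Variable a : nat.
Hypothesis card_T : a * #|V| <= #|T|.
Hypothesis card_V : #|V| <= 6 * a + 2.

Lemma triple_degree_le v : #|deg v| <= 3 * a.
Proof. by have := triple_degree_double v; lia. Qed.

(** No degree exceeds 3a, and there are enough triples for the average degree to be at least 3a. *)
Lemma triple_degree v : #|deg v| = 3 * a.
Proof.
have sum_deg : \sum_v #|deg v| = 3 * #|T|.
  under eq_bigr do rewrite -sum1dep_card big_mkcond /=.
  rewrite exchange_big /= (eq_bigr (fun=> 1)) => [|e _].
    by rewrite sum1_card card_prod card_ord mulnC.
  rewrite (bigD1 (tr e.1 e.2)) //= eqxx big1 // => u /negbTE.
  by rewrite eq_sym => ->.
apply/eqP; rewrite eqn_leq triple_degree_le /= leqNgt; apply/negP => lt_v.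
have : \sum_u #|deg u| < \sum_(u : V) 3 * a.
  rewrite (bigD1 v) //= [X in _ < X](bigD1 v) //= -addSn leq_add //.
  by apply: leq_sum => u _; apply: triple_degree_le.
rewrite sum_deg sum_nat_const mulnCA mulnA -mulnA ltn_mul2l /= mulnC.
by rewrite ltnNge card_T.
Qed.

End RegularTriples.

(** The 3a triples at a point are cut into a groups of three. Colouring the bipartite graph of
    triples against groups, of degree 3, with three colours yields the positions: a colour occurs
    once in each triple and once in each group, hence a times at each point. *)
Lemma code_of_triples (V T : finType) (tr : T -> 'I_3 -> V) (a n : nat)
    (w' : seq nat) :
  0 < a -> all (fun x => x <= a) w' -> sumn w' = a + a ->
  (forall t, injective (tr t)) ->
  (forall t t' k l k' l',
     tr t k = tr t' k' -> tr t l = tr t' l' -> k != l -> t = t') ->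
  a * #|V| <= #|T| -> #|V| <= 6 * a + 2 -> a * #|V| <= n ->
  #|V| <= max_ccc (size w').+2 n (2 * sumn (a :: w') - 1) (a :: w').
Proof.
move=> a_gt0 w'_le sum_w' tr_inj tr_lin cT cV size_n.
pose deg v := [set e : T * 'I_3 | tr e.1 e.2 == v].
have cdeg v : #|deg v| = 3 * a by apply: triple_degree.
pose rank e := index e (enum (deg (tr e.1 e.2))).
have rank_lt e : rank e < 3 * a.
  by rewrite -(cdeg (tr e.1 e.2)) cardE index_mem mem_enum inE.
have rank_inj e e' : tr e.1 e.2 = tr e'.1 e'.2 -> rank e = rank e' -> e = e'.
  move=> E; rewrite /rank E => Ei.
  by apply: (index_inj e _ _ Ei); rewrite mem_enum inE ?E.
pose tgt e := (tr e.1 e.2, insub (rank e %/ 3) : option 'I_a).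
have tgtE x y : tgt x = tgt y ->
    tr x.1 x.2 = tr y.1 y.2 /\ rank x %/ 3 = rank y %/ 3.
  have key z : omap val (insub (rank z %/ 3) : option 'I_a) = Some (rank z %/ 3).
    by case: insubP => [i _ <- //|]; rewrite ltn_divLR // mulnC rank_lt.
  by case=> -> /(congr1 (omap val)); rewrite !key => -[].
have [col [col_lt colX colY]] : exists col : T * 'I_3 -> nat,
    [/\ forall e, col e < 3,
      forall e e', e.1 = e'.1 -> col e = col e' -> e = e' &
      forall e e', tgt e = tgt e' -> col e = col e' -> e = e'].
  apply: konig => [t|y].
  - apply: (@card_le_index _ _ (fun e => val e.2)) => [[t1 k1] [t2 k2]|[t1 k1] _].
      by rewrite !inE => /eqP /= -> /eqP /= -> /val_inj ->.
    exact: ltn_ord.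
  - apply: (@card_le_index _ _ (fun e => rank e %% 3)) => [e e'|e _]; last first.
      by rewrite ltn_mod.
    rewrite !inE => /eqP E /eqP E' Em; have [Et Ed] := tgtE e e' (etrans E (esym E')).
    by apply: rank_inj => //; rewrite (divn_eq (rank e) 3) Em Ed -divn_eq.
pose cont t := [seq (tr t k, col (t, k)) | k <- enum 'I_3].
have contP t v p : reflect (exists2 k, tr t k = v & col (t, k) = p)
    ((v, p) \in cont t).
  apply: (iffP mapP) => [[k _ [-> ->]]|[k <- <-]]; exists k => //.
  by rewrite mem_enum.
have cnt_le v p : #|[set e in deg v | col e == p]| <= a.
  apply: (@card_le_index _ _ (fun e => rank e %/ 3)) => [e e'|e _]; last first.
    by rewrite ltn_divLR // mulnC.
  rewrite !inE => /andP[/eqP ve /eqP ce] /andP[/eqP ve' /eqP ce'] Er.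
  by apply: colY; rewrite ?ce ?ce' // /tgt ve ve' Er.
have cnt v p : p < 3 -> #|[set e in deg v | col e == p]| = a.
  have : \sum_(q < 3) #|[set e in deg v | col e == q]| = 3 * a.
    rewrite -(cdeg v) -sum1_card.
    transitivity (\sum_(q < 3) \sum_(e in deg v) (col e == q : nat)).
      apply: eq_bigr => q _; rewrite -sum1_card big_mkcond [RHS]big_mkcond.
      by apply: eq_bigr => e _; rewrite !inE; case: eqP => //=; case: eqP.
    rewrite exchange_big /=; apply: eq_bigr => e _.
    rewrite (bigD1 (Ordinal (col_lt e))) //= eqxx big1 // => i ne.
    by case: eqP => // E; case/eqP: ne; apply/val_inj; rewrite /= E.
  rewrite !big_ord_recl big_ord0 /= /bump /= !addn0 -[1 + 1]/2 => S.
  by have := cnt_le v 0; have := cnt_le v 1; have := cnt_le v 2;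
     case: p => [|[|[|//]]] /=; lia.
apply: (@code_of_positions a a a n w' V T cont) => //.
- by left.
- move=> t; rewrite /unzip1 /unzip2 -(map_comp fst) -(map_comp snd); apply/and3P; split.
  + by rewrite map_inj_uniq; [exact: enum_uniq|move=> k l /= /tr_inj].
  + rewrite map_inj_uniq; first exact: enum_uniq.
    by move=> k l /= E; have [] : (t, k) = (t, l) by apply: colX.
  + by apply/allP => _ /mapP[k _ ->]; apply: col_lt.
- move=> v p p3; rewrite -[RHS](_ : a = _); last by case: p p3 => [|[|[|]]].
  rewrite -(cnt v p p3) -(@card_in_imset _ _ fst [set e in deg v | col e == p]).
    apply: eq_card => t; rewrite inE; apply/contP/imsetP => [[k tv ct]|[[t' k]]].
      by exists (t, k); rewrite // !inE /= tv ct !eqxx.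
    by rewrite !inE => /andP[/eqP /= tv /eqP ct] ->; exists k.
  move=> e e'; rewrite !inE => /andP[_ /eqP ce] /andP[_ /eqP ce'] E.
  by apply: colX; rewrite ?ce ?ce'.
- move=> v; rewrite -(cnt v 1 isT).
  rewrite -(@card_in_imset _ _ fst [set e in deg v | col e == 1]).
    apply/subset_leq_card/subsetP => t; rewrite inE => /andP[/contP[k tv ct] _].
    by apply/imsetP; exists (t, k); rewrite // !inE /= tv ct !eqxx.
  move=> e e'; rewrite !inE => /andP[_ /eqP ce] /andP[_ /eqP ce'] E.
  by apply: colX; rewrite ?ce ?ce'.
- have inP u t : u \in unzip1 (cont t) -> exists k, tr t k = u.
    by case/mapP => _ /mapP[k _ ->] ->; exists k.
  move=> u v t t' uv /inP[k uk] /inP[l vl] /inP[k' uk'] /inP[l' vl'].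
  apply: (@tr_lin t t' k l k' l'); rewrite ?uk ?vl //.
  by apply: contraNneq uv => kl; rewrite -uk -vl kl.
- rewrite (_ : [set t | _] = set0) ?cards0 ?addn0 //.
  apply/setP => t; rewrite !inE; apply/negP => /andP[_ /negP]; apply.
  pose f (k : 'I_3) : 'I_3 := Ordinal (col_lt (t, k)).
  have f_inj : injective f.
    by move=> k l /(congr1 val) /= E; have [] : (t, k) = (t, l) by apply: colX.
  have [g _ fg] := injF_bij f_inj; apply/mapP; exists (tr t (g ord0), 0) => //.
  by apply/contP; exists (g ord0); rewrite // -[RHS](congr1 val (fg ord0)).
Qed.

(** * The pair count and asymptotic existence *)

Section Bounds.

Variables (w : seq nat) (n : nat) (C : {set word (size w).+1 n}).
Hypothesis C_ccc : is_ccc (2 * sumn w - 1) w C.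

Let supp (u : word (size w).+1 n) := [set x | (u x : nat) != 0].

Lemma ccc_letter u (i : nat) : u \in C -> i < size w ->
  #|[set x | (u x : nat) == i.+1]| = nth 0 w i.
Proof.
move=> uC iw; case/andP: C_ccc => /forall_inP/(_ u uC)/eqP wu _.
by have := congr1 (fun s => nth 0 s i) wu; rewrite (nth_map 0) ?size_iota // nth_iota // add1n.
Qed.

Lemma ccc_support u : u \in C -> #|supp u| = sumn w.
Proof.
move=> uC; rewrite (@card_support_labels _ (size w) (fun x => u x)) => [|x].
  by rewrite sumn_nth; apply: eq_bigr => i _; apply: ccc_letter.
by rewrite -ltnS.
Qed.

(** Differences occur only in the union of the supports, of size 2w minus the overlap. An overlap of
    two coordinates, or an agreement inside it, would push the distance below 2w - 1. *)
Lemma ccc_support_dist u v : u \in C -> v \in C -> u != v ->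
  (#|supp u :&: supp v| <= 1) *
  (forall x, (u x : nat) != 0 -> u x != v x).
Proof.
move=> uC vC uv.
have d_ge : 2 * sumn w - 1 <= hamming_dist u v.
  by case/andP: C_ccc => _ /forall_inP/(_ u uC)/forall_inP/(_ v vC)/implyP; apply.
have d_sub : [set x | u x != v x] \subset supp u :|: supp v.
  apply/subsetP => x; rewrite !inE; apply: contraR; rewrite negb_or !negbK.
  by case/andP => /eqP ux /eqP vx; apply/eqP/val_inj; rewrite /= ux vx.
have cU : #|supp u :|: supp v| = 2 * sumn w - #|supp u :&: supp v|.
  by rewrite cardsU !ccc_support // addnn mul2n.
split=> [|x ux].
  have := leq_trans d_ge (subset_leq_card d_sub); rewrite cU.
  have := subset_leq_card (subsetIl (supp u) (supp v)).
  by rewrite ccc_support //; lia.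
apply: contraTneq d_ge => uvx; rewrite -ltnNge.
have xI : x \in supp u :&: supp v by rewrite !inE -uvx ux.
have /subset_leq_card : [set x | u x != v x] \subset (supp u :|: supp v) :\ x.
  apply/subsetP => y yd; rewrite in_setD1 (subsetP d_sub) // andbT.
  by apply: contraTneq yd => ->; rewrite inE uvx eqxx.
have := cardsD1 x (supp u :|: supp v); rewrite cU.
have -> : x \in supp u :|: supp v by rewrite !inE ux.
have : 0 < #|supp u :&: supp v| by apply/card_gt0P; exists x.
rewrite /hamming_dist add1n.
move: #|_ :&: _| #|_ :\ x| #|[set x | _]| => I K d; lia.
Qed.

(** At a coordinate at most one word has the letter 1, and each word needs it [comp1 w] times. *)
Lemma ccc_johnson : 0 < size w -> #|C| * comp1 w <= n.
Proof.
move=> sw; rewrite -sum_nat_const.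
have -> : \sum_(u in C) comp1 w = \sum_(u in C) \sum_x ((u x : nat) == 1 : nat).
  apply: eq_bigr => u uC; rewrite -[comp1 w](ccc_letter uC sw) -sum1dep_card.
  by rewrite big_mkcond; apply: eq_bigr => x _; case: eqP.
rewrite exchange_big -[X in _ <= X]card_ord -sum1_card; apply: leq_sum => x _.
case: (pickP (fun u => (u \in C) && ((u x : nat) == 1))) => [u /andP[uC /eqP ux]|none].
  rewrite (bigD1 u) //= ux eqxx big1 // => v /andP[vC vu].
  case: eqP => // vx; have [_ /(_ x)] := ccc_support_dist vC uC vu.
  by rewrite -val_eqE /= ux vx => /(_ isT).
by rewrite big1 // => u uC; have := none u; rewrite uC /= => ->.
Qed.

(** This is the sum of (d - l)(d - l - 1) >= 0 over the coordinates, d being the number of words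
    that are nonzero there; l stands for lambda - 1. *)
Lemma ccc_pair_count l :
  2 * l * (#|C| * sumn w) + #|C| <= #|C| * #|C| + l * (l + 1) * n.
Proof.
pose d x := \sum_(u in C) (x \in supp u : nat).
have sum_d : \sum_x d x = #|C| * sumn w.
  rewrite exchange_big -sum_nat_const; apply: eq_bigr => u uC.
  by rewrite -(ccc_support uC) -sum1_card [RHS]big_mkcond.
have sum_dd : \sum_x d x * d x + #|C| <= #|C| * sumn w + #|C| * #|C|.
  have -> : \sum_x d x * d x = \sum_(u in C) \sum_(v in C) #|supp u :&: supp v|.
    transitivity (\sum_x \sum_(u in C) \sum_(v in C) (x \in supp u) * (x \in supp v)).
      apply: eq_bigr => x _; rewrite big_distrl; apply: eq_bigr => u _.
      by rewrite big_distrr.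
    rewrite exchange_big; apply: eq_bigr => u uC.
    rewrite exchange_big; apply: eq_bigr => v vC /=.
    rewrite -sum1_card [RHS]big_mkcond; apply: eq_bigr => x _.
    by rewrite in_setI; case: (x \in supp u); case: (x \in supp v).
  rewrite -!sum_nat_const -sum1_card -!big_split /=; apply: leq_sum => u uC.
  rewrite (bigD1 u) //= setIid ccc_support // -addnA leq_add2l.
  rewrite [X in _ <= X](bigD1 u) //= addnC leq_add2l.
  by apply: leq_sum => v /andP[vC vu]; case: (ccc_support_dist uC vC) => //; rewrite eq_sym.
have sq x : 2 * l * d x + d x <= d x * d x + l * (l + 1).
  by case: (leqP (d x) l) => ?; nia.
have : \sum_x (2 * l * d x + d x) <= \sum_(x < n) (d x * d x + l * (l + 1)).
  by apply: leq_sum => x _; apply: sq.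
rewrite !big_split /= sum_nat_const card_ord -big_distrr /= sum_d.
move: sum_dd; move: (\sum_x _) #|C| (sumn w) => S m W.
by nia.
Qed.

End Bounds.

Lemma max_ccc_johnson (w : seq nat) (n : nat) :
  0 < sumn w -> 0 < size w -> 0 < comp1 w ->
  max_ccc (size w).+1 n (2 * sumn w - 1) w <= n %/ comp1 w.
Proof.
move=> w0 sw c0; apply/bigmax_leqP => C hC.
by rewrite leq_divRL //; apply: ccc_johnson.
Qed.

Lemma max_ccc_pair_count (w : seq nat) (n l : nat) : 0 < sumn w ->
  2 * l * (max_ccc (size w).+1 n (2 * sumn w - 1) w * sumn w) +
      max_ccc (size w).+1 n (2 * sumn w - 1) w <=
    max_ccc (size w).+1 n (2 * sumn w - 1) w ^ 2 + l * (l + 1) * n.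
Proof.
move=> w0; have h0 : is_ccc (2 * sumn w - 1) w (set0 : {set word (size w).+1 n}).
  by apply/andP; split; apply/forall_inP => u; rewrite inE.
rewrite /max_ccc.
have [C hC ->] := eq_bigmax_cond (fun C : {set word (size w).+1 n} => #|C|)
      (introT card_gt0P (ex_intro _ set0 h0)).
by rewrite -mulnn; apply: ccc_pair_count.
Qed.

Lemma pow2_sidon a b c d : 2 ^ a + 2 ^ b = 2 ^ c + 2 ^ d ->
  a = c \/ a = d.
Proof.
have P x : 0 < 2 ^ x by rewrite expn_gt0.
elim: a b c d => [|a IHa] [|b] [|c] [|d]; rewrite ?expnS ?expn0 => E;
  try (by left); try (by right).
- by have := P c; have := P d; lia.
- by lia.
- by lia.
- by right; congr _.+1; apply: (@expnI 2) => //; lia.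
- by left; congr _.+1; apply: (@expnI 2) => //; lia.
- by lia.
- by have := P a; have := P b; lia.
- by lia.
- by lia.
- by have [||] := IHa b c d; [lia|left; congr _.+1|right; congr _.+1].
Qed.

Lemma card_ord_lt k m : m <= k -> #|[set j : 'I_k | j < m]| = m.
Proof.
move=> mk; rewrite -sum1dep_card big_mkcond /=.
rewrite -(big_mkord xpredT (fun j => if j < m then 1 else 0)).
rewrite (big_cat_nat (n := m)) //= -[RHS]addn0; congr (_ + _).
  rewrite -[RHS]muln1 -[m in RHS]subn0 -sum_nat_const_nat.
  by apply: eq_big_nat => j /andP[_ ->].
by rewrite big_nat big1 // => j /andP[mj _]; rewrite ltnNge mj.
Qed.

Lemma natZp_inj (M i j : nat) : i < M -> j < M -> 1 < M ->
  (i%:R = j%:R :> 'Z_M)%R -> i = j.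
Proof.
by move=> iM jM M1 /(congr1 val) /=; rewrite !val_Zp_nat // !modn_small.
Qed.

Lemma code_of_powers (w : seq nat) : 0 < size w -> is_composition w ->
  exists n0, forall n, n0 <= n ->
    n %/ comp1 w <= max_ccc (size w).+1 n (2 * sumn w - 1) w.
Proof.
move=> sw /andP[w_sorted w_pos].
have w1_gt0 : 0 < comp1 w by apply: (allP w_pos); rewrite mem_nth.
have w_le i : nth 0 w i <= comp1 w.
  case: (ltnP i (size w)) => iw; last by rewrite nth_default.
  rewrite -(subnK (leq0n i)) addn0 subn0.
  exact: (sorted_leq_nth (leT := geq) (fun y x z xy yz => leq_trans yz xy)
    leqnn 0 w_sorted 0 i sw iw (leq0n i)).
have sum_gt0 : 0 < sumn w.
  by rewrite sumn_nth (bigD1 (Ordinal sw)) //= -/(comp1 w); lia.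
pose k := size w; pose e j (l : 'I_k) := j * k + l.
have e_inj j j' l l' : e j l = e j' l' -> j = j' /\ l = l'.
  move=> E; have k_gt0 : 0 < k by [].
  have jj : j = j'.
    by have := congr1 (divn^~ k) E; rewrite !divnMDl ?divn_small ?addn0.
  by split=> //; apply/val_inj; move: E; rewrite /e jj => /addnI.
pose K := 2 ^ (comp1 w * k + k).
have e_lt j l : j < comp1 w -> 2 * 2 ^ e j l < 2 * K.
  move=> jw; rewrite ltn_mul2l ltn_exp2l // /e; have := ltn_ord l.
  by have := leq_mul jw (leqnn k); lia.
exists (2 * K * comp1 w) => n n_ge; set M := n %/ comp1 w.
have MK : 2 * K <= M by rewrite leq_divRL.
have K_gt0 : 0 < K by rewrite expn_gt0.
have M1 : 1 < M by lia.
have cM : #|'Z_M| = M by rewrite card_ord Zp_cast.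
pose t j l : 'Z_M := ((2 ^ e j l)%:R)%R.
pose hit (v : 'Z_M) (b : 'Z_M * 'I_(comp1 w)) (l : 'I_k) :=
  (b.2 < nth 0 w l) && (v == b.1 + t b.2 l)%R.
have t_inj j j' l l' : j < comp1 w -> j' < comp1 w -> t j l = t j' l' ->
    j = j' /\ l = l'.
  move=> jw jw' /natZp_inj E; apply/e_inj/(@expnI 2 isT)/E => //.
    by have := e_lt _ l jw; lia.
  by have := e_lt _ l' jw'; lia.
have hit_inj v b l l' : hit v b l -> hit v b l' -> l = l'.
  case/andP => _ /eqP -> /andP[_ /eqP/addrI].
  by case/t_inj; rewrite ?ltn_ord.
pose lab v b := if [pick l | hit v b l] is Some l then (val l).+1 else 0.
have labP v b (l : 'I_k) : (lab v b == l.+1) = hit v b l.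
  rewrite /lab; case: pickP => [m hm|none]; last by rewrite none.
  apply/eqP/idP => [[/val_inj <-]//|hl]; by rewrite (hit_inj _ _ _ _ hm hl).
have lab_hit v b : lab v b != 0 -> exists l, hit v b l.
  by rewrite /lab; case: pickP => // l; exists l.
rewrite -[X in X <= _]cM.
apply: (@code_of_labels w n _ _ lab) => //.
- by move=> v b; rewrite /lab; case: pickP => // l _; apply: ltn_ord.
- move=> v i; rewrite -(card_ord_lt (w_le i)).
  rewrite -(card_imset _ (f := fun j => ((v - t (val j) i)%R, j))) => [|j j' []] //.
  apply: eq_card => -[g j]; rewrite inE labP; apply/andP/imsetP => /=.
    by case=> jw /eqP ->; exists j; rewrite ?inE // addrK.
  by case=> j'; rewrite inE => jw [-> ->]; rewrite jw subrK.
- move=> u v b /lab_hit[l hl]; have := hl; rewrite -labP => /eqP -> /eqP.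
  by rewrite labP => /andP[_ /eqP ->]; case/andP: hl => _ /eqP.
- move=> u v [g j] [g' j'] uv /lab_hit[l /andP[_ /eqP /= ul]].
  move=> /lab_hit[m /andP[_ /eqP /= vm]] /lab_hit[l' /andP[_ /eqP /= ul']].
  move=> /lab_hit[m' /andP[_ /eqP /= vm']].
  have : ((2 ^ e j l + 2 ^ e j' m')%N%:R = (2 ^ e j' l' + 2 ^ e j m)%N%:R :> 'Z_M)%R.
    rewrite !natrD; apply: (@addrI _ (g + g')%R).
    by rewrite addrACA -ul -vm' [(g + g')%R]addrC addrACA -ul' -vm.
  move/natZp_inj => E; have /pow2_sidon[] : 2 ^ e j l + 2 ^ e j' m' =
      2 ^ e j' l' + 2 ^ e j m.
  + apply: E => //.
      by have := e_lt _ l (ltn_ord j); have := e_lt _ m' (ltn_ord j'); lia.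
    by have := e_lt _ m (ltn_ord j); have := e_lt _ l' (ltn_ord j'); lia.
  + case/e_inj => /val_inj jj ll; congr (_, _) => //.
    by move: ul'; rewrite ul -jj -ll => /addIr.
  + by case/e_inj => _ lm; case/eqP: uv; rewrite ul vm lm.
- apply: leq_trans (max_card _) _; rewrite card_prod cM card_ord.
  exact: leq_trunc_div.
Qed.

(** * Cyclic constructions *)

Lemma intZp_inj (M : nat) (x y : int) : 1 < M -> (`|x - y|%N < M) ->
  (x%:~R = y%:~R :> 'Z_M)%R -> x = y.
Proof.
move=> M1 lt_M /eqP; rewrite -subr_eq0 -rmorphB /= => /eqP E.
have : ((`|x - y|%N)%:R = 0%:R :> 'Z_M)%R.
  case/intP: (x - y)%R E => [|k|k] //= E.
  by move/eqP: E; rewrite rmorphN oppr_eq0 => /eqP.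
by move/(natZp_inj lt_M); lia.
Qed.

(* Blocks {g + t_0, g + t_1, g + t_2} where slot j contributes its position p
   only if j < (w1, nb, na)_p. *)
Lemma code_of_cyclic_slots (M w1 nb na n : nat) (w' : seq nat)
    (t : nat -> nat -> int) (pres := fun p j => j < nth 0 [:: w1; nb; na] p) :
  1 < M -> 0 < w1 -> all (fun x => x <= w1) w' -> sumn w' = nb + na ->
  na <= nb <= w1 -> nb = w1 \/ na = 0 ->
  (forall p q j, p < q < 3 -> pres q j -> (0 < 2 * (t q j - t p j) < M%:Z)%R) ->
  (forall p q j p' q' j', p < q < 3 -> p' < q' < 3 -> pres q j -> pres q' j' ->
     (t q j - t p j = t q' j' - t p' j')%R -> [/\ p = p', q = q' & j = j']) ->
  M * w1 <= n ->
  M <= max_ccc (size w').+2 n (2 * sumn (w1 :: w') - 1) (w1 :: w').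
Proof.
move=> M1 w1_gt0 w'_le sum_w' /andP[nanb nbw1] nbna t_bound t_inj size_n.
have cM : #|'Z_M| = M by rewrite card_ord Zp_cast.
pose tz p j : 'Z_M := ((t p j)%:~R)%R.
pose cont (b : 'Z_M * 'I_w1) : seq ('Z_M * nat) :=
  [seq ((b.1 + tz p b.2)%R, p) | p <- iota 0 3 & pres p b.2].
have contP (b : 'Z_M * 'I_w1) (v : 'Z_M) p : reflect [/\ p < 3, pres p b.2 & v = (b.1 + tz p b.2)%R]
    ((v, p) \in cont b).
  apply: (iffP mapP) => [[q]|[p3 pb ->]]; last first.
    by exists p; rewrite // mem_filter pb mem_iota.
  by rewrite mem_filter mem_iota => /andP[qb /andP[_ q3]] [-> ->].
have pres_le p q j : p < q < 3 -> pres q j -> pres p j.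
  by rewrite /pres; case: p => [|[|[|p]]]; case: q => [|[|[|q]]] //=; lia.
have diff_inj p q j p' q' j' : p != q -> p < 3 -> q < 3 -> pres p j -> pres q j ->
    p' < 3 -> q' < 3 -> p' != q' -> pres p' j' -> pres q' j' ->
    (tz q j - tz p j = tz q' j' - tz p' j')%R -> [/\ p = p', q = q' & j = j'].
  move=> pq p3 q3 pj qj p'3 q'3 p'q' pj' qj'; rewrite /tz -!rmorphB /= => E.
  (* The positive differences lie strictly between 0 and M/2, so a congruence between signed
     differences is an equality of integers. *)
  have bd p1 q1 j1 : p1 != q1 -> p1 < 3 -> q1 < 3 -> pres p1 j1 -> pres q1 j1 ->
      if p1 < q1 then (0 < 2 * (t q1 j1 - t p1 j1) < M%:Z)%R
      else (0 < 2 * (t p1 j1 - t q1 j1) < M%:Z)%R && (q1 < p1).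
    move=> ne p13 q13 h h'; case: ltnP => lt; first by apply: t_bound; rewrite ?lt.
    have {}lt : q1 < p1 by lia.
    by rewrite lt andbT; apply: t_bound; rewrite ?lt.
  have b1 := bd p q j pq p3 q3 pj qj; have b2 := bd p' q' j' p'q' p'3 q'3 pj' qj'.
  have {}E : (t q j - t p j = t q' j' - t p' j')%R.
    apply: intZp_inj E => //.
    by case: (p < q) b1; case: (p' < q') b2; lia.
  case: ltnP b1 => lt b1; case: ltnP b2 => lt' b2; try lia.
    by apply: t_inj => //; rewrite ?lt ?lt'.
  by have [|||||->->->] := @t_inj q p j q' p' j' => //; lia.
rewrite -[X in X <= _]cM; apply: (code_of_positions (nb := nb) (na := na) (cont := cont)) => //.
- move=> b; rewrite /unzip1 /unzip2 -(map_comp fst) -(map_comp snd) map_id.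
  rewrite filter_uniq ?iota_uniq // andTb; apply/andP; split; last first.
    by apply/allP => p; rewrite mem_filter mem_iota => /andP[_ /andP[]].
  rewrite map_inj_in_uniq ?filter_uniq ?iota_uniq // => p q.
  rewrite !mem_filter !mem_iota => /andP[pb /andP[_ p3]] /andP[qb /andP[_ q3]] /= E.
  apply/eqP; apply/negPn/negP => pq; have E' := addrI _ E.
  have := @diff_inj p q b.2 q p b.2 pq p3 q3 pb qb q3 p3.
  by rewrite eq_sym pq E' => /(_ isT qb pb erefl)[pq' _ _]; rewrite pq' eqxx in pq.
- move=> v p p3.
  have pw : nth 0 [:: w1; nb; na] p <= w1 by case: p p3 => [|[|[|]]] //=; lia.
  rewrite -(card_ord_lt pw).
  rewrite -(card_imset _ (f := fun j : 'I_w1 => ((v - tz p j)%R, j))) => [|j j' []] //.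
  apply: eq_card => -[g j]; rewrite inE; apply/contP/imsetP => /=.
    by case=> _ pj ->; exists j; rewrite ?inE // addrK.
  by case=> j'; rewrite inE => pj' [-> ->]; rewrite subrK.
- move=> v; rewrite -[X in _ <= X](card_ord_lt (leq_trans nanb nbw1)).
  rewrite -(card_imset _ (f := fun j : 'I_w1 => ((v - tz 1 j)%R, j))) => [|j j' []] //.
  apply/subset_leq_card/subsetP => -[g j]; rewrite inE => /andP[/contP[_ _ /= ->]].
  case/mapP => -[u q] /contP[_ /= qj _] q2; apply/imsetP; exists j; last by rewrite addrK.
  by move: qj; rewrite -q2 inE.
- have inP (v : 'Z_M) (b : 'Z_M * 'I_w1) : v \in unzip1 (cont b) ->
      exists2 p, p < 3 /\ pres p b.2 & v = (b.1 + tz p b.2)%R.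
    by case/mapP => -[u p] /contP[p3 pb ->] /= ->; exists p.
  move=> u v [g j] [g' j'] uv /inP[/= p [p3 pj] up] /inP[/= q [q3 qj] vq].
  move=> /inP[/= p' [p'3 pj'] up'] /inP[/= q' [q'3 qj'] vq'].
  have pq : p != q by apply: contraNneq uv => pq; rewrite up vq pq.
  have pq' : p' != q' by apply: contraNneq uv => pq'; rewrite up' vq' pq'.
  have D : (tz q j - tz p j = tz q' j' - tz p' j')%R.
    transitivity (v - u)%R; first by rewrite vq up opprD addrACA subrr add0r.
    by rewrite vq' up' opprD addrACA subrr add0r.
  have [pp _ /val_inj jj] := diff_inj _ _ _ _ _ _ pq p3 q3 pj qj p'3 q'3 pq' pj' qj' D.
  by congr (_, _) => //; move: up'; rewrite up -pp -jj => /addIr.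
- rewrite (_ : [set b | _] = set0) ?cards0 ?addn0 ?cM 1?mulnC //.
  apply/setP => b; rewrite !inE; apply/negP => /andP[_ /negP]; apply.
  apply/mapP; exists ((b.1 + tz 0 b.2)%R, 0) => //.
  by apply/contP; split=> //; rewrite /pres /= ltn_ord.
Qed.

Lemma code_of_edge_slots (M w1 n : nat) (w' : seq nat) :
  all (fun x => x <= w1) w' -> 0 < sumn w' <= w1 -> 2 * sumn w' < M ->
  M * w1 <= n ->
  M <= max_ccc (size w').+2 n (2 * sumn (w1 :: w') - 1) (w1 :: w').
Proof.
move=> w'_le /andP[b0 bw] M_gt size_n.
(* Slot j is the edge {0, j + 1}; from j = [sumn w'] on only the point 0 remains. *)
pose t (p j : nat) : int := if p == 0 then 0%R else Posz j.+1.
apply: (@code_of_cyclic_slots M w1 (sumn w') 0 n w' t) => //; try lia.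
- move=> [|[|[|p]]] [|[|[|q]]] j; rewrite ?andbF // => _; rewrite /= ?ltn0 //.
  by move=> jb; rewrite /t /=; lia.
- move=> [|[|[|p]]] [|[|[|q]]] j [|[|[|p']]] [|[|[|q']]] j';
    rewrite ?andbF // => _ _; rewrite /= ?ltn0 //.
  by move=> _ _; rewrite /t /=; split=> //; lia.
Qed.

(* The slot of the difference i is {-i/2, i/2, a + a/2 + 1} for i even and
   {-(i-1)/2, (i+1)/2, 2a + a/2 + 2} for i odd; together they use every
   difference from 1 to 3a + 1 except a + a/2 + 1. *)
Lemma code_of_nested_slots (M w1 a s n : nat) (w' : seq nat) :
  all (fun x => x <= w1) w' -> sumn w' = w1 + a -> 0 < a -> a + s = w1 ->
  6 * a + 2 * s < M -> 6 * a + 2 < M -> M * w1 <= n ->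
  M <= max_ccc (size w').+2 n (2 * sumn (w1 :: w') - 1) (w1 :: w').
Proof.
move=> w'_le sum_w' a0 asw M1 M2 size_n.
have [m [e [ae e1]]] : exists m e, a = 2 * m + e /\ e <= 1.
  by exists (a %/ 2), (a %% 2); lia.
(* Slots below m have the even first differences 2(j + 1), those from m to a the odd ones 2(j - m) +
   1. The slots from a on are pairs: slot a takes a + m + 1, the difference skipped by the triples,
   and the others continue from 3a + 2. *)
pose t (p j : nat) : int :=
  if j < m then
    if p == 0 then (- Posz j.+1)%R else if p == 1 then Posz j.+1 else Posz (a + m + 1)
  else if j < a then
    if p == 0 then (Posz m - Posz j)%R else if p == 1 then (Posz j.+1 - Posz m)%R
    else Posz (2 * a + m + 2)
  else if p == 0 then 0%R
  else if j == a then Posz (a + m + 1) else Posz (2 * a + 1 + j).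
apply: (@code_of_cyclic_slots M w1 w1 a n w' t) => //; try lia.
- move=> [|[|[|p]]] [|[|[|q]]] j; rewrite ?andbF // => _ jb; rewrite /t /=;
  by move: jb => /=; case: (ltnP j m) => ?;
    [|case: (ltnP j a) => ?; [|case: (j =P a) => ?]]; lia.
- move=> [|[|[|p]]] [|[|[|q]]] j [|[|[|p']]] [|[|[|q']]] j';
    rewrite ?andbF // => _ _ jb jb'; move: jb jb'; rewrite /t /=.
  all: case: (ltnP j m) => ?; [|case: (ltnP j a) => ?; [|case: (j =P a) => ?]];
    (case: (ltnP j' m) => ?; [|case: (ltnP j' a) => ?; [|case: (j' =P a) => ?]]);
    move=> *; try (exfalso; lia); split => //; lia.
Qed.

(* All edges of the complete graph on 2b points, oriented so that half of the
   points have out-degree b and the others b - 1. *)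
Lemma code_of_complete_graph (b w1 n : nat) (w' : seq nat) :
  all (fun x => x <= w1) w' -> sumn w' = b -> 0 < b <= w1 ->
  2 * b * w1 + b <= n ->
  2 * b <= max_ccc (size w').+2 n (2 * sumn (w1 :: w') - 1) (w1 :: w').
Proof.
move=> w'_le sum_w' /andP[b0 bw1] size_n.
pose V := 'I_(2 * b); pose B : finType := (V * 'I_w1 + 'I_b)%type.
have [sh shE] : exists sh : V -> nat -> V, forall g j, j < 2 * b ->
    sh g j = (if g + j < 2 * b then g + j else g + j - 2 * b) :> nat.
  have ltM x : x %% (2 * b) < 2 * b by rewrite ltn_mod; lia.
  exists (fun g j => Ordinal (ltM (g + j))) => g j jb /=.
  have := ltn_ord g; case: (ltnP (g + j)) => lt gb; first by rewrite modn_small.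
  by rewrite -[in LHS](subnK lt) modnDr modn_small //; lia.
(* Differences below b start at every point; the difference b starts only in the first half, which
   gives each antipodal edge once. *)
pose isedge (g : V) (j : 'I_w1) := (j.+1 < b) || (j.+1 == b) && (g < b).
have bM (i : 'I_b) : i < 2 * b by have := ltn_ord i; lia.
(* Each of the first b points is the head of only b - 1 edges. The blocks [inr i] supply the missing
   positions 1 and account for the b coordinates beyond 2 b w1. *)
pose cont (x : B) : seq (V * nat) := match x with
  | inl (g, j) => (g, 0) :: if isedge g j then [:: (sh g j.+1, 1)] else [::]
  | inr i => [:: (Ordinal (bM i) : V, 1)]
  end.
have cV : #|V| = 2 * b by rewrite card_ord.
rewrite -[X in X <= _]cV.
apply: (code_of_positions (nb := b) (na := 0) (cont := cont)) => //; try lia.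
- case=> [[g j]|i] //=; case: ifP => //= ed; rewrite !andbT inE -(inj_eq (@ord_inj _)).
  have jb : j.+1 < 2 * b by move: ed; rewrite /isedge; lia.
  have gb := ltn_ord g; rewrite shE //; apply/eqP.
  by move: ed; rewrite /isedge; case: ifP; lia.
- move=> v [|[|[|//]]] _ /=.
  + rewrite -[RHS]card_ord -(card_imset _ (f := fun j : 'I_w1 => inl (v, j) : B)) => [|j j' []] //.
    apply: eq_card => -[[g j]|i]; rewrite inE /=; last first.
      by rewrite inE xpair_eqE andbF; apply/esym/negbTE/negP => /imsetP[].
    rewrite inE xpair_eqE andbT; apply/orP/imsetP => [[/eqP ->|]|[j' _ [-> _]]].
    * by exists j.
    * by case: ifP => // _; rewrite inE xpair_eqE andbF.
    * by left.
  + have wb (j : 'I_b) : j < w1 by have := ltn_ord j; lia.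
    pose f (j : 'I_b) : B := if (j.+1 < b) || (b <= v) then
      inl (sh v (2 * b - j.+1), Ordinal (wb j)) else inr (insubd j (val v)).
    have f_inj : injective f.
      move=> j j'; rewrite /f; case: ifP => hj; case: ifP => hj' //.
        by case=> _ jj; apply/val_inj.
      move=> _; apply/val_inj => /=; have := ltn_ord j; have := ltn_ord j'.
      by move: hj hj'; lia.
    rewrite -[RHS](card_ord b) -(card_imset _ f_inj).
    apply: eq_card => -[[g j]|i]; rewrite inE /=; apply/idP/imsetP.
    - rewrite inE xpair_eqE andbF; case: ifP => //=; rewrite inE xpair_eqE andbT.
      move=> ed /eqP vE; have jb : j < b by move: ed; rewrite /isedge; lia.
      exists (Ordinal jb) => //; rewrite /f /=.
      have gb := ltn_ord g; have j2 : j.+1 < 2 * b by lia.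
      have vE' := congr1 (@nat_of_ord _) vE; rewrite shE // in vE'.
      case: ifP => h; last by move: ed h vE'; rewrite /isedge; case: ifP; lia.
      congr (inl (_, _)); last exact/val_inj.
      apply/val_inj => /=; rewrite shE; last by lia.
      by rewrite vE'; case: ifP; case: ifP; lia.
    - case=> j'; rewrite /f; case: ifP => // h _ [-> ->].
      have vb := ltn_ord v; have jb := ltn_ord j'.
      have -> : isedge (sh v (2 * b - j'.+1)) (Ordinal (wb j')).
        by rewrite /isedge /= shE; [case: ifP; lia|lia].
      rewrite !inE !xpair_eqE andbF andbT /=; apply/eqP/val_inj => /=.
      by rewrite shE; [rewrite shE; [do 2?case: ifP; lia|lia]|lia].
    - rewrite inE xpair_eqE andbT => /eqP vE.
      have b1 : b.-1 < b by lia.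
      have vb : v < b by rewrite vE /=.
      exists (Ordinal b1) => //; rewrite /f /= ifF; last by lia.
      by congr inr; apply/val_inj; rewrite /= val_insubd vb vE.
    - case=> j'; rewrite /f; case: ifP => // h _ [->].
      rewrite inE xpair_eqE andbT; apply/eqP/val_inj => /=.
      by rewrite val_insubd ifT //; lia.
  + by rewrite eq_card0 // => -[[g j]|i]; rewrite !inE /=; [case: ifP|];
      rewrite ?inE ?xpair_eqE ?andbF.
- move=> v; rewrite leqn0 cards_eq0; apply/eqP/setP => -[[g j]|i].
    by rewrite !inE /=; case: ifP; rewrite /= ?inE ?andbF.
  by rewrite !inE /= andbF.
- have inP (u v : V) x : u != v -> u \in unzip1 (cont x) -> v \in unzip1 (cont x) ->
      exists g j, [/\ x = inl (g, j), isedge g j &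
        (u = g /\ v = sh g j.+1) \/ (v = g /\ u = sh g j.+1)].
    case: x => [[g j]|i] uv /=; last by rewrite !inE => /eqP uE /eqP vE; rewrite uE vE eqxx in uv.
    case: ifP => ed; rewrite /= !inE; last by move=> /eqP uE /eqP vE; rewrite uE vE eqxx in uv.
    move=> uE vE; exists g, j; split=> //.
    case/orP: uE => /eqP uE; case/orP: vE => /eqP vE; try by [left|right].
      by rewrite uE vE eqxx in uv.
    by rewrite uE vE eqxx in uv.
  move=> u v x x' uv ux vx ux' vx'.
  have [g [j [-> ed E]]] := inP u v x uv ux vx.
  have [g' [j' [-> ed' E']]] := inP u v x' uv ux' vx'.
  have gg_jj : g = g' :> nat /\ j = j' :> nat.
    have j1 : j.+1 < 2 * b by move: ed; rewrite /isedge; lia.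
    have j1' : j'.+1 < 2 * b by move: ed'; rewrite /isedge; lia.
    have gb := ltn_ord g; have gb' := ltn_ord g'; move: ed ed'; rewrite /isedge.
    case: E E' => -[-> ->] [] [/(congr1 (@nat_of_ord _)) + /(congr1 (@nat_of_ord _))];
      rewrite ?shE //; do 2?case: ifP; lia.
  by case: gg_jj => /val_inj -> /val_inj ->.
- rewrite cV mulnC; apply: leq_trans size_n; rewrite leq_add2l.
  rewrite -[X in _ <= X]card_ord -(card_imset _ (@inr_inj (V * 'I_w1) 'I_b)).
  apply/subset_leq_card/subsetP => -[[g j]|i]; rewrite inE; last first.
    by move=> _; apply/imsetP; exists i.
  by case/andP => _ /negP[]; apply: mem_head.
Qed.

Lemma code_lambda2 (w1 n : nat) (w' : seq nat) :
  all (fun x => x <= w1) w' -> 0 < sumn w' <= w1 ->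
  2 * sumn w' * w1 + sumn w' <= n ->
  n %/ w1 <= max_ccc (size w').+2 n (2 * sumn (w1 :: w') - 1) (w1 :: w').
Proof.
move=> w'_le sum_w' size_n; have w1_gt0 : 0 < w1 by lia.
have le_n := leq_divM n w1.
have ge_M : 2 * sumn w' <= n %/ w1 by rewrite leq_divRL //; lia.
case: (leqP (n %/ w1) (2 * sumn w')) => M_le; last exact: code_of_edge_slots.
rewrite (_ : n %/ w1 = 2 * sumn w'); last by lia.
exact: code_of_complete_graph.
Qed.

Lemma code_of_triple_system (V T : finType) (tr : T -> 'I_3 -> V)
    (S : {set V}) (A : {set T}) (a n : nat) (w' : seq nat) :
  0 < a -> all (fun x => x <= a) w' -> sumn w' = a + a ->
  (forall t k, t \in A -> tr t k \in S) ->
  (forall t, t \in A -> injective (tr t)) ->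
  (forall t t' k l k' l', t \in A -> t' \in A ->
     tr t k = tr t' k' -> tr t l = tr t' l' -> k != l -> t = t') ->
  a * #|S| <= #|A| -> #|S| <= 6 * a + 2 -> a * #|S| <= n ->
  #|S| <= max_ccc (size w').+2 n (2 * sumn (a :: w') - 1) (a :: w').
Proof.
move=> a0 w'_le sum_w' AS inj lin cA cS size_n.
pose V0 : finType := {v | v \in S}; pose T0 : finType := {t | t \in A}.
pose tr0 (t : T0) k : V0 := exist _ (tr (val t) k) (AS _ k (valP t)).
have cV0 : #|V0| = #|S| by rewrite card_sig.
have cT0 : #|T0| = #|A| by rewrite card_sig.
rewrite -cV0; apply: (@code_of_triples V0 T0 tr0); rewrite ?cV0 ?cT0 //.
- by move=> t k l /(congr1 val) /=; apply: inj (valP t) _ _.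
- move=> t t' k l k' l' /(congr1 val) /= E /(congr1 val) /= E' kl.
  by apply/val_inj; apply: lin E E' kl; apply: valP.
Qed.

(** * Steiner triple systems *)

(* Commutative quasigroup on [0, m): idempotent for m odd, and with exactly the
   first half of the elements idempotent for m even. *)
Section HalfIdempotent.

Variable m : nat.
Hypothesis m_gt0 : 0 < m.

(** Halving modulo m when m is odd. For even m it is a bijection that halves the even elements and
    sends the odd ones to the upper half. *)
Definition mean z := z./2 + odd z * uphalf m.

Lemma mean_lt (x y : 'I_m) : mean ((x + y) %% m) < m.
Proof. by have := ltn_pmod (x + y) m_gt0; rewrite /mean; lia. Qed.

Definition op (x y : 'I_m) : 'I_m := Ordinal (mean_lt x y).

Lemma opC x y : op x y = op y x.
Proof. by apply/val_inj; rewrite /= addnC. Qed.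

Lemma op_inj x : injective (op x).
Proof.
have modE z : z < 2 * m -> z %% m = if z < m then z else z - m.
  move=> z2; case: ltnP => zm; first by rewrite modn_small.
  by rewrite -[in LHS](subnK zm) modnDr modn_small //; lia.
have xl := ltn_ord x => y y'; have yl := ltn_ord y; have yl' := ltn_ord y'.
move/(congr1 (@nat_of_ord _)); rewrite /= /mean !modE; try lia.
by move=> E; apply/val_inj => /=; move: E; do 2?case: ifP; lia.
Qed.

Lemma op_diag (x : 'I_m) :
  op x x = (if x < uphalf m then x : nat else if odd m then x : nat else x - m./2) :> nat.
Proof.
have xl := ltn_ord x; rewrite /= /mean; case: (ltnP (x + x) m) => lt.
  by rewrite modn_small //; do 2?case: ifP; lia.
rewrite -[X in X %% m](subnK lt) modnDr modn_small; last by lia.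
by do 2?case: ifP; lia.
Qed.

Lemma op_idem (x : 'I_m) : (op x x == x) = odd m || (x < uphalf m).
Proof.
rewrite -(inj_eq (@ord_inj _)) op_diag.
by have := ltn_ord x; do 2?case: ifP; lia.
Qed.

End HalfIdempotent.

Lemma triple_degree_in (V T : finType) (tr : T -> 'I_3 -> V)
    (S : {set V}) (A : {set T}) v : v \in S ->
  (forall t k, t \in A -> tr t k \in S) ->
  (forall t, t \in A -> injective (tr t)) ->
  (forall t t' k l k' l', t \in A -> t' \in A ->
     tr t k = tr t' k' -> tr t l = tr t' l' -> k != l -> t = t') ->
  2 * #|[set t in A | [exists k, tr t k == v]]| < #|S|.
Proof.
move=> vS AS inj lin.
pose V0 : finType := {v | v \in S}; pose T0 : finType := {t | t \in A}.
pose tr0 (t : T0) k : V0 := exist _ (tr (val t) k) (AS _ k (valP t)).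
have inj0 t : injective (tr0 t).
  by move=> k l /(congr1 val) /=; apply: inj (valP t) _ _.
have lin0 t t' k l k' l' :
    tr0 t k = tr0 t' k' -> tr0 t l = tr0 t' l' -> k != l -> t = t'.
  move=> /(congr1 val) /= E /(congr1 val) /= E' kl.
  by apply/val_inj; apply: lin E E' kl; apply: valP.
have := triple_degree_double inj0 lin0 (exist _ v vS).
rewrite card_sig; apply: leq_ltn_trans.
rewrite leq_mul2l /=.
have : [set t in A | [exists k, tr t k == v]] \subset
    (fun e : T0 * 'I_3 => val e.1) @: [set e | tr0 e.1 e.2 == exist _ v vS].
  apply/subsetP => t; rewrite inE => /andP[tA /existsP[k tk]].
  by apply/imsetP; exists (exist _ t tA, k); rewrite // inE -val_eqE.
by move/subset_leq_card/leq_trans; apply; apply: leq_imset_card.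
Qed.

Section SteinerTriples.

Variable m : nat.
Hypothesis m_gt0 : 0 < m.

Let o := @op m m_gt0.
Let idem x := o x x == x.

Definition sts_point : finType := option ('I_m * 'I_3).
Definition sts_index : finType := (('I_m * 'I_m) * 'I_3 + 'I_m * 'I_3)%type.

Definition sts (t : sts_index) (k : 'I_3) : sts_point := match t with
  | inl (x, y, i) =>
      if k == 0 :> nat then Some (x, i) else if k == 1 :> nat then Some (y, i)
      else Some (o x y, ordS i)
  | inr (x, i) =>
      if idem x then Some (x, k) else if k == 0 :> nat then None
      else if k == 1 :> nat then Some (x, i) else Some (o x x, ordS i)
  end.

Definition sts_block := [set t : sts_index | match t with
  | inl (x, y, i) => x < y | inr (x, i) => ~~ idem x || (i == ord0) end].

Let ldiv x z := odflt x [pick y | o x y == z].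
Let root x := odflt x [pick y | (o y y == x) && ~~ idem y].
Let mix x z (i : 'I_3) : sts_index :=
  let y := ldiv x z in
  if y == x then inr (x, if idem x then ord0 else i)
  else inl (if x < y then (x, y) else (y, x), i).
(** Recovers a triple from two of its points; both its injectivity and the linearity are drawn from
    this left inverse. *)
Let join (u v : sts_point) : option sts_index := match u, v with
  | Some (x, i), Some (y, j) => Some (
      if i == j then inl (if x < y then (x, y) else (y, x), i)
      else if j == ordS i then mix x y i else mix y x j)
  | None, Some (x, i) | Some (x, i), None =>
      Some (inr (if idem x then (root x, ordS (ordS i)) else (x, i)))
  | None, None => None
  end.

Let ldivK x y : ldiv x (o x y) = y.
Proof.
rewrite /ldiv; case: pickP => [z /eqP/op_inj //|/(_ y)].
by rewrite eqxx.
Qed.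

Let idem_lt x : idem x = odd m || (x < uphalf m).
Proof. exact: op_idem. Qed.

Let idem_o x : idem (o x x).
Proof.
rewrite idem_lt op_diag; have := ltn_ord x.
by do 2?case: ifP; lia.
Qed.

Let rootK x : ~~ idem x -> root (o x x) = x.
Proof.
move=> ix; rewrite /root; case: pickP => [y /andP[/eqP E iy]|/(_ x)]; last first.
  by rewrite eqxx ix.
apply/val_inj => /=; move: ix iy; rewrite !idem_lt !negb_or.
move/(congr1 (@nat_of_ord _)): E; rewrite !op_diag.
by have := ltn_ord x; have := ltn_ord y; do 4?case: ifP; lia.
Qed.

Lemma sts_join t k l : t \in sts_block -> k != l -> join (sts t k) (sts t l) = Some t.
Proof.
have S1 (i : 'I_3) : (i == ordS i) = false /\ (ordS i == i) = false.
  by case: i => -[|[|[|]]].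
have S2 (i : 'I_3) : (i == ordS (ordS i)) = false /\ ordS (ordS (ordS i)) = i.
  by case: i => -[|[|[|i]]] // h; split=> //; apply/val_inj.
case: t => [[[x y] i]|[x i]]; rewrite inE.
  move=> xy; have yx : (y < x) = false by lia.
  have nxy : (y == x) = false by apply/eqP => E; rewrite E ltnn in xy.
  have nyx : (x == y) = false by rewrite eq_sym.
  have [S1a S1b] := S1 i; have [S2a S2b] := S2 i.
  have mix1 j : mix x (o x y) j = inl (x, y, j) by rewrite /mix ldivK nxy xy.
  have mix2 j : mix y (o x y) j = inl (x, y, j).
    by rewrite /mix /o opC -/o ldivK nyx yx.
  case: k => -[|[|[|//]]] ?; case: l => -[|[|[|//]]] ? //= _; congr Some;
  by rewrite ?eqxx ?xy ?yx ?S1a ?S1b ?S2a ?mix1 ?mix2.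
move=> hx; case ix : (idem x) hx => /= hx.
  have lx : ldiv x x = x by rewrite -[in X in ldiv _ X](eqP ix) ldivK.
  rewrite ix => kl; rewrite /= (negbTE kl) /mix lx eqxx ix (eqP hx).
  by case: ifP.
have [S1a S1b] := S1 i; have [S2a S2b] := S2 i.
case: k => -[|[|[|//]]] ?; case: l => -[|[|[|//]]] ? //= _; rewrite ix /= ?ix.
all: rewrite ?idem_o ?rootK ?ix ?S1a ?S1b ?S2a ?S2b ?eqxx //=.
all: by rewrite /mix ldivK eqxx ix.
Qed.

Lemma sts_inj t : t \in sts_block -> injective (sts t).
Proof.
move=> tB k l E; apply/eqP; case: (eqVneq k l) => // kl.
have := sts_join tB kl; rewrite -E; case: (sts t k) => [[x i]|] //= [] tE.
by move: tB; rewrite -tE inE eqxx; case: ifP => /=; rewrite ltnn.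
Qed.

Lemma sts_linear t t' k l k' l' : t \in sts_block -> t' \in sts_block ->
  sts t k = sts t' k' -> sts t l = sts t' l' -> k != l -> t = t'.
Proof.
move=> tB tB' E E' kl; suff kl' : k' != l'.
  by apply: Some_inj; rewrite -(sts_join tB kl) -(sts_join tB' kl') E E'.
by apply: contraNneq kl => kl'; apply/eqP/(sts_inj tB); rewrite E E' kl'.
Qed.

Lemma card_sts : #|sts_block| = \sum_(y < m) 3 * y + \sum_(x < m) (if idem x then 1 else 3).
Proof.
rewrite -sum1_card big_mkcond /= big_sumType /=; congr (_ + _).
  transitivity (\sum_(x < m) \sum_(y < m) \sum_(i < 3)
      (if inl (x, y, i) \in sts_block then 1 else 0)).
    by rewrite pair_bigA pair_bigA; apply: eq_bigr => -[[]].
  rewrite exchange_big; apply: eq_bigr => y _ /=.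
  have ym : y <= m by apply: ltnW.
  rewrite -[in RHS](card_ord_lt ym) -sum1dep_card big_distrr [RHS]big_mkcond.
  apply: eq_bigr => x _; rewrite !big_ord_recl big_ord0 !inE.
  by case: ifP.
transitivity (\sum_(x < m) \sum_(i < 3)
    (if inr (x, i) \in sts_block then 1 else 0)).
  by rewrite pair_bigA; apply: eq_bigr => -[].
apply: eq_bigr => x _; rewrite !big_ord_recl big_ord0 !inE.
by case: (idem x).
Qed.

End SteinerTriples.

Lemma sum_ord k : 2 * (\sum_(y < k) y) + k = k * k.
Proof.
elim: k => [|k]; first by rewrite big_ord0.
by rewrite big_ord_recr /=; move: (\sum_(y < k) y) => S; nia.
Qed.

(** Skolem's case m = 2a: half of the elements are idempotent, which makes 3a(2a - 1) + a + 3a =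
    a(6a + 1) triples. *)
Lemma code_of_steiner1 (a n : nat) (w' : seq nat) :
  0 < a -> all (fun x => x <= a) w' -> sumn w' = a + a -> (6 * a + 1) * a <= n ->
  6 * a + 1 <= max_ccc (size w').+2 n (2 * sumn (a :: w') - 1) (a :: w').
Proof.
move=> a0 w'_le sum_w' size_n; have m0 : 0 < 2 * a by lia.
have cV : #|[set: sts_point (2 * a)]| = 6 * a + 1.
  by rewrite cardsT card_option card_prod !card_ord; lia.
rewrite -cV; apply: (code_of_triple_system (tr := @sts _ m0) (A := sts_block m0)) => //.
- exact: sts_inj.
- exact: sts_linear.
- rewrite cV card_sts -big_distrr /=; have := sum_ord (2 * a).
  have -> : \sum_(x < 2 * a) (if @op _ m0 x x == x then 1 else 3) = 4 * a.
    transitivity (\sum_(x < 2 * a) (if x < a then 1 else 3)).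
      by apply: eq_bigr => x _; rewrite op_idem; do 2?case: ifP => ?; lia.
    have : \sum_(x < 2 * a) (if x < a then 1 else 3) + \sum_(x < 2 * a | x < a) 2 =
        \sum_(x < 2 * a) 3.
      rewrite [X in _ + X]big_mkcond -big_split; apply: eq_bigr => x _ /=.
      by case: ifP.
    rewrite sum_nat_const sum_nat_const card_ord.
    rewrite -[#|_|](_ : #|[set x : 'I_(2 * a) | x < a]| = _); last first.
      by apply: eq_card => x; rewrite !inE.
    by rewrite card_ord_lt; lia.
  by move: (\sum_(y < 2 * a) y) => S; nia.
- by rewrite cV; lia.
- by rewrite cV mulnC.
Qed.

(** Bose's case m = 2a + 1 has 6a + 3 points and (2a + 1)(3a + 1) triples. Deleting a point removes
    at most 3a + 1 of them and leaves the required a(6a + 2). *)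
Lemma code_of_steiner2 (a n : nat) (w' : seq nat) :
  0 < a -> all (fun x => x <= a) w' -> sumn w' = a + a -> (6 * a + 2) * a <= n ->
  6 * a + 2 <= max_ccc (size w').+2 n (2 * sumn (a :: w') - 1) (a :: w').
Proof.
move=> a0 w'_le sum_w' size_n; have m0 : 0 < (2 * a).+1 by [].
pose v0 : sts_point (2 * a).+1 := Some (Ordinal m0, ord0).
pose S := [set~ None : sts_point (2 * a).+1] :\ v0.
pose A := [set t in sts_block m0 | [forall k, sts m0 t k != v0]].
have cS1 : #|[set~ None : sts_point (2 * a).+1]| = 6 * a + 3.
  by rewrite cardsC1 card_option card_prod !card_ord; lia.
have cS : #|S| = 6 * a + 2.
  have := cardsD1 v0 [set~ None]; rewrite cS1 !inE /= -/S; lia.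
have noN t k : t \in sts_block m0 -> sts m0 t k \in [set~ None].
  case: t => [[[x y] i]|[x i]] _; rewrite !inE /=; first by do 2?case: ifP.
  by rewrite op_idem ifT //; lia.
have deg0 := triple_degree_in (v := v0) _ noN (@sts_inj _ m0) (@sts_linear _ m0).
rewrite -cS; apply: (code_of_triple_system (tr := sts m0) (A := A)) => //.
- move=> t k; rewrite inE => /andP[tB /forallP/(_ k) tv].
  by rewrite in_setD1 tv noN.
- by move=> t /setIdP[/(@sts_inj _ m0)].
- by move=> t t' k l k' l' /setIdP[tB _] /setIdP[tB' _]; apply: sts_linear.
- rewrite cS; have {}deg0 : #|[set t in sts_block m0 | [exists k, sts m0 t k == v0]]| <= 3 * a + 1.
    by have := deg0 (_ : v0 \in _); rewrite cS1 !inE => /(_ isT); lia.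
  have : #|sts_block m0| <= #|A| + #|[set t in sts_block m0 | [exists k, sts m0 t k == v0]]|.
    apply: leq_trans (leq_card_setU _ _); apply/subset_leq_card/subsetP => t tB.
    rewrite !in_set in tB *; rewrite tB /= orbC; case: existsP => //= none.
    by apply/forallP => k; apply/negP => tk; apply: none; exists k.
  rewrite card_sts -big_distrr /=; have := sum_ord (2 * a).+1.
  have -> : \sum_(x < (2 * a).+1) (if op m0 x x == x then 1 else 3) = (2 * a).+1.
    rewrite (eq_bigr (fun=> 1)) => [|x _]; last by rewrite op_idem ifT //; lia.
    by rewrite sum_nat_const card_ord muln1.
  move: deg0; move: (\sum_(y < (2 * a).+1) y) #|A| #|[set _ in _ | _]| => S' x y.
  by nia.
- by rewrite cS.
- by rewrite cS mulnC.
Qed.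

(** * Blocks over Z_D x Z_3 *)

Section Weight.

Variable Q : nat -> seq nat -> bool.

(* The second argument of Q receives the list of all positions of the block. *)
Definition weight (X : eqType) (u : X) (s : seq (X * nat)) : nat :=
  \sum_(z <- s) (z.1 == u) * Q z.2 (unzip2 s).

Definition map_block (X Y : Type) (g : X -> Y) (s : seq (X * nat)) :=
  [seq (g z.1, z.2) | z <- s].

Lemma unzip2_map_block (X Y : Type) (g : X -> Y) s :
  unzip2 (map_block g s) = unzip2 s.
Proof. by rewrite /unzip2 -map_comp. Qed.

Lemma unzip1_map_block (X Y : Type) (g : X -> Y) s :
  unzip1 (map_block g s) = map g (unzip1 s).
Proof. by rewrite /unzip1 -!map_comp. Qed.

Lemma weight_map (X Y : eqType) (g : X -> Y) u s :
  injective g -> weight (g u) (map_block g s) = weight u s.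
Proof.
move=> g_inj; rewrite /weight unzip2_map_block big_map.
by apply: eq_bigr => z _; rewrite /= inj_eq.
Qed.

Lemma weight_map0 (X Y : eqType) (g : X -> Y) v s :
  (forall u, g u <> v) -> weight v (map_block g s) = 0.
Proof.
move=> gv; rewrite /weight big_map big1 // => z _ /=.
by case: eqP => // /gv.
Qed.

Lemma weight_mem (X : eqType) (u : X) s :
  uniq (unzip1 s) ->
  weight u s = has (fun z => (z.1 == u) && Q z.2 (unzip2 s)) s.
Proof.
rewrite /weight; move: (unzip2 s) => l; elim: s => [|[x p] s IHs] /=.
  by rewrite big_nil.
case/andP => xs /IHs{}IHs; rewrite big_cons IHs /=.
case: (x =P u) => [xu|_] //=; rewrite mul1n; case: (Q p l) => //=.
rewrite (_ : has _ _ = false) //; apply/negP => /hasP[z zs /andP[/eqP zx _]].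
by rewrite xu -zx map_f in xs.
Qed.

Lemma card_weight (X : eqType) (B : finType) (cont : B -> seq (X * nat)) (u : X) :
  (forall b, uniq (unzip1 (cont b))) ->
  #|[set b | has (fun z => (z.1 == u) && Q z.2 (unzip2 (cont b))) (cont b)]| =
  \sum_b weight u (cont b).
Proof.
move=> cont_uniq; rewrite -sum1dep_card big_mkcond; apply: eq_bigr => b _.
by rewrite weight_mem //; case: has.
Qed.

End Weight.

(* Blocks on the three rows of 'Z_D * 'I_3 and the infinite points of I.  Full
   orbits are given by the slots (r j, c j) and by the pairs with a difference in
   Urow (inside a row) or Umix (from a row to the next).  The pairs with mixed
   differences p, 0 and -p form the triangles vtx cc y 0, vtx cc y 1, vtx cc y 2:
   if tri cc y, the triangle is a single block tcont cc y 0, otherwise its edge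
   from vtx cc y e to vtx cc y (e + 1) lies in the block tcont cc y e.  The pairs
   with row difference q are in the blocks jcont.  An infinite point m meets the
   triangles of class cl m, in a block econt for each vertex of a triangle
   which is a single block; xcont gives the blocks of infinite points only. *)
Section Frame.

Variables (D L : nat) (I X : finType).
Notation Z := 'Z_D.
Notation F := ('Z_D * 'I_3)%type.

Variables (p q : Z) (r c : 'I_L -> Z) (Urow Umix : {set Z}).
Variables (cl : I -> 'I_3) (tri : 'I_3 -> Z -> bool).
Variable tcont : 'I_3 -> Z -> 'I_3 -> seq (('I_3 + I) * nat).
Variable jcont : Z -> 'I_3 -> seq ((bool + I) * nat).
Variable econt : I -> Z -> 'I_3 -> option (nat * nat).
Variable xcont : X -> seq (I * nat).

Local Open Scope ring_scope.

Definition row_step (n : 'I_L + option Z) : Z :=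
  match n with inl j => r j | inr (Some d) => d | inr None => q end.
Definition row_valid (n : 'I_L + option Z) : bool :=
  if n is inr (Some d) then d \in Urow else true.

Definition tri_step (e : 'I_3) : Z :=
  if e == 0 then p else if e == 1 then 0 else - p.
Definition mix_step (n : 'I_L * bool + ('I_3 + Z)) : Z :=
  match n with
  | inl (j, b) => if b then c j - r j else c j
  | inr (inl e) => tri_step e
  | inr (inr d) => d
  end.
Definition mix_valid (n : 'I_L * bool + ('I_3 + Z)) : bool :=
  if n is inr (inr d) then d \in Umix else true.

Definition vtx (cc : 'I_3) (y : Z) (k : 'I_3) : F :=
  (if k == 0 then y else y + p, cc + k).
Definition tri_loc (cc : 'I_3) (y : Z) (u : 'I_3 + I) : F + I :=
  match u with inl k => inl (vtx cc y k) | inr m => inr m end.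
Definition join_loc (x : Z) (i : 'I_3) (u : bool + I) : F + I :=
  match u with inl b => inl (if b then x + q else x, i) | inr m => inr m end.

Definition frame_index : finType :=
  (F * 'I_L + F * Z * bool + 'I_3 * Z * 'I_3 + F + I * Z * 'I_3 + X)%type.
Definition frame_point : finType := (F + I)%type.

Definition frame (b : frame_index) : seq (frame_point * nat) := match b with
  | inl (inl (inl (inl (inl (x, i, j))))) =>
      [:: (inl (x, i), 0%N); (inl (x + r j, i), 1%N); (inl (x + c j, i + 1), 2%N)]
  | inl (inl (inl (inl (inr (x, i, d, false))))) =>
      if d \in Urow then [:: (inl (x, i), 0%N); (inl (x + d, i), 1%N)] else [::]
  | inl (inl (inl (inl (inr (x, i, d, true))))) =>
      if d \in Umix then [:: (inl (x, i), 0%N); (inl (x + d, i + 1), 1%N)] else [::]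
  | inl (inl (inl (inr (cc, y, e)))) => map_block (tri_loc cc y) (tcont cc y e)
  | inl (inl (inr (x, i))) => map_block (join_loc x i) (jcont x i)
  | inl (inr (m, y, k)) =>
      if econt m y k is Some (s, t) then [:: (inl (vtx (cl m) y k), s); (inr m, t)]
      else [::]
  | inr x => map_block inr (xcont x)
  end.

Hypothesis row_inj : {in row_valid &, injective row_step}.
Hypothesis row_opp : {in row_valid &, forall n n',
  row_step n = - row_step n' -> n = inr None /\ n' = inr None}.
Hypothesis row_neq0 : {in row_valid, forall n, row_step n != 0}.
Hypothesis mix_inj : {in mix_valid &, injective mix_step}.
Hypothesis cl_inj : injective cl.

Definition block_ok (Y : eqType) (s : seq (Y * nat)) :=
  [&& uniq (unzip1 s), uniq (unzip2 s) & all (fun t => t < 3)%N (unzip2 s)].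

Hypothesis tcont_ok : forall cc y e, block_ok (tcont cc y e).
Hypothesis tcont_fin : forall cc y e k, inl k \in unzip1 (tcont cc y e) ->
  if tri cc y then e == 0 else (k == e) || (k == e + 1).
Hypothesis tcont_inf : forall cc y e m, inr m \in unzip1 (tcont cc y e) ->
  [&& cc == cl m, e == 1 & ~~ tri cc y].
Hypothesis jcont_ok : forall x i, block_ok (jcont x i).
Hypothesis jcont_half : forall x i, q + q = 0 -> jcont x i != [::] ->
  jcont (x + q) i = [::].
Hypothesis jcont_inf : forall x i m, inr m \in unzip1 (jcont x i) ->
  [&& i == cl m, ~~ tri i x & ~~ tri i (x + q)].
Hypothesis jcont_two : forall x i m, inr m \in unzip1 (jcont x i) ->
  inr m \notin unzip1 (jcont (x + q) i).
Hypothesis econt_ok : forall m y k s t, econt m y k = Some (s, t) ->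
  [&& tri (cl m) y, s != t, s < 3 & t < 3]%N.
Hypothesis xcont_ok : forall x, block_ok (xcont x).
Hypothesis xcont_lin : forall m m' x x', m != m' ->
  m \in unzip1 (xcont x) -> m' \in unzip1 (xcont x) ->
  m \in unzip1 (xcont x') -> m' \in unzip1 (xcont x') -> x = x'.

Lemma row_shift (i : 'I_3) : (i == i + 1) = false.
Proof. by case: i => -[|[|[|i]]]. Qed.

Lemma q_neq0 : q != 0.
Proof. exact: (@row_neq0 (inr None)). Qed.

Lemma vtx_inj cc y : injective (vtx cc y).
Proof. by move=> k k' /(congr1 snd) /addrI. Qed.

Lemma vtxE cc y k x i :
  (vtx cc y k == (x, i)) = (k == i - cc) && (y == if i == cc then x else x - p).
Proof.
have -> : (k == i - cc) = (cc + k == i) by rewrite eq_sym subr_eq addrC eq_sym.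
rewrite /vtx xpair_eqE andbC; case: (cc + k =P i) => [<-|] //=.
have -> : (cc + k == cc) = (k == 0) by rewrite -[X in _ == X]addr0 (inj_eq (addrI cc)).
case: (k == 0) => //.
by rewrite eq_sym -subr_eq eq_sym.
Qed.

Lemma tri_loc_inj cc y : injective (tri_loc cc y).
Proof.
case=> [k|m] [k'|m'] //=; last by case=> ->.
by move/(@inl_inj F I)/(@vtx_inj cc y) ->.
Qed.

Lemma join_loc_inj x i : injective (join_loc x i).
Proof.
case=> [b|m] [b'|m'] //=; last by case=> ->.
by move/(@inl_inj F I)/(congr1 fst); case: b; case: b' => //= /eqP; rewrite -subr_eq0 ?opprD ?addrA ?addrK
  ?subrr ?[x + q]addrC ?addrK ?sub0r ?oppr_eq0 (negbTE q_neq0).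
Qed.

Let slot_block (x : Z) (i : 'I_3) (j : 'I_L) : frame_index :=
  inl (inl (inl (inl (inl (x, i, j))))).
Let pair_block (x : Z) (i : 'I_3) (d : Z) (b : bool) : frame_index :=
  inl (inl (inl (inl (inr (x, i, d, b))))).
Let tri_block (cc : 'I_3) (y : Z) (e : 'I_3) : frame_index :=
  inl (inl (inl (inr (cc, y, if tri cc y then 0 else e)))).
Let join_block (x : Z) (i : 'I_3) : frame_index := inl (inl (inr (x, i))).

Let row_block (x : Z) (i : 'I_3) (n : 'I_L + option Z) : frame_index :=
  match n with
  | inl j => slot_block x i j
  | inr (Some d) => pair_block x i d false
  | inr None => join_block x i
  end.
Let mix_block (x : Z) (i : 'I_3) (n : 'I_L * bool + ('I_3 + Z)) : frame_index :=
  match n with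
  | inl (j, b) => slot_block (if b then x - r j else x) i j
  | inr (inl e) => tri_block (i - e) (if e == 0 then x else x - p) e
  | inr (inr d) => pair_block x i d true
  end.

(** The difference from [u] to [v] prescribes a block, and [b] is that block. Linearity on finite
    points amounts to this prescription being unique and independent of the direction in which the
    pair is read. *)
Let edge (b : frame_index) (u v : F) : Prop :=
  (exists2 n, row_valid n /\ (n = inr None -> jcont u.1 u.2 != [::]) &
     v = (u.1 + row_step n, u.2) /\ b = row_block u.1 u.2 n) \/
  (exists2 n, mix_valid n &
     v = (u.1 + mix_step n, u.2 + 1) /\ b = mix_block u.1 u.2 n).

Lemma tri_edge cc y e : edge (tri_block cc y e) (vtx cc y e) (vtx cc y (e + 1)).
Proof.
right; exists (inr (inl e)) => //=; rewrite addrK; split.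
  rewrite /vtx /tri_step addrA; congr (_, _).
  by case: e => -[|[|[|//]]] ? /=; rewrite ?addr0 ?addrK.
congr (tri_block _ _ _); case: (e == 0) => //.
by rewrite addrK.
Qed.

Lemma neq_I3 (k l : 'I_3) : k != l -> l = k + 1 \/ k = l + 1.
Proof.
by case: k => -[|[|[|//]]] ?; case: l => -[|[|[|//]]] ? // _; [left|right|right|left|left|right];
  apply/val_inj.
Qed.

Lemma edge_I3 (e k : 'I_3) :
  ((k == e) || (k == e + 1)) && ((k + 1 == e) || (k + 1 == e + 1)) -> e == k.
Proof. by case: e => -[|[|[|//]]] ?; case: k => -[|[|[|//]]]. Qed.

Lemma frame_edge b u v : u != v -> inl u \in unzip1 (frame b) ->
  inl v \in unzip1 (frame b) -> edge b u v \/ edge b v u.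
Proof.
move=> uv; case: b => [[[[[[[x i] j]|[[[x i] d] [|]]]|[[cc y] e]]|[x i]]|[[m y] k]]|x] /=.
- rewrite !inE !(inj_eq (@inl_inj _ _)) => /or3P[]/eqP uE /or3P[]/eqP vE.
  all: try (by rewrite uE vE eqxx in uv).
  + by left; left; exists (inl j) => //; rewrite uE vE.
  + by left; right; exists (inl (j, false)) => //; rewrite uE vE.
  + by right; left; exists (inl j) => //; rewrite uE vE.
  + left; right; exists (inl (j, true)) => //; rewrite uE vE /= addrK; split=> //.
    by rewrite [c j - r j]addrC addrA addrK.
  + by right; right; exists (inl (j, false)) => //; rewrite uE vE.
  + right; right; exists (inl (j, true)) => //; rewrite uE vE /= addrK; split=> //.
    by rewrite [c j - r j]addrC addrA addrK.
- case: ifP => // dU; rewrite !inE !(inj_eq (@inl_inj _ _)) => /orP[]/eqP uE /orP[]/eqP vE.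
  all: try (by rewrite uE vE eqxx in uv).
  + by left; right; exists (inr (inr d)) => //; rewrite uE vE.
  + by right; right; exists (inr (inr d)) => //; rewrite uE vE.
- case: ifP => // dU; rewrite !inE !(inj_eq (@inl_inj _ _)) => /orP[]/eqP uE /orP[]/eqP vE.
  all: try (by rewrite uE vE eqxx in uv).
  + by left; left; exists (inr (Some d)); [split|rewrite uE vE].
  + by right; left; exists (inr (Some d)); [split|rewrite uE vE].
- rewrite unzip1_map_block => /mapP[[k|//] kt [uE]] /mapP[[l|//] lt [vE]].
  have kl : k != l by apply: contraNneq uv => kl; rewrite uE vE kl.
  have main (e' : 'I_3) : (tri cc y || (e == e')) ->
      edge (tri_block cc y e') (vtx cc y e') (vtx cc y (e' + 1)) ->
      edge (inl (inl (inl (inr (cc, y, e))))) (vtx cc y e') (vtx cc y (e' + 1)).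
    have := tcont_fin kt; rewrite /tri_block; case: (tri cc y) => [/eqP -> //|_] /=.
    by move/eqP ->.
  have kle : tri cc y || ((k == e) || (k == e + 1)) && ((l == e) || (l == e + 1)).
    by have := tcont_fin kt; have := tcont_fin lt; case: (tri cc y) => // -> ->.
  rewrite uE vE; case: (neq_I3 kl) => E; [left; rewrite E|right; rewrite E];
    apply: main; try exact: tri_edge.
    by move: kle; rewrite E; case: (tri cc y) => //= /edge_I3.
  by move: kle; rewrite E; case: (tri cc y) => //=; rewrite andbC => /edge_I3.
- rewrite unzip1_map_block => /mapP[[b|//] kt [uE]] /mapP[[b'|//] lt [vE]].
  have jne : jcont x i != [::] by apply: contraTneq kt => ->.
  case: b kt uE => kt uE; case: b' lt vE => lt vE.
  all: try (by rewrite uE vE eqxx in uv).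
  + by right; left; exists (inr None); rewrite ?uE ?vE.
  + by left; left; exists (inr None); rewrite ?uE ?vE.
- case: econt => [[s t]|//]; rewrite !inE /= !(inj_eq (@inl_inj _ _)) !orbF.
  by move=> /eqP uE /eqP vE; rewrite uE vE eqxx in uv.
- by rewrite unzip1_map_block => /mapP[].
Qed.

Lemma edge_fun b b' u v : u != v -> edge b u v -> edge b' u v -> b = b'.
Proof.
move=> uv; case=> [[n [nv _] [vE ->]]|[n nv [vE ->]]];
  case=> [[n' [nv' _] [vE' ->]]|[n' nv' [vE' ->]]]; move: vE'; rewrite {}vE => E.
- by congr row_block; apply: row_inj => //; apply: addrI (congr1 fst E).
- by have /eqP := congr1 snd E; rewrite /= row_shift.
- by have /eqP := congr1 snd E; rewrite /= eq_sym row_shift.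
- by congr mix_block; apply: mix_inj => //; apply: addrI (congr1 fst E).
Qed.

(** A pair is prescribed in one direction only. The delicate case is q = -q, where [jcont_half]
    leaves just one of the two blocks on {x, x + q} nonempty. *)
Lemma edge_opp b b' u v : edge b u v -> edge b' v u -> b = b'.
Proof.
case: u v => [x i] [x' i']; case=> [[n [nv jne] [[-> ->] ->]]|[n nv [[-> ->] ->]]];
  case=> [[n' [nv' jne'] [E ->]]|[n' nv' [E ->]]]; move: E => /= E.
- have E1 : row_step n + row_step n' = 0.
    by apply: (@addrI _ x); rewrite addr0 addrA; apply/esym/(congr1 fst E).
  have /row_opp[//|//|nN n'N] : row_step n = - row_step n'.
    by apply/eqP; rewrite -addr_eq0 E1.
  move: E1 (jne nN) (jne' n'N); rewrite nN n'N /= => qq jn.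
  by rewrite (jcont_half qq jn).
- by have /eqP := congr1 snd E; rewrite /= row_shift.
- by have /eqP := congr1 snd E; rewrite /= row_shift.
- by have /eqP := congr1 snd E => /=; case: i {E} => -[|[|[|//]]].
Qed.

(** Every finite point is a vertex of exactly one triangle of class [cl m], and this vertex
    determines the block shared with [m]. In a split triangle, vertices 1 and 2 meet [m] on their
    common edge and vertex 0 meets it in its row pair. *)
Let inf_block (m : I) (y : Z) (k : 'I_3) : frame_index :=
  if tri (cl m) y then inl (inr (m, y, k))
  else if k != 0 then tri_block (cl m) y 1
  else join_block (if inr m \in unzip1 (jcont y (cl m)) then y else y - q) (cl m).

Lemma frame_inf b m v : inr m \in unzip1 (frame b) -> inl v \in unzip1 (frame b) ->
  exists y k, v = vtx (cl m) y k /\ b = inf_block m y k.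
Proof.
case: b => [[[[[[[x i] j]|[[[x i] d] [|]]]|[[cc y] e]]|[x i]]|[[m' y] k]]|x] /=.
- by rewrite !inE.
- by case: ifP.
- by case: ifP.
- rewrite unzip1_map_block => /mapP[[//|m'] mt [mE]] /mapP[[k|//] kt [vE]].
  rewrite -{}mE in mt; have /and3P[/eqP cE /eqP eE ntri] := tcont_inf mt.
  have := tcont_fin kt; rewrite (negbTE ntri) => ke.
  exists y, k; rewrite -cE; split=> //; rewrite /inf_block -cE (negbTE ntri).
  rewrite (_ : k != 0) /tri_block ?(negbTE ntri) ?eE //.
  by move: ke; rewrite eE; case: (k) => -[|[|[|//]]].
- rewrite unzip1_map_block => /mapP[[//|m'] mt [mE]]; rewrite -{}mE in mt.
  case/mapP => [[b|//] kt [vE]].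
  have /and3P[/eqP iE nt1 nt2] := jcont_inf mt.
  case: b kt vE => kt vE.
    exists (x + q), 0; rewrite -iE /vtx addr0; split=> //.
    rewrite /inf_block -iE (negbTE nt2) eqxx /=.
    by rewrite (negbTE (jcont_two mt)) addrK.
  exists x, 0; rewrite -iE /vtx addr0; split=> //.
  by rewrite /inf_block -iE (negbTE nt1) eqxx /= mt.
- case E: econt => [[s t]|//]; rewrite !inE /= orbF => /eqP[->].
  rewrite (inj_eq (@inl_inj _ _)) => /eqP ->; exists y, k; split=> //.
  by have /and4P[tr _ _ _] := econt_ok E; rewrite /inf_block tr.
- by rewrite unzip1_map_block => _ /mapP[].
Qed.

Lemma frame_infinf b m m' : m != m' -> inr m \in unzip1 (frame b) ->
  inr m' \in unzip1 (frame b) -> exists x,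
    [/\ b = inr x, m \in unzip1 (xcont x) & m' \in unzip1 (xcont x)].
Proof.
move=> mm'; case: b => [[[[[[[x i] j]|[[[x i] d] [|]]]|[[cc y] e]]|[x i]]|[[m0 y] k]]|x] /=.
- by rewrite !inE.
- by case: ifP.
- by case: ifP.
- rewrite unzip1_map_block => /mapP[[//|m1] mt [mE]] /mapP[[//|m1'] mt' [mE']].
  have /and3P[/eqP cE _ _] := tcont_inf mt; have /and3P[/eqP cE' _ _] := tcont_inf mt'.
  by rewrite mE mE' (cl_inj (etrans (esym cE) cE')) eqxx in mm'.
- rewrite unzip1_map_block => /mapP[[//|m1] mt [mE]] /mapP[[//|m1'] mt' [mE']].
  have /and3P[/eqP cE _ _] := jcont_inf mt; have /and3P[/eqP cE' _ _] := jcont_inf mt'.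
  by rewrite mE mE' (cl_inj (etrans (esym cE) cE')) eqxx in mm'.
- case: econt => [[s t]|//]; rewrite !inE /= => /eqP[mE] /eqP[mE'].
  by rewrite mE mE' eqxx in mm'.
- rewrite unzip1_map_block !(mem_map (@inr_inj _ _)) => mt mt'.
  by exists x.
Qed.

Lemma frame_linear u v b b' : u != v ->
  u \in unzip1 (frame b) -> v \in unzip1 (frame b) ->
  u \in unzip1 (frame b') -> v \in unzip1 (frame b') -> b = b'.
Proof.
have inf_uniq m w b1 b2 : inr m \in unzip1 (frame b1) -> inl w \in unzip1 (frame b1) ->
    inr m \in unzip1 (frame b2) -> inl w \in unzip1 (frame b2) -> b1 = b2.
  move=> mb wb mb' wb'; have [y [k [wE ->]]] := frame_inf mb wb.
  have [y' [k' [wE' ->]]] := frame_inf mb' wb'.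
  have : vtx (cl m) y k == vtx (cl m) y' k' by rewrite -wE wE'.
  case E: (vtx (cl m) y' k') => [x i]; rewrite vtxE => /andP[/eqP -> /eqP ->].
  by move/eqP: E; rewrite vtxE => /andP[/eqP -> /eqP ->].
case: u v => [u|m] [v|m'] uv ub vb ub' vb'.
- have {}uv : u != v by apply: contraNneq uv => ->.
  have vu : v != u by rewrite eq_sym.
  have [e|e] := frame_edge uv ub vb; have [e'|e'] := frame_edge uv ub' vb'.
  + exact: edge_fun e e'.
  + exact: edge_opp e e'.
  + exact: edge_opp e e'.
  + exact: edge_fun e e'.
- exact: inf_uniq vb ub vb' ub'.
- exact: inf_uniq ub vb ub' vb'.
- have {}uv : m != m' by apply: contraNneq uv => ->.
  have [x [-> mx mx']] := frame_infinf uv ub vb.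
  have [x' [-> mx1 mx1']] := frame_infinf uv ub' vb'.
  by rewrite (xcont_lin uv mx mx' mx1 mx1').
Qed.

Lemma block_ok_map (Y Y' : eqType) (g : Y -> Y') s :
  injective g -> block_ok (map_block g s) = block_ok s.
Proof.
by move=> g_inj; rewrite /block_ok unzip2_map_block unzip1_map_block map_inj_uniq.
Qed.

Lemma frame_ok b : block_ok (frame b).
Proof.
have shift0 (x d : Z) : (x == x + d) = (d == 0).
  by rewrite -[X in X == _]addr0 (inj_eq (addrI x)) eq_sym.
case: b => [[[[[[[x i] j]|[[[x i] d] [|]]]|[[cc y] e]]|[x i]]|[[m y] k]]|x] /=.
- rewrite /block_ok /= !inE !(inj_eq (@inl_inj _ _)) !xpair_eqE !row_shift !andbF.
  by rewrite shift0 eqxx andbT orbF (negbTE (@row_neq0 (inl j) _)).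
- by case: ifP => // _; rewrite /block_ok /= inE (inj_eq (@inl_inj _ _)) xpair_eqE row_shift andbF.
- case: ifP => // dU; rewrite /block_ok /= inE (inj_eq (@inl_inj _ _)) xpair_eqE shift0.
  by rewrite (negbTE (@row_neq0 (inr (Some d)) dU)).
- by rewrite block_ok_map //; apply: tri_loc_inj.
- by rewrite block_ok_map //; apply: join_loc_inj.
- case E: econt => [[s t]|//]; have /and4P[_ st s3 t3] := econt_ok E.
  by rewrite /block_ok /= !inE s3 t3 st.
- by rewrite block_ok_map //; apply: inr_inj.
Qed.

End Frame.

Lemma sum_delta (T : finType) (u : T) (f : T -> nat) :
  \sum_v (u == v) * f v = f u.
Proof.
rewrite (bigD1 u) //= eqxx mul1n big1 ?addn0 // => v /negbTE.
by rewrite eq_sym => ->.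
Qed.

Lemma weight_map_sum Q (X : finType) (Y : eqType) (g : X -> Y) v s :
  weight Q v (map_block g s) = \sum_u (g u == v) * weight Q u s.
Proof.
rewrite /weight unzip2_map_block big_map.
under [RHS]eq_bigr => u _ do rewrite big_distrr /=.
rewrite exchange_big; apply: eq_bigr => z _ /=.
rewrite -[LHS](sum_delta z.1 (fun u => (g u == v) * Q z.2 (unzip2 s))).
by apply: eq_bigr => u _; rewrite mulnCA.
Qed.

Section Counting.

Variables (D L : nat) (I X : finType).
Notation Z := 'Z_D.
Notation F := ('Z_D * 'I_3)%type.

Variables (p q : Z) (r c : 'I_L -> Z) (Urow Umix : {set Z}).
Variable cl : I -> 'I_3.
Variable tcont : 'I_3 -> Z -> 'I_3 -> seq (('I_3 + I) * nat).
Variable jcont : Z -> 'I_3 -> seq ((bool + I) * nat).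
Variable econt : I -> Z -> 'I_3 -> option (nat * nat).
Variable xcont : X -> seq (I * nat).
Variable Q : nat -> seq nat -> bool.

Notation weight := (weight Q).
Notation frame := (frame p q r c Urow Umix cl tcont jcont econt xcont).
Notation fpoint := (frame_point D I).

Lemma sum_shift (f0 : F) (t : Z) (k : 'I_3) :
  \sum_(f : F) ((f.1 + t, f.2 + k)%R == f0 : nat) = 1.
Proof.
case: f0 => x i; rewrite (bigD1 ((x - t)%R, (i - k)%R)) //= !subrK eqxx big1 // => -[x' i'] /=.
rewrite xpair_eqE negb_and => ne; case: eqP => // -[xE iE].
by rewrite -xE -iE !addrK !eqxx in ne.
Qed.

Lemma sum_shiftM (f0 : F) (t : Z) (k : 'I_3) n :
  \sum_(f : F) ((inl (f.1 + t, f.2 + k)%R : fpoint) == inl f0) * n = n.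
Proof.
rewrite -big_distrl /= -[RHS]mul1n; congr (_ * _).
rewrite -[RHS](sum_shift f0 t k); apply: eq_bigr => f _.
by rewrite (inj_eq (@inl_inj _ _)).
Qed.

Lemma sum_shift0M (f0 : F) n : \sum_(f : F) ((inl f : fpoint) == inl f0) * n = n.
Proof.
rewrite -[RHS](sum_shiftM f0 0%R 0%R); apply: eq_bigr => -[x i] _.
by rewrite !addr0.
Qed.

Lemma sum_pairs (f0 : F) (U : {set Z}) (k : 'I_3) :
  \sum_(z : F * Z) weight (inl f0)
    (if z.2 \in U
     then [:: (inl z.1 : fpoint, 0); (inl (z.1.1 + z.2, z.1.2 + k)%R, 1)] else [::]) =
  #|U| * (Q 0 [:: 0; 1] + Q 1 [:: 0; 1]).
Proof.
rewrite -(pair_bigA _ (fun f d => weight (inl f0)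
    (if d \in U then [:: (inl f : fpoint, 0); (inl (f.1 + d, f.2 + k)%R, 1)] else [::]))) /=.
rewrite exchange_big /= -sum1_card big_distrl /= [RHS]big_mkcond /=.
apply: eq_bigr => d _; case: (d \in U); last first.
  by rewrite big1 // => f _; rewrite /weight big_nil.
rewrite mul1n -[in RHS](sum_shift0M f0 (Q 0 _)) -[in RHS](sum_shiftM f0 d k (Q 1 _)).
rewrite -big_split /=; apply: eq_bigr => f _.
by rewrite /weight !big_cons big_nil addn0.
Qed.

Definition join_weight (x : Z) (i : 'I_3) : nat :=
  weight (inl false) (jcont x i) + weight (inl true) (jcont (x - q)%R i).

Definition tri_weight (x : Z) (i : 'I_3) : nat :=
  \sum_cc \sum_e weight (inl (i - cc)%R) (tcont cc (if i == cc then x else x - p)%R e).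

Definition out_weight (m : I) (y : Z) (k : 'I_3) : nat :=
  if econt m y k is Some (s, t) then Q s [:: s; t] else 0.

Definition in_weight (m : I) (y : Z) (k : 'I_3) : nat :=
  if econt m y k is Some (s, t) then Q t [:: s; t] else 0.

Lemma sum_vtx cc (x : Z) (i : 'I_3) (f : Z -> 'I_3 -> nat) :
  \sum_y \sum_k (vtx p cc y k == (x, i)) * f y k =
  f (if i == cc then x else x - p)%R (i - cc)%R.
Proof.
rewrite -(sum_delta (if i == cc then x else x - p)%R (fun y => f y (i - cc)%R)).
apply: eq_bigr => y _.
rewrite -(sum_delta (i - cc)%R (f y)) big_distrr /=; apply: eq_bigr => k _.
by rewrite vtxE mulnA mulnb andbC ![_ == (i - cc)%R]eq_sym [y == _]eq_sym.
Qed.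

(** A full orbit meets every finite point once in each of its positions, so only triangles, row
    pairs of difference q and infinite points give terms that vary with the point. *)
Lemma sum_frame_fin (x : Z) (i : 'I_3) :
  \sum_b weight (inl (x, i)) (frame b) =
  L * (Q 0 [:: 0; 1; 2] + Q 1 [:: 0; 1; 2] + Q 2 [:: 0; 1; 2]) +
  (#|Urow| + #|Umix|) * (Q 0 [:: 0; 1] + Q 1 [:: 0; 1]) +
  tri_weight x i + join_weight x i +
  \sum_m out_weight m (if i == cl m then x else x - p)%R (i - cl m)%R.
Proof.
rewrite !big_sumType /= [X in _ + X]big1 ?addn0 => [|z _]; last exact: weight_map0.
congr (_ + _ + _ + _ + _).
- transitivity (\sum_(f : F) \sum_(j < L)
        (((inl f : fpoint) == inl (x, i)) * Q 0 [:: 0; 1; 2] +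
         ((inl (f.1 + r j, f.2 + 0)%R : fpoint) == inl (x, i)) * Q 1 [:: 0; 1; 2] +
         ((inl (f.1 + c j, f.2 + 1)%R : fpoint) == inl (x, i)) * Q 2 [:: 0; 1; 2])).
    rewrite pair_bigA; apply: eq_bigr => -[[x' i'] j] _.
    by rewrite /weight !big_cons big_nil addn0 addnA /= addr0.
  rewrite exchange_big -[in RHS](card_ord L) -sum_nat_const; apply: eq_bigr => j _.
  by rewrite !big_split /= sum_shift0M !sum_shiftM.
- rewrite mulnDl -(sum_pairs (x, i) Urow 0%R) -(sum_pairs (x, i) Umix 1%R).
  rewrite -big_split /=.
  transitivity (\sum_(z : F * Z) \sum_(b : bool)
      weight (inl (x, i)) (frame (inl (inl (inl (inl (inr (z, b)))))))).
    by rewrite pair_bigA; apply: eq_bigr => -[[[x' i'] d] b].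
  by apply: eq_bigr => -[[x' i'] d] _; rewrite big_bool /= addnC addr0.
- transitivity (\sum_cc \sum_y \sum_e weight (inl (x, i))
      (map_block (tri_loc p cc y) (tcont cc y e))).
    by rewrite pair_bigA pair_bigA; apply: eq_bigr => -[[cc y] e].
  apply: eq_bigr => cc _.
  rewrite -(sum_vtx cc x i (fun y k => \sum_e weight (inl k) (tcont cc y e))).
  apply: eq_bigr => y _; under eq_bigr => e _ do rewrite weight_map_sum.
  rewrite exchange_big big_sumType /= [X in _ + X]big1 ?addn0.
    by apply: eq_bigr => k _; rewrite big_distrr (inj_eq (@inl_inj _ _)).
  by move=> m _; rewrite big1.
- transitivity (\sum_(f : F) (((inl f : fpoint) == inl (x, i)) * weight (inl false) (jcont x i)
     + ((inl (f.1 + q, f.2 + 0)%R : fpoint) == inl (x, i)) *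
        weight (inl true) (jcont (x - q)%R i))); last first.
    by rewrite big_split /= sum_shift0M sum_shiftM.
  apply: eq_bigr => -[x' i'] _; rewrite weight_map_sum big_sumType /= big_bool /=.
  rewrite [X in _ + X]big1 ?addn0 // addnC addr0 !(inj_eq (@inl_inj _ _)).
  congr (_ + _); case: eqP => //= -[<- <-] //.
  by rewrite addrK.
- transitivity (\sum_m \sum_y \sum_k (vtx p (cl m) y k == (x, i)) * out_weight m y k).
    rewrite pair_bigA pair_bigA; apply: eq_bigr => -[[m y] k] _ /=.
    rewrite /out_weight; case: econt => [[s t]|]; last by rewrite /weight big_nil muln0.
    by rewrite /weight !big_cons big_nil /= !addn0 (inj_eq (@inl_inj _ _)).
  by apply: eq_bigr => m _; rewrite sum_vtx.
Qed.

Lemma sum_frame_inf (m : I) :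
  \sum_b weight (inr m) (frame b) =
  \sum_cc \sum_y \sum_e weight (inr m) (tcont cc y e) +
  \sum_x \sum_i weight (inr m) (jcont x i) +
  \sum_y \sum_k in_weight m y k + \sum_x weight m (xcont x).
Proof.
rewrite !big_sumType /= [X in X + _ + _ + _ + _ + _]big1; last first.
  by case=> [[x i] j] _; rewrite /weight !big_cons big_nil.
rewrite [X in _ + X + _ + _ + _ + _]big1 ?add0n; last first.
  by case=> [[[x i] d] [|]] _; case: ifP => _; rewrite /weight ?big_cons big_nil.
congr (_ + _ + _ + _).
- rewrite pair_bigA pair_bigA; apply: eq_bigr => -[[cc y] e] _ /=.
  rewrite weight_map_sum big_sumType /= big1 ?add0n // -[RHS](sum_delta m (fun m => weight (inr m) _)).
  by apply: eq_bigr => m' _; rewrite (inj_eq (@inr_inj _ _)) eq_sym.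
- rewrite pair_bigA; apply: eq_bigr => -[x i] _ /=.
  rewrite weight_map_sum big_sumType /= big1 ?add0n // -[RHS](sum_delta m (fun m => weight (inr m) _)).
  by apply: eq_bigr => m' _; rewrite (inj_eq (@inr_inj _ _)) eq_sym.
- rewrite -[RHS](sum_delta m (fun m => \sum_y \sum_k in_weight m y k)).
  transitivity (\sum_m' \sum_y \sum_k (m == m') * in_weight m' y k).
    rewrite pair_bigA pair_bigA; apply: eq_bigr => -[[m' y] k] _ /=.
    rewrite /in_weight; case: econt => [[s t]|]; last by rewrite /weight big_nil muln0.
    by rewrite /weight !big_cons big_nil /= !addn0 (inj_eq (@inr_inj _ _)) eq_sym.
  apply: eq_bigr => m' _; rewrite big_distrr; apply: eq_bigr => y _.
  by rewrite big_distrr.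
- by apply: eq_bigr => x _; rewrite weight_map //; apply: inr_inj.
Qed.

(** Such a block carries no letter 1 and needs a coordinate beyond the w1 per point. *)
Definition open_block (Y : Type) (s : seq (Y * nat)) : bool :=
  (unzip2 s != [::]) && (0 \notin unzip2 s).

Lemma card_open_frame :
  #|[set b | (frame b != [::]) && (0 \notin unzip2 (frame b))]| =
  \sum_cc \sum_y \sum_e open_block (tcont cc y e) +
  \sum_x \sum_i open_block (jcont x i) +
  \sum_m \sum_y \sum_k
     (if econt m y k is Some (s, t) then (s != 0) && (t != 0) else false) +
  \sum_x open_block (xcont x).
Proof.
have openE (Y : eqType) (s : seq (Y * nat)) :
    (s != [::]) && (0 \notin unzip2 s) = open_block s by rewrite /open_block; case: s.
rewrite -sum1dep_card big_mkcond /=.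
transitivity (\sum_b (open_block (frame b) : nat)).
  by apply: eq_bigr => b _; rewrite openE; case: open_block.
rewrite !big_sumType /= [X in X + _ + _ + _ + _ + _]big1; last first.
  by case=> [[x i] j] _.
rewrite [X in _ + X + _ + _ + _ + _]big1 ?add0n; last first.
  by case=> [[[x i] d] [|]] _; case: ifP.
congr (_ + _ + _ + _).
- rewrite pair_bigA pair_bigA; apply: eq_bigr => -[[cc y] e] _ /=.
  by rewrite /open_block unzip2_map_block.
- rewrite pair_bigA; apply: eq_bigr => -[x i] _ /=.
  by rewrite /open_block unzip2_map_block.
- rewrite pair_bigA pair_bigA; apply: eq_bigr => -[[m y] k] _ /=.
  case: econt => [[s t]|] //=.
  by rewrite /open_block /= !inE negb_or ![0 == _]eq_sym.
- by apply: eq_bigr => x _; rewrite /open_block unzip2_map_block.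
Qed.

End Counting.

(** [at_pos] counts the blocks where a point has a given position; [one_with_two] counts its edges,
    from the side of position 1, in the graph to be coloured. *)
Definition at_pos (t : nat) (t' : nat) (_ : seq nat) : bool := t' == t.
Definition one_with_two (t : nat) (l : seq nat) : bool := (t == 1) && (2 \in l).

Section FrameCode.

Variables (D L : nat) (I X : finType).
Hypothesis D_gt1 : 1 < D.
Notation Z := 'Z_D.

Variables (p q : Z) (r c : 'I_L -> Z) (Urow Umix : {set Z}).
Variables (cl : I -> 'I_3) (tri : 'I_3 -> Z -> bool).
Variable tcont : 'I_3 -> Z -> 'I_3 -> seq (('I_3 + I) * nat).
Variable jcont : Z -> 'I_3 -> seq ((bool + I) * nat).
Variable econt : I -> Z -> 'I_3 -> option (nat * nat).
Variable xcont : X -> seq (I * nat).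

Definition fin_weight Q (x : Z) (i : 'I_3) : nat :=
  tri_weight p tcont Q x i + join_weight q jcont Q x i +
  \sum_m out_weight econt Q m (if i == cl m then x else x - p)%R (i - cl m)%R.

Definition inf_weight Q (m : I) : nat :=
  \sum_cc \sum_y \sum_e weight Q (inr m) (tcont cc y e) +
  \sum_x \sum_i weight Q (inr m) (jcont x i) +
  \sum_y \sum_k in_weight econt Q m y k + \sum_x weight Q m (xcont x).

Definition frame_open : nat :=
  \sum_cc \sum_y \sum_e open_block (tcont cc y e) +
  \sum_x \sum_i open_block (jcont x i) +
  \sum_m \sum_y \sum_k
     (if econt m y k is Some (s, t) then (s != 0) && (t != 0) else false) +
  \sum_x open_block (xcont x).

Variables (w1 K n : nat) (w' : seq nat).
Hypotheses (w'_le : all (fun x => x <= w1) w') (sum_w' : sumn w' = w1 + L.+1).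
Hypothesis w1_def : L + (#|Urow| + #|Umix|) + K = w1.
Hypothesis L_lt : L < w1.

Hypothesis row_inj : {in row_valid Urow &, injective (row_step q r)}.
Hypothesis row_opp : {in row_valid Urow &, forall n n',
  row_step q r n = (- row_step q r n')%R -> n = inr None /\ n' = inr None}.
Hypothesis row_neq0 : {in row_valid Urow, forall n, row_step q r n != 0%R}.
Hypothesis mix_inj : {in mix_valid Umix &, injective (mix_step p r c)}.
Hypothesis cl_inj : injective cl.
Hypothesis tcont_ok : forall cc y e, block_ok (tcont cc y e).
Hypothesis tcont_fin : forall cc y e k, inl k \in unzip1 (tcont cc y e) ->
  if tri cc y then e == 0%R else (k == e) || (k == e + 1)%R.
Hypothesis tcont_inf : forall cc y e m, inr m \in unzip1 (tcont cc y e) ->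
  [&& cc == cl m, e == 1%R & ~~ tri cc y].
Hypothesis jcont_ok : forall x i, block_ok (jcont x i).
Hypothesis jcont_half : forall x i, (q + q = 0)%R -> jcont x i != [::] ->
  jcont (x + q)%R i = [::].
Hypothesis jcont_inf : forall x i m, inr m \in unzip1 (jcont x i) ->
  [&& i == cl m, ~~ tri i x & ~~ tri i (x + q)%R].
Hypothesis jcont_two : forall x i m, inr m \in unzip1 (jcont x i) ->
  inr m \notin unzip1 (jcont (x + q)%R i).
Hypothesis econt_ok : forall m y k s t, econt m y k = Some (s, t) ->
  [&& tri (cl m) y, s != t, s < 3 & t < 3].
Hypothesis xcont_ok : forall x, block_ok (xcont x).
Hypothesis xcont_lin : forall m m' x x', m != m' ->
  m \in unzip1 (xcont x) -> m' \in unzip1 (xcont x) ->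
  m \in unzip1 (xcont x') -> m' \in unzip1 (xcont x') -> x = x'.

Hypothesis fin0 : forall x i, fin_weight (at_pos 0) x i = K.
Hypothesis fin1 : forall x i, fin_weight (at_pos 1) x i = K.
Hypothesis fin2 : forall x i, fin_weight (at_pos 2) x i = 1.
Hypothesis fin12 : forall x i, fin_weight one_with_two x i <= 1.
Hypothesis inf0 : forall m, inf_weight (at_pos 0) m = w1.
Hypothesis inf1 : forall m, inf_weight (at_pos 1) m = w1.
Hypothesis inf2 : forall m, inf_weight (at_pos 2) m = L.+1.
Hypothesis inf12 : forall m, inf_weight one_with_two m <= L.+1.
Hypothesis open_le : w1 * (3 * D + #|I|) + frame_open <= n.

(** The L slots give a finite point each position L times, and each spare difference gives it
    positions 0 and 1 once. The K further positions 0 and 1, and the one further position 2 that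
    makes L + 1, come from triangles, row pairs of difference q and infinite points. *)
Lemma code_of_frame :
  3 * D + #|I| <= max_ccc (size w').+2 n (2 * sumn (w1 :: w') - 1) (w1 :: w').
Proof.
pose fr := frame p q r c Urow Umix cl tcont jcont econt xcont.
have fr_ok b : block_ok (fr b).
  exact: (frame_ok p c Umix row_neq0 tcont_ok jcont_ok econt_ok xcont_ok).
have card_pt : #|{: frame_point D I}| = 3 * D + #|I|.
  by rewrite card_sum card_prod !card_ord mulnC Zp_cast.
have card_w Q (u : frame_point D I) :
    #|[set b | has (fun z => (z.1 == u) && Q z.2 (unzip2 (fr b))) (fr b)]| =
    \sum_b weight Q u (fr b).
  by apply: card_weight => b; case/and3P: (fr_ok b).
have fin_sum Q x i : \sum_b weight Q (inl (x, i)) (fr b) =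
    L * (Q 0 [:: 0; 1; 2] + Q 1 [:: 0; 1; 2] + Q 2 [:: 0; 1; 2]) +
    (#|Urow| + #|Umix|) * (Q 0 [:: 0; 1] + Q 1 [:: 0; 1]) + fin_weight Q x i.
  by rewrite sum_frame_fin /fin_weight !addnA.
rewrite -card_pt; apply: (@code_of_positions w1 w1 L.+1 n w' _ _ fr) => //.
- exact: leq_ltn_trans L_lt.
- by left.
- move=> v t t3; transitivity (\sum_b weight (at_pos t) v (fr b)).
    rewrite -card_w; apply: eq_card => b; rewrite !inE.
    apply/idP/hasP => [vb|[[u t'] ub /andP[/eqP <- /eqP <-]] //].
    by exists (v, t); rewrite //= eqxx /at_pos eqxx.
  case: v => [[x i]|m].
    rewrite fin_sum; move: (#|Urow| + #|Umix|) w1_def => N w1E.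
    by case: t t3 => [|[|[|//]]] _; rewrite ?fin0 ?fin1 ?fin2 /at_pos /=; lia.
  rewrite sum_frame_inf -/(inf_weight _ m).
  by case: t t3 => [|[|[|//]]] _; rewrite ?inf0 ?inf1 ?inf2.
- move=> v; apply: (@leq_trans (\sum_b weight one_with_two v (fr b))).
    rewrite -card_w; apply/subset_leq_card/subsetP => b; rewrite !inE.
    case/andP => vb two; apply/hasP; exists (v, 1) => //.
    by rewrite /= eqxx /one_with_two two.
  case: v => [[x i]|m].
    rewrite fin_sum.
    by have := fin12 x i; rewrite /one_with_two /=; lia.
  by rewrite sum_frame_inf; exact: inf12.
- move=> u v b b' uv.
  exact: (frame_linear row_inj row_opp mix_inj cl_inj tcont_fin
    tcont_inf jcont_half jcont_inf jcont_two econt_ok xcont_lin).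
- by rewrite card_pt card_open_frame.
Qed.

End FrameCode.

(** * Row and mixed differences modulo D *)

Section Differences.

Variables (D L N : nat) (u v u' v' : 'Z_D) (R : nat -> nat) (C : nat -> bool -> int).
Hypothesis D_gt1 : 1 < D.
Local Open Scope ring_scope.
Hypotheses (uv : v * u = 1) (uv' : v' * u' = 1).
Hypothesis R_inj : forall i j, (i <= L + N)%N -> (j <= L + N)%N -> R i = R j -> i = j.
Hypothesis R_gt0 : forall i, (i <= L + N)%N -> (0 < R i)%N.
Hypothesis R_lt : forall i, (i < L + N)%N -> (2 * R i < D)%N.
Hypothesis R_le : (2 * R (L + N) <= D)%N.
Hypothesis C_row : forall j, (j < L)%N ->
  (C j false)%:~R * u' - (R j)%:R * u = (C j true)%:~R * u' :> 'Z_D.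

(** Mixed differences are measured in units of u', which also serves as the p of the frame; row
    differences are measured in units of u. *)
Definition mix_int (n : 'I_L * bool + 'I_3) : int :=
  match n with
  | inl (j, b) => C j b
  | inr e => if e == 0 then 1 else if e == 1 then 0 else - 1
  end.

Hypothesis mix_int_inj : injective mix_int.
Hypothesis mix_int_lt : forall n n', (`|(mix_int n - mix_int n')%R|%N < D)%N.

Definition row_elt (i : nat) : 'Z_D := (R i)%:R * u.
Definition mix_elt (n : 'I_L * bool + 'I_3) : 'Z_D := (mix_int n)%:~R * u'.
Definition spare_row : {set 'Z_D} := [set row_elt (L + i) | i : 'I_N].
Definition spare_mix : {set 'Z_D} := ~: [set mix_elt n | n in setT].

Let r (j : 'I_L) := row_elt j.
Let c (j : 'I_L) := mix_elt (inl (j, false)).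
Let q := row_elt (L + N).

Lemma mulu_inj : injective (fun x : 'Z_D => x * u).
Proof. by apply: (can_inj (g := fun x => x * v)) => x; rewrite -mulrA [u * v]mulrC uv mulr1. Qed.

Lemma mulu'_inj : injective (fun x : 'Z_D => x * u').
Proof. by apply: (can_inj (g := fun x => x * v')) => x; rewrite -mulrA [u' * v']mulrC uv' mulr1. Qed.

Lemma row_elt_inj i j : (i <= L + N)%N -> (j <= L + N)%N -> row_elt i = row_elt j -> i = j.
Proof.
move=> iL jL /mulu_inj E; apply: R_inj => //; apply: natZp_inj E => //.
  by move: iL; rewrite leq_eqVlt => /predU1P[->|/R_lt]; lia.
by move: jL; rewrite leq_eqVlt => /predU1P[->|/R_lt]; lia.
Qed.

(** Before scaling, row differences lie strictly between 0 and D/2, except that the last one, q, may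
    equal D/2. *)
Lemma row_elt_add i j : (i <= L + N)%N -> (j <= L + N)%N -> row_elt i + row_elt j = 0 ->
  i = (L + N)%N /\ j = (L + N)%N.
Proof.
move=> iL jL; rewrite /row_elt -mulrDl -[in RHS](mul0r u) => /mulu_inj.
rewrite -natrD => /(congr1 val) /=; rewrite val_Zp_nat // => E.
have i0 := R_gt0 iL; have j0 := R_gt0 jL.
move: iL jL; rewrite leq_eqVlt [(j <= _)%N]leq_eqVlt.
case/predU1P => [iE|iL]; case/predU1P => [jE|jL]; split=> //; exfalso; move: E.
all: try have Ri := R_lt iL; try have Rj := R_lt jL; have Rq := R_le.
all: rewrite modn_small; try rewrite iE; try rewrite jE; lia.
Qed.

Lemma mix_elt_inj : injective mix_elt.
Proof.
move=> n n' /mulu'_inj E; apply: mix_int_inj.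
exact: intZp_inj (mix_int_lt n n') E.
Qed.

Lemma row_stepE n : row_valid spare_row n ->
  exists2 i, (i <= L + N)%N & row_step q r n = row_elt i /\
    forall n', row_valid spare_row n' -> row_step q r n' = row_elt i -> n' = n.
Proof.
have r_lt (j : 'I_L) : (j < L + N)%N by have := ltn_ord j; lia.
have s_lt (j : 'I_N) : (L + j < L + N)%N by rewrite ltn_add2l.
have ne i j : (i < j <= L + N)%N -> row_elt i <> row_elt j.
  by case/andP => ij jL /(row_elt_inj (leq_trans (ltnW ij) jL) jL); lia.
have ne' i j : (j < i <= L + N)%N -> row_elt i <> row_elt j.
  by move=> /ne ji /esym/ji.
case: n => [j _|[d|_]].
- exists j; first exact: ltnW.
  split=> // -[j' _|[d|_]] /=.
  + by move/row_elt_inj => E; congr inl; apply/val_inj/E; apply: ltnW.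
  + by case/imsetP => i _ -> /ne' []; have := ltn_ord j; have := s_lt i; lia.
  + by move/ne' => []; have := r_lt j; lia.
- case/imsetP => i _ ->; exists (L + i)%N; first exact: ltnW.
  split=> // -[j' _|[d'|_]] /=.
  + by move/ne => []; have := ltn_ord j'; have := s_lt i; lia.
  + by move=> _ ->.
  + by move/ne' => []; have := s_lt i; lia.
- exists (L + N)%N => //; split=> // -[j' _|[d'|_]] //=.
  + by move/ne => []; have := r_lt j'; lia.
  + by case/imsetP => i _ -> /ne []; have := s_lt i; lia.
Qed.

Lemma diff_row_inj : {in row_valid spare_row &, injective (row_step q r)}.
Proof.
move=> n n' nv nv' E; have [i _ [nE iP]] := row_stepE nv'.
by apply: iP; rewrite // E.
Qed.

Lemma diff_row_opp : {in row_valid spare_row &, forall n n',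
  row_step q r n = - row_step q r n' -> n = inr None /\ n' = inr None}.
Proof.
move=> n n' nv nv' /eqP; rewrite -addr_eq0 => /eqP.
have [i iL [-> iP]] := row_stepE nv; have [j jL [-> jP]] := row_stepE nv'.
case/row_elt_add => // iE jE.
by split; apply/esym; [apply: iP; rewrite // iE|apply: jP; rewrite // jE].
Qed.

Lemma diff_row_neq0 : {in row_valid spare_row, forall n, row_step q r n != 0}.
Proof.
move=> n nv; have [i iL [-> _]] := row_stepE nv.
apply/eqP; rewrite /row_elt -[RHS](mul0r u) => /mulu_inj.
move/(congr1 val) => /=; rewrite val_Zp_nat // modn_small.
  by have := R_gt0 iL; lia.
have := R_gt0 iL.
by move: iL; rewrite leq_eqVlt => /predU1P[->|/R_lt]; move: R_le; lia.
Qed.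

Lemma card_spare_row : #|spare_row| = N.
Proof.
rewrite card_imset ?card_ord // => i j /row_elt_inj E.
by apply/val_inj/(@addnI L)/E; rewrite leq_add2l ltnW.
Qed.

Lemma card_spare_mix : (#|spare_mix| + 2 * L + 3 = D)%N.
Proof.
clear R_le; have := cardsC [set mix_elt n | n in setT]; rewrite -/spare_mix.
move: #|spare_mix| => m; rewrite (card_imset _ mix_elt_inj) cardsT.
by rewrite card_sum card_prod card_bool !card_ord Zp_cast // => <-; lia.
Qed.

Lemma mix_stepE n : mix_step u' r c n =
  match n with
  | inl jb => mix_elt (inl jb)
  | inr (inl e) => mix_elt (inr e)
  | inr (inr d) => d
  end.
Proof.
case: n => [[j [|]]|[e|d]] //=.
  by rewrite /c /r /row_elt /mix_elt /= C_row.
rewrite /mix_elt /= /tri_step; do 2?[case: ifP => _]; rewrite ?mul1r ?mul0r //.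
by rewrite rmorphN1 mulN1r.
Qed.

Lemma diff_mix_inj : {in mix_valid spare_mix &, injective (mix_step u' r c)}.
Proof.
have im n : mix_elt n \notin spare_mix by rewrite inE negbK imset_f ?inE.
move=> n n' nv nv'; rewrite !mix_stepE.
case: n nv => [jb _|[e _|d /= dU]]; case: n' nv' => [jb' _|[e' _|d' /= dU']].
- by move/mix_elt_inj; congruence.
- by move/mix_elt_inj.
- by move=> E; move: dU'; rewrite -E => /(negP (im _)).
- by move/mix_elt_inj.
- by move/mix_elt_inj => [->].
- by move=> E; move: dU'; rewrite -E => /(negP (im _)).
- by move=> E; move: dU; rewrite E => /(negP (im _)).
- by move=> E; move: dU; rewrite E => /(negP (im _)).
- by move=> ->.
Qed.

End Differences.

Lemma weightE Q (X : eqType) (u : X) s :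
  weight Q u s = count (fun z => (z.1 == u) && Q z.2 (unzip2 s)) s.
Proof.
rewrite /weight; move: (unzip2 s) => l; elim: s => [|z s IHs]; first by rewrite big_nil.
by rewrite big_cons IHs /= mulnb.
Qed.

(* Zones of the indices y of triangles.  The pair {x, x+q} of row difference q
   runs from a Tail to a Head and goes through an infinite point, which then
   uses an edge of the triangle at x and one of the triangle at x+q; the other
   triangles are kept.  In a zone KeptB (KeptA) the vertex of row 2 of a kept
   triangle of class 1 has position 1 (0) in its pair with the infinite point;
   LastB and LastA are single indices, those after which the half of 'Z_D
   changes. *)
Inductive zone := Tail | KeptB | LastB | Head | KeptA | LastA.

Definition kept (z : zone) := match z with Tail | Head => false | _ => true end.
Definition keptB (z : zone) := match z with KeptB | LastB => true | _ => false end.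

Definition I3_0 : 'I_3 := @Ordinal 3 0 isT.
Definition I3_1 : 'I_3 := @Ordinal 3 1 isT.
Definition I3_2 : 'I_3 := @Ordinal 3 2 isT.

Lemma I3_case (P : 'I_3 -> Prop) : P I3_0 -> P I3_1 -> P I3_2 -> forall i, P i.
Proof.
move=> P0 P1 P2 [[|[|[|//]]] i3].
- by rewrite (_ : Ordinal i3 = I3_0) //; apply/val_inj.
- by rewrite (_ : Ordinal i3 = I3_1) //; apply/val_inj.
- by rewrite (_ : Ordinal i3 = I3_2) //; apply/val_inj.
Qed.

(** * Position tables for the triangles *)

Section Tables.

Variable I : Type.
Notation fin k := (@inl 'I_3 I k).
Notation infty m := (@inr 'I_3 I m).

(** With points at infinity, the tables are chosen to give every finite point positions 0, 1, 2
    exactly 3, 3, 1 times in total, together with the row pairs of difference q and the pairs with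
    infinite points; [fin_weights] checks this zone by zone. *)
Definition tri0 (z : zone) (e : nat) : seq (('I_3 + I) * nat) :=
  match z, e with
  | Tail, 0 => [:: (fin I3_0, 0); (fin I3_1, 1)]
  | Tail, 1 => [:: (fin I3_1, 0); (fin I3_2, 1)]
  | Tail, _ => [:: (fin I3_2, 0); (fin I3_0, 1)]
  | (KeptB | LastB), 0 => [:: (fin I3_0, 0); (fin I3_1, 1)]
  | (KeptB | LastB), 1 => [:: (fin I3_1, 0); (fin I3_2, 2)]
  | (KeptB | LastB), _ => [:: (fin I3_2, 0); (fin I3_0, 1)]
  | _, 0 => [:: (fin I3_1, 0); (fin I3_0, 1)]
  | _, 1 => [:: (fin I3_1, 1); (fin I3_2, 2)]
  | _, _ => [:: (fin I3_0, 0); (fin I3_2, 1)]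
  end.

Definition tri1 (m : I) (z : zone) (e : nat) : seq (('I_3 + I) * nat) :=
  match z, e with
  | Tail, 0 => [:: (fin I3_1, 0); (fin I3_0, 2)]
  | Tail, 1 => [:: (infty m, 0); (fin I3_2, 1); (fin I3_1, 2)]
  | Head, 0 => [:: (fin I3_1, 0); (fin I3_0, 1)]
  | Head, 1 => [:: (fin I3_1, 0); (fin I3_2, 1); (infty m, 2)]
  | (Tail | Head), _ => [:: (fin I3_2, 0); (fin I3_0, 1)]
  | _, 0 => [:: (fin I3_1, 0); (fin I3_2, 1); (fin I3_0, 2)]
  | _, _ => [::]
  end.

Definition tri2_full (e : nat) : seq (('I_3 + I) * nat) :=
  if e is 0 then [:: (fin I3_2, 0); (fin I3_0, 1); (fin I3_1, 2)] else [::].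

Definition tri2 (m : I) (z : zone) (e : nat) : seq (('I_3 + I) * nat) :=
  match z, e with
  | Tail, 0 => [:: (fin I3_0, 0); (fin I3_1, 1)]
  | Tail, 1 => [:: (infty m, 0); (fin I3_2, 1); (fin I3_1, 2)]
  | Head, 0 => [:: (fin I3_1, 0); (fin I3_0, 1)]
  | Head, 1 => [:: (fin I3_2, 0); (infty m, 1); (fin I3_1, 2)]
  | (Tail | Head), _ => [:: (fin I3_2, 0); (fin I3_0, 1)]
  | _, _ => tri2_full e
  end.

(* Positions (at the finite vertex, at the infinite one) of the pairs left over
   when a triangle of class 1 is kept. *)
Definition out1 (z : zone) (k : nat) : option (nat * nat) :=
  if kept z then
    match k with
    | 0 => Some (1, 0)
    | 1 => if keptB z then Some (1, 0) else Some (0, 1)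
    | _ => Some (0, 1)
    end
  else None.

Definition plain_pair : seq ((bool + I) * nat) := [:: (inl false, 0); (inl true, 1)].

End Tables.

Arguments plain_pair {I}.


(** Each half, [0, h) and [h, D), starts with a indices of split triangles: an infinite point needs
    position 2 exactly a times and gets it once per index of one of these two zones. With l = 1 the
    last index of each half is singled out. *)
Definition zone_of (a h l D y : nat) : zone :=
  if y < a then Tail else if y < h - l then KeptB else if y < h then LastB
  else if y < h + a then Head else if y < D - l then KeptA else LastA.

Lemma sum_zone_nat (F : nat -> nat) (m n : nat) c :
  m <= n -> (forall y, m <= y < n -> F y = c) -> \sum_(m <= y < n) F y = (n - m) * c.
Proof.
by move=> mn Fc; rewrite (eq_big_nat _ _ Fc) sum_nat_const_nat.
Qed.

Lemma sum_zone (a h l D : nat) (f : zone -> nat) :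
  1 < D -> a + l <= h -> h + a + l <= D ->
  \sum_(y : 'Z_D) f (zone_of a h l D y) =
  a * f Tail + (h - l - a) * f KeptB + l * f LastB +
  (a * f Head + (D - l - h - a) * f KeptA + l * f LastA).
Proof.
move=> D1 alh hal.
have -> : \sum_(y : 'Z_D) f (zone_of a h l D y) = \sum_(0 <= y < D) f (zone_of a h l D y).
  by rewrite -(big_mkord xpredT (fun y => f (zone_of a h l D y))) Zp_cast.
rewrite (@big_cat_nat _ _ _ h) //=; last by lia.
rewrite (@big_cat_nat _ _ _ (h - l) 0 h) //=; last by lia.
rewrite (@big_cat_nat _ _ _ a 0 (h - l)) //=; last by lia.
rewrite (@big_cat_nat _ _ _ (D - l) h D) //=; [|by lia|by lia].
rewrite (@big_cat_nat _ _ _ (h + a) h (D - l)) //=; [|by lia|by lia].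
have zone_sum m n z : m <= n -> (forall y, m <= y < n -> zone_of a h l D y = z) ->
    \sum_(m <= y < n) f (zone_of a h l D y) = (n - m) * f z.
  by move=> mn zE; apply: sum_zone_nat => // y /zE ->.
rewrite (zone_sum 0 a Tail) // ?(zone_sum a (h - l) KeptB) ?(zone_sum (h - l) h LastB)
  ?(zone_sum h (h + a) Head) ?(zone_sum (h + a) (D - l) KeptA)
  ?(zone_sum (D - l) D LastA); try lia.
all: try by rewrite /zone_of => y yb; do ?[case: ltnP => ?] => //; exfalso; lia.
by congr (_ * _ + _ * _ + _ * _ + (_ * _ + _ * _ + _ * _)); lia.
Qed.

Lemma Zp_shift (D t : nat) (x : 'Z_D) : 1 < D -> t < D ->
  val (x + t%:R)%R = if x + t < D then x + t else x + t - D.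
Proof.
move=> D1 tD; rewrite -[in LHS](natr_Zp x) -natrD.
transitivity ((x + t) %% D); first exact: val_Zp_nat.
have : x < D by have := ltn_ord x; rewrite [X in _ < X]Zp_cast.
case: (ltnP (x + t) D) => [lt _|ge xD]; first by rewrite modn_small.
by rewrite -[in LHS](subnK ge) modnDr modn_small //; lia.
Qed.

(** * 3D + 1 points: D odd, one point at infinity *)

Section OneInfinity.

Variables (a k : nat).
Hypothesis a_gt0 : 0 < a.

Let h := a + k + 1.
Let D := 2 * (a + k) + 1.
Let st (x : 'Z_D) : zone := zone_of a h 0 D x.

(** Modulo the odd D, [q] is 1/2 and [p] is 1/4. With i = j + 2, slot j has the row difference i/2
    and the mixed differences i/4 and -i/4; the value i = 1 is left to q and the triangles. *)
Let q : 'Z_D := h%:R%R.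
Let p : 'Z_D := (q * q)%R.
Let R (j : nat) : nat := if j == a.-1 + k then 1 else j.+2.
Let C (j : nat) (b : bool) : int := if b then (- (j.+2)%:Z)%R else (j.+2)%:Z%R.

Let D_gt1 : 1 < D. Proof. by rewrite /D; lia. Qed.

Let uv : (2%:R * q = 1 :> 'Z_D)%R.
Proof.
rewrite /q -natrM (_ : 2 * h = D + 1); last by rewrite /h /D; lia.
by rewrite natrD pchar_Zp // add0r.
Qed.

Let uv' : (2%:R * 2%:R * p = 1 :> 'Z_D)%R.
Proof. by rewrite /p mulrACA uv mulr1. Qed.

Definition one_table (cc : 'I_3) (z : zone) (e : 'I_3) : seq (('I_3 + 'I_1) * nat) :=
  match val cc with
  | 0 => tri0 _ z e
  | 1 => tri1 ord0 z e
  | _ => tri2_full _ e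
  end.
Definition one_tri (cc : 'I_3) (z : zone) : bool :=
  match val cc with 0 => false | 1 => kept z | _ => true end.
Definition one_join (tail : bool) (i : nat) : seq ((bool + 'I_1) * nat) :=
  if (i == 1) && tail then [:: (inl false, 0); (inr ord0, 1); (inl true, 2)]
  else plain_pair.
Definition is_tail (z : zone) := if z is Tail then true else false.
Definition is_head (z : zone) := if z is Head then true else false.

Let tcont cc (y : 'Z_D) e := one_table cc (st y) e.
Let tri cc (y : 'Z_D) := one_tri cc (st y).
Let jcont (x : 'Z_D) (i : 'I_3) := one_join (is_tail (st x)) i.
Let econt (_ : 'I_1) (y : 'Z_D) (k : 'I_3) := out1 (st y) k.
(** The zones give the infinite point position 1 only w1 - 1 times; this single-point block supplies
    the last one. *)
Let xcont (_ : 'I_1) : seq ('I_1 * nat) := [:: (ord0, 1)].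
Let cl (_ : 'I_1) : 'I_3 := I3_1.

Let st_head x : is_tail (st x) -> st (x + q)%R = Head.
Proof.
rewrite /st /q (Zp_shift _ D_gt1); last by rewrite /h /D; lia.
have hD : h = a + k + 1 /\ D = 2 * (a + k) + 1 by [].
rewrite /zone_of; case: (ltnP x a) => [xa _|xa]; last by do !case: ifP.
case: (ltnP (x + h) D) => xD; do ?[case: ltnP => ?] => //; exfalso; lia.
Qed.

Let st_tail x : is_tail (st (x - q)%R) = is_head (st x).
Proof.
set y := (x - q)%R; have -> : x = (y + q)%R by rewrite /y subrK.
apply/idP/idP => [/st_head -> //|].
rewrite /st /q (Zp_shift _ D_gt1); last by rewrite /h /D; lia.
have hD : h = a + k + 1 /\ D = 2 * (a + k) + 1 by [].
rewrite /zone_of; case: (ltnP (y + h) D) => xD; do ?[case: ltnP => ?] => //; exfalso;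
  have := ltn_ord y; rewrite [X in _ < X]Zp_cast //; lia.
Qed.


Let tcont_ok cc y e : block_ok (tcont cc y e).
Proof.
rewrite /tcont /one_table; case: (st y); move: cc e; do 2!apply: I3_case; by vm_compute.
Qed.

Let tcont_fin cc y e l : inl l \in unzip1 (tcont cc y e) ->
  if tri cc y then e == 0%R else (l == e) || (l == e + 1)%R.
Proof.
rewrite /tcont /tri /one_table /one_tri.
by case: (st y); move: cc e l; do 3!apply: I3_case; vm_compute.
Qed.

Let tcont_inf cc y e m : inr m \in unzip1 (tcont cc y e) ->
  [&& cc == cl m, e == 1%R & ~~ tri cc y].
Proof.
rewrite /tcont /tri /one_table /one_tri [m]ord1.
by case: (st y); move: cc e; do 2!apply: I3_case; vm_compute.
Qed.


Let fin_weights x i : [/\ fin_weight p q cl tcont jcont econt (at_pos 0) x i = 3,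
  fin_weight p q cl tcont jcont econt (at_pos 1) x i = 3,
  fin_weight p q cl tcont jcont econt (at_pos 2) x i = 1 &
  fin_weight p q cl tcont jcont econt one_with_two x i <= 1].
Proof.
rewrite /fin_weight /tri_weight /join_weight /out_weight /econt /tcont /jcont /one_table.
rewrite !big_ord_recl !big_ord0 !(fun_if st) st_tail.
move: (st x) (st (x - p)%R) => s s'; rewrite !weightE.
by split; move: i; apply: I3_case; case: s; case: s'; vm_compute.
Qed.

Definition one_inf_zone Q (m : 'I_1) (z : zone) : nat :=
  \sum_cc \sum_e weight Q (inr m) (one_table cc z e) +
  \sum_(i : 'I_3) weight Q (inr m) (one_join (is_tail z) i) +
  \sum_(k : 'I_3) (if out1 z k is Some (s, t) then Q t [:: s; t] else 0).

Definition one_open_zone (z : zone) : nat :=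
  \sum_cc \sum_e open_block (one_table cc z e) +
  \sum_(i : 'I_3) open_block (one_join (is_tail z) i) +
  \sum_(k : 'I_3) (if out1 z k is Some (s, t) then (s != 0) && (t != 0) else false).

Let inf_weightE Q m : inf_weight tcont jcont econt xcont Q m =
  \sum_(y : 'Z_D) one_inf_zone Q m (zone_of a h 0 D y) + Q 1 [:: 1].
Proof.
rewrite /inf_weight [m]ord1 big_ord1 weightE /= addn0.
by rewrite [X in X + _ + _ + _]exchange_big -!big_split.
Qed.

Let frame_openE : frame_open tcont jcont econt xcont =
  \sum_(y : 'Z_D) one_open_zone (zone_of a h 0 D y) + 1.
Proof.
rewrite /frame_open !big_ord1.
by rewrite [X in X + _ + _ + _]exchange_big -!big_split.
Qed.

Lemma one_inf_zoneE m z :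
  ((one_inf_zone (at_pos 0) m z =
       match z with Tail => 1 | Head => 0 | KeptB | LastB => 2 | _ => 1 end) *
   (one_inf_zone (at_pos 1) m z =
       match z with Tail => 1 | Head => 0 | KeptB | LastB => 1 | _ => 2 end) *
   (one_inf_zone (at_pos 2) m z = if z is Head then 1 else 0) *
   (one_inf_zone one_with_two m z = if z is Tail then 1 else 0))%type.
Proof.
rewrite /one_inf_zone [m]ord1 !big_ord_recl !big_ord0 !weightE.
by do !split; case: z; vm_compute.
Qed.

Lemma one_open_zoneE z :
  one_open_zone z = match z with Head | KeptA | LastA => 1 | _ => 0 end.
Proof.
rewrite /one_open_zone !big_ord_recl !big_ord0.
by case: z; vm_compute.
Qed.

Lemma code_of_one_infinity (n : nat) (w' : seq nat) (w1 := a + (3 * k + 2)) :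
  all (fun x => x <= w1) w' -> sumn w' = w1 + a ->
  w1 * (3 * D + 1) + (a + k + 1) <= n ->
  3 * D + 1 <= max_ccc (size w').+2 n (2 * sumn (w1 :: w') - 1) (w1 :: w').
Proof.
move=> w'_le sum_w' size_n.
have R_inj i j : i <= a.-1 + k -> j <= a.-1 + k -> R i = R j -> i = j.
  by rewrite /R; case: eqP; case: eqP; lia.
have R_gt0 i : i <= a.-1 + k -> 0 < R i by rewrite /R; case: eqP.
have R_lt i : i < a.-1 + k -> 2 * R i < D by rewrite /R /D; case: eqP; lia.
have R_le : 2 * R (a.-1 + k) <= D by rewrite /R eqxx /D; lia.
have pp : (p + p = q)%R by rewrite -[in RHS](mul1r q) -uv -mulrA mulr_natl mulr2n.
have C_row j : j < a.-1 ->
    ((C j false)%:~R * p - (R j)%:R * q = (C j true)%:~R * p :> 'Z_D)%R.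
  move=> ja; rewrite /C /R ifN; last by lia.
  have -> : (j.+2%:R * q = j.+2%:R * p + j.+2%:R * p :> 'Z_D)%R.
    by rewrite -mulrDr pp.
  by rewrite rmorphN /= mulNr opprD addrA subrr add0r.
have mi : injective (mix_int (L := a.-1) C).
  case=> [[i [|]]|e] [[j [|]]|e'] /=; rewrite /C.
  all: try by move=> E; congr (inl (_, _)); apply/ord_inj; move: E => /=; lia.
  all: try by move=> E; exfalso; lia.
  all: try by case: ifP => _; [|case: ifP => _]; move=> E; exfalso; lia.
  by case: e => -[|[|[|//]]] ?; case: e' => -[|[|[|//]]] ? //= _; congr inr; apply/val_inj.
have mi_lt n1 n2 : `|(mix_int (L := a.-1) C n1 - mix_int (L := a.-1) C n2)%R|%N < D.
  have b m : `|mix_int (L := a.-1) C m|%N <= a.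
    case: m => [[i [|]]|e] /=; rewrite /C; try by have := ltn_ord i; lia.
    by case: ifP => _; [|case: ifP => _]; lia.
  by have := b n1; have := b n2; move: (mix_int _ _) (mix_int _ _) => x y; rewrite /D; lia.
have cU := card_spare_row D_gt1 uv R_inj R_lt R_le.
have cM := card_spare_mix D_gt1 uv' mi mi_lt.
have ri := diff_row_inj D_gt1 uv R_inj R_lt R_le.
have ro := diff_row_opp D_gt1 uv R_inj R_gt0 R_lt R_le.
have r0 := diff_row_neq0 D_gt1 uv R_inj R_gt0 R_lt R_le.
have mj := diff_mix_inj D_gt1 uv' C_row mi mi_lt.
have qE : row_elt q R (a.-1 + k) = q by rewrite /row_elt /R eqxx mul1r.
rewrite qE in ri ro r0.
have hD : h = a + k + 1 /\ D = 2 * (a + k) + 1 by [].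
have qq : (q + q = 1)%R by rewrite -mulr2n -mulr_natl uv.
have q0 : (1 : 'Z_D)%R != 0%R by exact: oner_neq0.
have cF : #|'I_1| = 1 by rewrite card_ord.
rewrite -[X in 3 * D + X <= _]cF.
apply: (code_of_frame (K := 3) D_gt1 w'_le _ _ _ ri ro r0 mj
  (cl := cl) (tri := tri) (tcont := tcont) (jcont := jcont) (econt := econt) (xcont := xcont)).
- by rewrite prednK.
- by rewrite cU; move: #|spare_mix _ _ _| cM => m; rewrite /w1 /D; lia.
- by rewrite /w1; lia.
- by move=> m m' _; rewrite [m]ord1 [m']ord1.
- exact: tcont_ok.
- exact: tcont_fin.
- exact: tcont_inf.
- by move=> x i; rewrite /jcont /one_join; case: ifP.
(* As D is odd, q is not its own opposite: q + q = 1. *)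
- by move=> x i /eqP; rewrite qq (negbTE q0).
- move=> x i m; rewrite /jcont /one_join /tri /one_tri /cl; case: ifP => // /andP[/eqP i1 tx] _.
  rewrite (st_head tx) (_ : i = I3_1); last exact/val_inj.
  by case: (st x) tx.
- move=> x i m; rewrite /jcont /one_join; case: ifP => // /andP[_ tx] _.
  by rewrite (st_head tx) andbF.
- move=> m y l s t; rewrite /econt /out1 /tri /one_tri /=; case: (st y) => //=;
    by case: (val l) => [|[|j]] [<- <-].
- by [].
- by move=> m m'; rewrite [m]ord1 [m']ord1.
- by move=> x i; have [] := fin_weights x i.
- by move=> x i; have [] := fin_weights x i.
- by move=> x i; have [] := fin_weights x i.
- by move=> x i; have [] := fin_weights x i.
- by move=> m; rewrite inf_weightE sum_zone ?one_inf_zoneE /at_pos /w1 /=; lia.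
- by move=> m; rewrite inf_weightE sum_zone ?one_inf_zoneE /at_pos /w1 /=; lia.
- by move=> m; rewrite inf_weightE sum_zone ?one_inf_zoneE /at_pos /=; lia.
- by move=> m; rewrite inf_weightE sum_zone ?one_inf_zoneE /one_with_two /=; lia.
- rewrite frame_openE sum_zone ?one_open_zoneE ?card_ord; lia.
Qed.
End OneInfinity.

(* The slots of row differences 2i are {x, x+2i} in one row and x+m+2+i in the
   next, with m = (a-1)/2, so that their two mixed differences m+2+i and m+2-i
   move apart symmetrically; the odd row differences do the same further up, and
   all mixed differences used lie in [2, 2a]. *)
Lemma even_differences (a h : nat) (D := 2 * h) (q : 'Z_D := h%:R%R) : 0 < a < h ->
  exists (r c : 'I_a.-1 -> 'Z_D) (Urow Umix : {set 'Z_D}),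
  [/\ {in row_valid Urow &, injective (row_step q r)},
      {in row_valid Urow &, forall n n',
        row_step q r n = (- row_step q r n')%R -> n = inr None /\ n' = inr None} &
      {in row_valid Urow, forall n, row_step q r n != 0%R}] /\
  [/\ {in mix_valid Umix &, injective (mix_step 1%R r c)},
      #|Urow| = h - a & #|Umix| + 2 * a.-1 + 3 = D].
Proof.
case/andP => a0 ah; have DE : D = 2 * h by [].
have D1 : 1 < D by lia.
have uv : (1 * 1 = 1 :> 'Z_D)%R by rewrite mulr1.
have [m [u [am um]]] : exists m u, a.-1 = m + u /\ m <= u <= m.+1.
  by exists (a.-1 %/ 2), (a.-1 - a.-1 %/ 2); lia.
(* The slots take the row differences 1 to a - 1, even ones first. From there on index j carries j +
   1, so the last index h - 1 carries q = h. *)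
pose R j := if j < m then 2 * j + 2 else if j < a.-1 then 2 * (j - m) + 1 else j.+1.
pose C j b : int := if j < m then (if b then Posz (m + 1 - j) else Posz (m + 3 + j))
  else if b then Posz (2 * m + 2 + u - (j - m)) else Posz (2 * m + 3 + u + (j - m)).
have LN : a.-1 + (h - a) = h.-1 by lia.
have R_inj i j : i <= a.-1 + (h - a) -> j <= a.-1 + (h - a) -> R i = R j -> i = j.
  by rewrite /R LN; do 4![case: ltnP => ?]; lia.
have R_gt0 i : i <= a.-1 + (h - a) -> 0 < R i.
  by rewrite /R; case: (ltnP i m) => ?; [|case: (ltnP i a.-1) => ?]; lia.
have R_lt i : i < a.-1 + (h - a) -> 2 * R i < D.
  by rewrite /R LN; case: (ltnP i m) => ?; [|case: (ltnP i a.-1) => ?]; lia.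
have Rh : R (a.-1 + (h - a)) = h by rewrite /R LN; case: (ltnP _ m) => ?; [|case: (ltnP _ a.-1) => ?]; lia.
have R_le : 2 * R (a.-1 + (h - a)) <= D by rewrite Rh.
have C_row j : j < a.-1 ->
    ((C j false)%:~R * 1 - (R j)%:R * 1 = (C j true)%:~R * 1 :> 'Z_D)%R.
  move=> ja; rewrite !mulr1 -[((R j)%:R)%R]/((Posz (R j))%:~R)%R -rmorphB; congr (_%:~R)%R.
  by rewrite /C /R ja; case: ltnP => ?; lia.
have mi : injective (mix_int (L := a.-1) C).
  have C_big j b : j < a.-1 -> (2 <= C j b)%R by move=> ja; rewrite /C; case: b; case: ltnP => ?; lia.
  case=> [[i b]|e] [[j b']|e'] /=.
  - have [il jl] := (ltn_ord i, ltn_ord j); move=> E.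
    have [-> /ord_inj -> //] : b = b' /\ i = j :> nat.
    by move: E; rewrite /C; case: b; case: b'; do 2![case: ltnP => ?]; lia.
  - by have := C_big i b (ltn_ord i); do 2?[case: ifP => _]; lia.
  - by have := C_big j b' (ltn_ord j); do 2?[case: ifP => _]; lia.
  - by move: e e'; do 2!apply: I3_case.
have mi_lt n1 n2 : `|(mix_int (L := a.-1) C n1 - mix_int (L := a.-1) C n2)%R|%N < D.
  have b n : (-1 <= mix_int (L := a.-1) C n <= 2 * Posz a)%R.
    case: n => [[i b]|e] /=; last by do 2?[case: ifP => _]; lia.
    by have il := ltn_ord i; rewrite /C; case: b; case: ltnP => ?; lia.
  by have := b n1; have := b n2; move: (mix_int _ _) (mix_int _ _) => x y; lia.
have qE : row_elt (1%R : 'Z_D) R (a.-1 + (h - a)) = q by rewrite /row_elt Rh mulr1.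
exists (fun j => row_elt 1%R R j), (fun j => mix_elt 1%R C (inl (j, false))).
exists (spare_row a.-1 (h - a) 1%R R), (spare_mix a.-1 1%R C).
split; split.
- by rewrite -qE; apply: (diff_row_inj D1 uv).
- by rewrite -qE; apply: (diff_row_opp D1 uv).
- by rewrite -qE; apply: (diff_row_neq0 D1 uv).
- exact: (diff_mix_inj D1 uv).
- exact: (card_spare_row D1 uv).
- exact: (card_spare_mix D1 uv).
Qed.

(** * 3D + 2 points: D even, two points at infinity *)

Section TwoInfinities.

Variables (a k : nat).
Hypothesis a_gt0 : 0 < a.

Let h := a + k + 1.
Let D := 2 * h.
Let st (x : 'Z_D) : zone := zone_of a h 1 D x.
Let q : 'Z_D := h%:R%R.

Let D_gt1 : 1 < D. Proof. by rewrite /D /h; lia. Qed.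

Definition zone_opp (z : zone) := match z with
  | Tail => Head | KeptB => KeptA | LastB => LastA
  | Head => Tail | KeptA => KeptB | LastA => LastB end.
Definition low (z : zone) := match z with Tail | KeptB | LastB => true | _ => false end.
(** Whether the next index lies in the first half. Since p = 1, the vertices 1 and 2 of the triangle
    at x - 1 lie at x, and their positions depend on the half of x. *)
Definition low_next (z : zone) := match z with Tail | KeptB | LastA => true | _ => false end.

Let st_opp x : st (x + q)%R = zone_opp (st x).
Proof.
have hD : h = a + k + 1 /\ D = 2 * h by [].
have xD : x < D by have := ltn_ord x; rewrite [X in _ < X]Zp_cast.
rewrite /st /q (Zp_shift _ D_gt1); last by lia.
rewrite /zone_of; case: (ltnP (x + h) D) => ?;
  do ?[case: ltnP => ?] => //; exfalso; lia.
Qed.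

Let st_sub x : st (x - q)%R = zone_opp (st x).
Proof.
by set y := (x - q)%R; rewrite -[x](subrK q) -/y st_opp; case: (st y).
Qed.

Let st_next x : low (st x) = low_next (st (x - 1)%R).
Proof.
have hD : h = a + k + 1 /\ D = 2 * h by [].
set y := (x - 1)%R; have -> : x = (y + 1%:R)%R by rewrite /y subrK.
have yD : y < D by have := ltn_ord y; rewrite [X in _ < X]Zp_cast.
rewrite /st (Zp_shift _ D_gt1) // /zone_of; case: (ltnP (y + 1) D) => ?;
  do ?[case: ltnP => ?] => //; exfalso; lia.
Qed.

Definition I2_0 : 'I_2 := @Ordinal 2 0 isT.
Definition I2_1 : 'I_2 := @Ordinal 2 1 isT.

Definition two_table (cc : 'I_3) (z : zone) (e : 'I_3) : seq (('I_3 + 'I_2) * nat) :=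
  match val cc with
  | 0 => tri0 _ z e
  | 1 => tri1 I2_0 z e
  | _ => tri2 I2_1 z e
  end.
Definition two_tri (cc : 'I_3) (z : zone) : bool :=
  if val cc is 0 then false else kept z.
Definition two_join (i : 'I_3) (z z' : zone) : seq ((bool + 'I_2) * nat) :=
  match val i with
  | 0 => if low z' then plain_pair else [::]
  | 1 => if is_tail z then [:: (inl false, 0); (inr I2_0, 1); (inl true, 2)]
         else if low z then plain_pair else [::]
  | _ => if is_tail z then [:: (inl true, 0); (inl false, 1); (inr I2_1, 2)]
         else if low z then plain_pair else [::]
  end.
Definition two_out (m : 'I_2) (z : zone) (k : 'I_3) : option (nat * nat) :=
  if val m is 0 then out1 z k else
  if kept z then
    if (if val k == 2 then low_next z else low z) then Some (1, 0) else Some (0, 1)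
  else None.

Let tcont cc (y : 'Z_D) e := two_table cc (st y) e.
Let tri cc (y : 'Z_D) := two_tri cc (st y).
Let jcont (x : 'Z_D) (i : 'I_3) := two_join i (st x) (st (x - 1)%R).
Let econt m (y : 'Z_D) k := two_out m (st y) k.
(** Beyond the zones each infinite point lacks one position 0 and one position 1; the pair of both
    points supplies two of these, single-point blocks the other two. *)
Let xcont (x : 'I_3) : seq ('I_2 * nat) := match val x with
  | 0 => [:: (I2_0, 1)] | 1 => [:: (I2_0, 0); (I2_1, 1)] | _ => [:: (I2_1, 0)] end.
Definition two_cl (m : 'I_2) : 'I_3 := if val m is 0 then I3_1 else I3_2.

Lemma I2_case (P : 'I_2 -> Prop) : P I2_0 -> P I2_1 -> forall i, P i.
Proof.
move=> P0 P1 [[|[|//]] i2].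
- by rewrite (_ : Ordinal i2 = I2_0) //; apply/val_inj.
- by rewrite (_ : Ordinal i2 = I2_1) //; apply/val_inj.
Qed.

Let tcont_ok cc y e : block_ok (tcont cc y e).
Proof.
rewrite /tcont /two_table; case: (st y); move: cc e; do 2!apply: I3_case; by vm_compute.
Qed.

Let tcont_fin cc y e l : inl l \in unzip1 (tcont cc y e) ->
  if tri cc y then e == 0%R else (l == e) || (l == e + 1)%R.
Proof.
rewrite /tcont /tri /two_table /two_tri.
by case: (st y); move: cc e l; do 3!apply: I3_case; vm_compute.
Qed.

Let tcont_inf cc y e m : inr m \in unzip1 (tcont cc y e) ->
  [&& cc == two_cl m, e == 1%R & ~~ tri cc y].
Proof.
rewrite /tcont /tri /two_table /two_tri; move: m; apply: I2_case;
by case: (st y); move: cc e; do 2!apply: I3_case; vm_compute.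
Qed.

Let fin_weights x i : [/\ fin_weight 1%R q two_cl tcont jcont econt (at_pos 0) x i = 3,
  fin_weight 1%R q two_cl tcont jcont econt (at_pos 1) x i = 3,
  fin_weight 1%R q two_cl tcont jcont econt (at_pos 2) x i = 1 &
  fin_weight 1%R q two_cl tcont jcont econt one_with_two x i <= 1].
Proof.
rewrite /fin_weight /tri_weight /join_weight /out_weight /econt /tcont /jcont /two_table.
rewrite !big_ord_recl !big_ord0 !(fun_if st) addrAC !st_sub.
move: (st_next x); move: (st x) (st (x - 1)%R) => s s' ss'; rewrite !weightE.
by split; move: ss'; move: i; apply: I3_case; case: s; case: s' => // _; vm_compute.
Qed.

Definition two_inf_zone Q (m : 'I_2) (z : zone) : nat :=
  \sum_cc \sum_e weight Q (inr m) (two_table cc z e) +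
  \sum_(i : 'I_3) weight Q (inr m) (two_join i z Head) +
  \sum_(k : 'I_3) (if two_out m z k is Some (s, t) then Q t [:: s; t] else 0).

Definition two_open_zone (z : zone) : nat :=
  \sum_cc \sum_e open_block (two_table cc z e) +
  \sum_(i : 'I_3) open_block (two_join i z Head) +
  \sum_(m : 'I_2) \sum_(k : 'I_3) (if two_out m z k is Some (s, t) then (s != 0) && (t != 0) else false).

Let inf_weightE Q m : inf_weight tcont jcont econt xcont Q m =
  \sum_(y : 'Z_D) two_inf_zone Q m (zone_of a h 1 D y) + \sum_x weight Q m (xcont x).
Proof.
rewrite /inf_weight; congr (_ + _); rewrite [X in X + _ + _]exchange_big -!big_split.
apply: eq_bigr => y _ /=; congr (_ + _ + _); apply: eq_bigr => i _.
rewrite /jcont /two_join !weightE.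
by move: i; apply: I3_case => //=; case: (low _).
Qed.

Let frame_openE : frame_open tcont jcont econt xcont =
  \sum_(y : 'Z_D) two_open_zone (zone_of a h 1 D y) + 1.
Proof.
rewrite /frame_open; congr (_ + _); last by rewrite !big_ord_recl big_ord0.
rewrite [X in X + _ + _]exchange_big [X in _ + X]exchange_big -!big_split.
apply: eq_bigr => y _ /=; congr (_ + _ + _); apply: eq_bigr => i _.
rewrite /jcont /two_join.
by move: i; apply: I3_case => //=; case: (low _).
Qed.

Lemma two_inf_zoneE m z :
  ((two_inf_zone (at_pos 0) m z =
     if val m is 0
     then match z with Tail => 1 | Head => 0 | KeptB | LastB => 2 | _ => 1 end
     else match z with Tail | LastA => 1 | KeptB => 3 | LastB => 2 | _ => 0 end) *
   (two_inf_zone (at_pos 1) m z =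
     if val m is 0
     then match z with Tail => 1 | Head => 0 | KeptB | LastB => 1 | _ => 2 end
     else match z with Head | LastB => 1 | KeptA => 3 | LastA => 2 | _ => 0 end) *
   (two_inf_zone (at_pos 2) m z =
     if val m is 0 then (if z is Head then 1 else 0) else (if z is Tail then 1 else 0)) *
   (two_inf_zone one_with_two m z =
     if val m is 0 then (if z is Tail then 1 else 0) else (if z is Head then 1 else 0)))%type.
Proof.
rewrite /two_inf_zone; move: m; apply: I2_case; rewrite !big_ord_recl !big_ord0 !weightE.
  by do !split; case: z; vm_compute.
by do !split; case: z; vm_compute.
Qed.

Lemma two_open_zoneE z :
  two_open_zone z = match z with Head | KeptA | LastA => 1 | _ => 0 end.
Proof.
rewrite /two_open_zone !big_ord_recl !big_ord0.
by case: z; vm_compute.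
Qed.

Let inf_xcont Q m : \sum_x weight Q m (xcont x) =
  if val m is 0 then Q 1 [:: 1] + Q 0 [:: 0; 1] else Q 1 [:: 0; 1] + Q 0 [:: 0].
Proof.
by move: m; apply: I2_case; rewrite !big_ord_recl big_ord0 !weightE /= ?addn0.
Qed.

Lemma code_of_two_infinities (n : nat) (w' : seq nat) (w1 := a + (3 * k + 4)) :
  all (fun x => x <= w1) w' -> sumn w' = w1 + a ->
  w1 * (3 * D + 2) + (a + k + 2) <= n ->
  3 * D + 2 <= max_ccc (size w').+2 n (2 * sumn (w1 :: w') - 1) (w1 :: w').
Proof.
move=> w'_le sum_w' size_n.
have hD : h = a + k + 1 /\ D = 2 * h by [].
have [|r [c [Urow [Umix [[ri ro r0] [mj cU cM]]]]]] := @even_differences a h; first lia.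
have cF : #|'I_2| = 2 by rewrite card_ord.
rewrite -[X in 3 * D + X <= _]cF.
apply: (code_of_frame (K := 3) D_gt1 w'_le _ _ _ ri ro r0 mj
  (cl := two_cl) (tri := tri) (tcont := tcont) (jcont := jcont) (econt := econt) (xcont := xcont)).
- by rewrite prednK.
- by rewrite cU; move: #|Umix| cM => m; rewrite /w1; lia.
- by rewrite /w1; lia.
- by do 2!apply: I2_case.
- exact: tcont_ok.
- exact: tcont_fin.
- exact: tcont_inf.
- move=> x i; rewrite /jcont /two_join.
  by move: i; apply: I3_case => //=; case: (st x); case: (st _).
- move=> x i _; rewrite /jcont /two_join addrAC !st_opp.
  by move: i; apply: I3_case => //=; case: (st x); case: (st _).
- move=> x i m; rewrite /jcont /two_join /tri /two_tri st_opp.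
  by move: m i; apply: I2_case; apply: I3_case => //=; case: (st x); case: (st _).
- move=> x i m; rewrite /jcont /two_join addrAC !st_opp.
  by move: m i; apply: I2_case; apply: I3_case => //=; case: (st x); case: (st _).
- move=> m y l s t; rewrite /econt /two_out /out1 /tri /two_tri /=.
  by move: m l; apply: I2_case; apply: I3_case => //=; case: (st y) => //= -[<- <-].
- by apply: I3_case.
- by do 2!apply: I2_case => //; do 2!apply: I3_case.
- by move=> x i; have [] := fin_weights x i.
- by move=> x i; have [] := fin_weights x i.
- by move=> x i; have [] := fin_weights x i.
- by move=> x i; have [] := fin_weights x i.
- move=> m; rewrite inf_weightE inf_xcont sum_zone ?two_inf_zoneE /at_pos /w1 /=; try lia.
  by case: (nat_of_ord m) => /=; lia.
- move=> m; rewrite inf_weightE inf_xcont sum_zone ?two_inf_zoneE /at_pos /w1 /=; try lia.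
  by case: (nat_of_ord m) => /=; lia.
- move=> m; rewrite inf_weightE inf_xcont sum_zone ?two_inf_zoneE /at_pos /=; try lia.
  by case: (nat_of_ord m) => /=; lia.
- move=> m; rewrite inf_weightE inf_xcont sum_zone ?two_inf_zoneE /one_with_two /=; try lia.
  by case: (nat_of_ord m) => /=; lia.
- by rewrite frame_openE sum_zone ?two_open_zoneE ?card_ord; lia.
Qed.

End TwoInfinities.

(** * 3D points: D even, no point at infinity *)

Section NoInfinity.

Variables (a k : nat).
Hypothesis a_gt0 : 0 < a.
Hypothesis k_gt0 : 0 < k.

Let h := a + k.
Let D := 2 * h.
Let first (x : 'Z_D) : bool := x < h.
Let q : 'Z_D := h%:R%R.

Let D_gt1 : 1 < D. Proof. by rewrite /D /h; lia. Qed.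

Let first_opp x : first (x + q)%R = ~~ first x.
Proof.
have hD : h = a + k /\ D = 2 * h by [].
have xD : x < D by have := ltn_ord x; rewrite [X in _ < X]Zp_cast.
rewrite /first /q (Zp_shift _ D_gt1); last by lia.
by case: (ltnP (x + h) D) => ?; lia.
Qed.

Let first_sub x : first (x - q)%R = ~~ first x.
Proof.
by set y := (x - q)%R; rewrite -[x](subrK q) -/y first_opp negbK.
Qed.

(** Only class 0 is split. Its triangles with index in the second half have one block each without
    position 0, h = a + k in all, which is w1 - floor(2s/3) for s = 3k. *)
Definition zero_table (cc : 'I_3) (b : bool) (e : 'I_3) : seq (('I_3 + 'I_0) * nat) :=
  match val cc, val e with
  | 0, 0 => [:: (inl I3_0, 0); (inl I3_1, 1)]
  | 0, 1 => if b then [:: (inl I3_1, 0); (inl I3_2, 1)]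
            else [:: (inl I3_1, 1); (inl I3_2, 2)]
  | 0, _ => if b then [:: (inl I3_0, 0); (inl I3_2, 2)]
            else [:: (inl I3_2, 0); (inl I3_0, 1)]
  | 1, 0 => [:: (inl I3_1, 0); (inl I3_2, 1); (inl I3_0, 2)]
  | 1, _ => [::]
  | _, e => tri2_full _ e
  end.
Definition zero_join (i : 'I_3) (b b' : bool) : seq ((bool + 'I_0) * nat) :=
  match val i with
  | 0 => if b then [:: (inl true, 0); (inl false, 1)] else [::]
  | 1 => if b' then [:: (inl true, 0); (inl false, 1)] else [::]
  | _ => if b' then plain_pair else [::]
  end.

Let tcont cc (y : 'Z_D) e := zero_table cc (first y) e.
Let tri (cc : 'I_3) (y : 'Z_D) := cc != 0%R.
Let jcont (x : 'Z_D) (i : 'I_3) := zero_join i (first x) (first (x - 1)%R).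
Let econt (m : 'I_0) (y : 'Z_D) (k : 'I_3) : option (nat * nat) := None.
Let xcont (x : 'I_0) : seq ('I_0 * nat) := [::].
Let cl (m : 'I_0) : 'I_3 := ord0.

Let tcont_ok cc y e : block_ok (tcont cc y e).
Proof.
by rewrite /tcont /zero_table; case: (first y); move: cc e; do 2!apply: I3_case; vm_compute.
Qed.

Let tcont_fin cc y e l : inl l \in unzip1 (tcont cc y e) ->
  if tri cc y then e == 0%R else (l == e) || (l == e + 1)%R.
Proof.
rewrite /tcont /tri /zero_table.
by case: (first y); move: cc e l; do 3!apply: I3_case; vm_compute.
Qed.

Let fin_weights x i : [/\ fin_weight 1%R q cl tcont jcont econt (at_pos 0) x i = 2,
  fin_weight 1%R q cl tcont jcont econt (at_pos 1) x i = 2,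
  fin_weight 1%R q cl tcont jcont econt (at_pos 2) x i = 1 &
  fin_weight 1%R q cl tcont jcont econt one_with_two x i <= 1].
Proof.
rewrite /fin_weight /tri_weight /join_weight /out_weight /econt /tcont /jcont /zero_table.
rewrite !big_ord_recl !big_ord0 !(fun_if first) addrAC !first_sub.
move: (first x) (first (x - 1)%R) => s s'; rewrite !weightE.
by split; move: i; apply: I3_case; case: s; case: s'; vm_compute.
Qed.

Let frame_openE : frame_open tcont jcont econt xcont = h.
Proof.
rewrite /frame_open !big_ord0 !addn0 [X in _ + X]big1 ?addn0 => [|x _]; last first.
  rewrite /jcont !big_ord_recl big_ord0.
  by case: (first x); case: (first (x - 1)%R).
rewrite exchange_big /=.
have -> : h = \sum_(y : 'Z_D) ~~ first y.
  have hD : h = a + k /\ D = 2 * h by [].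
  rewrite (eq_bigr (fun y : 'Z_D =>
      if zone_of 0 h 0 D y is KeptB then 0 else 1)) => [|y _].
    by rewrite (sum_zone (fun z => if z is KeptB then 0 else 1)) //; lia.
  by rewrite /first /zone_of subn0; case: (y < h); do 2?case: ifP.
apply: eq_bigr => y _; rewrite /tcont !big_ord_recl !big_ord0.
by case: (first y); vm_compute.
Qed.

Lemma code_of_no_infinity (n : nat) (w' : seq nat) (w1 := a + 3 * k) :
  all (fun x => x <= w1) w' -> sumn w' = w1 + a ->
  w1 * (3 * D) + (a + k) <= n ->
  3 * D <= max_ccc (size w').+2 n (2 * sumn (w1 :: w') - 1) (w1 :: w').
Proof.
move=> w'_le sum_w' size_n.
have hD : h = a + k /\ D = 2 * h by [].
have [|r [c [Urow [Umix [[ri ro r0] [mj cU cM]]]]]] := @even_differences a h; first lia.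
have cF : #|'I_0| = 0 by rewrite card_ord.
rewrite -[X in X <= _]addn0 -[X in 3 * D + X <= _]cF.
apply: (code_of_frame (K := 2) D_gt1 w'_le _ _ _ ri ro r0 mj
  (cl := cl) (tri := tri) (tcont := tcont) (jcont := jcont) (econt := econt) (xcont := xcont)).
- by rewrite prednK.
- by rewrite cU; move: #|Umix| cM => m; rewrite /w1; lia.
- by rewrite /w1; lia.
- by case.
- exact: tcont_ok.
- exact: tcont_fin.
- by move=> cc y e [].
- move=> x i; rewrite /jcont /zero_join.
  by move: i; apply: I3_case => //=; case: (first x); case: (first _).
- move=> x i _; rewrite /jcont /zero_join addrAC !first_opp.
  by move: i; apply: I3_case => //=; case: (first x); case: (first _).
- by move=> x i [].
- by move=> x i [].
- by case.
- by case.
- by case.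
- by move=> x i; have [] := fin_weights x i.
- by move=> x i; have [] := fin_weights x i.
- by move=> x i; have [] := fin_weights x i.
- by move=> x i; have [] := fin_weights x i.
- by case.
- by case.
- by case.
- by case.
- by rewrite frame_openE ?card_ord; lia.
Qed.

End NoInfinity.

Lemma code_lambda3 (w1 a s n : nat) (w' : seq nat) :
  all (fun x => x <= w1) w' -> sumn w' = w1 + a -> 0 < a -> a + s = w1 ->
  (6 * a + 2 * s + 1) * w1 - (2 * s) %/ 3 <= n ->
  n %/ w1 <= max_ccc (size w').+2 n (2 * sumn (w1 :: w') - 1) (w1 :: w').
Proof.
move=> w'_le sum_w' a0 asw size_n.
have Mn := leq_trunc_div n w1.
case: (ltnP (6 * a + 2 * s) (n %/ w1)) => [M_gt|M_le].
  case: (ltnP (6 * a + 2) (n %/ w1)) => [M_gt'|M_le'].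
    exact: (code_of_nested_slots w'_le sum_w' a0 asw).
  (* A size of at most 6a + 2 exceeds 6a + 2s only for s = 0, that is w1 = a; triples alone then
     provide all positions, each a times. *)
  have s0 : s = 0 by lia.
  have aw : a = w1 by lia.
  have [ME|ME] : n %/ w1 = 6 * a + 1 \/ n %/ w1 = 6 * a + 2 by lia.
    rewrite ME -aw; apply: code_of_steiner1; rewrite ?aw //; try lia.
  rewrite ME -aw; apply: code_of_steiner2; rewrite ?aw //; try lia.
have w1_gt0 : 0 < w1 by lia.
apply: (leq_trans M_le).
have size_M : w1 * (6 * a + 2 * s) + (w1 - (2 * s) %/ 3) <= n.
  by move: size_n; rewrite mulnDl mul1n mulnC; lia.
have f_le : (2 * s) %/ 3 <= w1.
  by lia.
(* For s <= 1 the floor vanishes, so the length already has quotient at least 6a + 2s + 1. *)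
have s2 : 1 < s.
  rewrite ltnNge; apply/negP => s1; move: size_n.
  have -> : (2 * s) %/ 3 = 0 by lia.
  by rewrite subn0 -leq_divRL //; lia.
(* The residue of 6a + 2s modulo 3 fixes the number of infinite points. Residue 1 of s is written 3k
   + 4 because s > 1. *)
have [k [sE|[sE|[sE k0]]]] : exists k, s = 3 * k + 2 \/ s = 3 * k + 4 \/ s = 3 * k /\ 0 < k.
  have := divn_eq s 3; have : s %% 3 < 3 by rewrite ltn_pmod.
  case: (s %% 3) => [|[|[|//]]] _ sE; first by exists (s %/ 3); lia.
    by exists (s %/ 3).-1; lia.
  by exists (s %/ 3); lia.
- have := @code_of_one_infinity a k a0 n w'; rewrite -sE asw.
  by rewrite (_ : 3 * _ + 1 = 6 * a + 2 * s); [apply|]; lia.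
- have := @code_of_two_infinities a k a0 n w'; rewrite -sE asw.
  by rewrite (_ : 3 * _ + 2 = 6 * a + 2 * s); [apply|]; lia.
- have := @code_of_no_infinity a k a0 k0 n w'; rewrite -sE asw.
  by rewrite (_ : 3 * (2 * _) = 6 * a + 2 * s); [apply|]; lia.
Qed.

(** * The value of N_ccc *)

Definition lambda_nat (w : seq nat) := (sumn w + comp1 w - 1) %/ comp1 w.

Definition s_nat (w : seq nat) := lambda_nat w * comp1 w - sumn w.

Lemma lambda_nat_bounds w : 0 < comp1 w ->
  sumn w <= lambda_nat w * comp1 w < sumn w + comp1 w.
Proof.
move=> c0; rewrite /lambda_nat; have := divn_eq (sumn w + comp1 w - 1) (comp1 w).
have := ltn_pmod (sumn w + comp1 w - 1) c0; lia.
Qed.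

Lemma comp_lambdaE w : 0 < comp1 w -> (comp_lambda w = (lambda_nat w)%:Z)%R.
Proof.
move=> c0; have /andP[le1 lt2] := lambda_nat_bounds c0.
have c0' : (0 < (comp1 w)%:R :> rat)%R by rewrite ltr0n.
apply/ceil_def; rewrite ltr_pdivlMr // ler_pdivrMr //.
rewrite rmorphB /= -!pmulrn mulrBl mul1r -natrM ltrBlDr -natrD ltr_nat ler_nat.
by rewrite lt2 le1.
Qed.

Lemma comp_sE w : 0 < comp1 w -> (comp_s w = (s_nat w)%:Z)%R.
Proof.
move=> c0; have /andP[le1 lt2] := lambda_nat_bounds c0.
by rewrite /comp_s comp_lambdaE // /s_nat; lia.
Qed.

Lemma floor_natdiv (m k : nat) : 0 < k ->
  (Num.floor (m%:R / k%:R : rat) = (m %/ k)%:Z)%R.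
Proof.
move=> k0; have k0' : (0 < k%:R :> rat)%R by rewrite ltr0n.
apply/floor_def; rewrite ler_pdivlMr // ltr_pdivrMr //.
rewrite (_ : (Posz (m %/ k) + 1)%R = Posz (m %/ k).+1); last by lia.
rewrite -!pmulrn -!natrM ler_nat ltr_nat.
have := divn_eq m k; have := ltn_pmod m k0; lia.
Qed.

Section Composition.

Variables (w1 : nat) (w' : seq nat).
Hypotheses (w_ok : is_composition (w1 :: w')) (w'_gt0 : 0 < size w').

Let w := w1 :: w'.
Let L := lambda_nat w.
Let s := s_nat w.

Lemma comp1_gt0 : 0 < w1.
Proof. by case/andP: w_ok => _ /= /andP[]. Qed.

Lemma tail_le : all (fun x => x <= w1) w'.
Proof.
case/andP: w_ok => w_sorted _; have geq_trans : transitive geq.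
  by move=> y x z xy yz; apply: leq_trans yz xy.
by move: w_sorted; rewrite /= (path_sortedE geq_trans) => /andP[].
Qed.

Lemma tail_gt0 : 0 < sumn w'.
Proof.
by move: w_ok w'_gt0; rewrite /is_composition /=; case: w' => //= x t /and4P[_ _]; lia.
Qed.

Lemma L_ge2 : 1 < L.
Proof.
have := @lambda_nat_bounds w comp1_gt0; rewrite -/L /comp1 /=.
by have := tail_gt0; have := comp1_gt0; case: L => [|[|l]] //; lia.
Qed.

Lemma sE : sumn w + s = L * w1 /\ s < w1.
Proof. by have := @lambda_nat_bounds w comp1_gt0; rewrite /s /s_nat -/L /comp1 /=; lia. Qed.

Lemma Nccc_boundE : (Nccc_bound w =
  Posz (L * (L - 1) * w1 - 2 * (L - 1) * s + 1) * Posz w1 - Posz ((2 * s) %/ L))%R.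
Proof.
have [sumE s_lt] := sE; have L2 := L_ge2.
rewrite /Nccc_bound comp_lambdaE ?comp_sE ?comp1_gt0 // -/L -/s.
rewrite (_ : (2 * Posz s)%R = Posz (2 * s)) // -!pmulrn floor_natdiv; last by lia.
congr (_ - _)%R; rewrite /comp1 /=.
have le : 2 * (L - 1) * s <= L * (L - 1) * w1.
  by rewrite -mulnA [X in _ <= X](_ : _ = L * ((L - 1) * w1)) ?leq_mul //; lia.
nia.
Qed.

(** With f = floor(2s/L), a code of size P just below the bound would give L(L - 1)(f + 1) <= 2(L -
    1)s by the pair count for l = L - 1, hence f + 1 <= 2s/L, a contradiction. *)
Lemma bound_lt n0 : meets_johnson_from w n0 -> (Nccc_bound w <= n0%:Z)%R.
Proof.
have [sumE s_lt] := sE; have L2 := L_ge2; have w1_gt0 := comp1_gt0.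
move=> meets; rewrite leNgt; apply/negP; rewrite Nccc_boundE.
set P := L * (L - 1) * w1 - 2 * (L - 1) * s; set f := (2 * s) %/ L => lt_n0.
have PE : P + 2 * (L - 1) * s = L * (L - 1) * w1.
  rewrite /P subnK // -mulnA.
  by rewrite [X in _ <= X](_ : _ = L * ((L - 1) * w1)) ?leq_mul //; lia.
have f_le : f <= s.
  by have := leq_divM (2 * s) L; rewrite -/f; nia.
have [q [qE qlt]] : exists q, 2 * s = f * L + q /\ q < L.
  by exists ((2 * s) %% L); rewrite ltn_pmod -?divn_eq //; lia.
(* The largest length below the bound; since f < w1, its quotient by w1 is P. *)
pose n := P * w1 + (w1 - f - 1).
have E : max_ccc (size w).+1 n (2 * sumn w - 1) w = P.
  rewrite meets /n /comp1 /=; last by lia.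
  by rewrite divnMDl // divn_small ?addn0 //; lia.
have W0 : 0 < sumn w by rewrite /=; lia.
have := @max_ccc_pair_count w n (L - 1) W0; rewrite {}E.
have [k Lk] : exists k, L = k.+1 by exists L.-1; lia.
move: PE qE qlt sumE; rewrite {}/n {meets lt_n0}; rewrite Lk subn1 /= addn1.
move: (w1 + sumn w') => W PE qE qlt sumE.
have -> : w1 - f - 1 = w1 - f.+1 by lia.
have [y yE] : exists y, w1 = y + f.+1 by exists (w1 - f.+1); lia.
have -> : w1 - f.+1 = y by lia.
have k0 : 0 < k by lia.
have EW : 2 * k * (P * W) + 2 * k * P * s = 2 * P * (P + 2 * k * s).
  by rewrite PE; have := congr1 (muln (2 * k * P)) sumE; rewrite mulnDr; lia.
have EX : k * k.+1 * (P * w1) = P * (P + 2 * k * s) by rewrite PE; lia.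
have EY : k * k.+1 * y + k * k.+1 * f.+1 = P + 2 * k * s by rewrite PE yE; lia.
rewrite mulnDr EX; move=> H.
have : k * k.+1 * f.+1 <= 2 * k * s by lia.
rewrite -!mulnA [2 * (k * s)]mulnCA leq_pmul2l // qE; lia.
Qed.

End Composition.

Theorem theorem1 (w : seq nat) (hw : is_composition w) (hsize : 2 <= size w) :
  exists N : nat,
    [/\ is_Nccc w N,
        (Nccc_bound w <= N%:Z)%R
      & sumn w <= 3 * comp1 w ->
        (forall v : seq nat,
           v \in [:: [:: 4; 4; 2]; [:: 4; 3; 3]; [:: 5; 5; 3]; [:: 5; 4; 4]] ->
           ~ is_refinement w v) ->
        (N%:Z = Nccc_bound w)%R].
Proof.
case: w hw hsize => [|w1 w'] // w_ok w'_gt0; rewrite /= ltnS in w'_gt0.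
have w1_gt0 := comp1_gt0 w_ok; set w := w1 :: w'.
have [K codeK] := code_of_powers (isT : 0 < size w) w_ok.
have sum_gt0 : 0 < sumn w by rewrite /=; lia.
pose meets n := max_ccc (size w).+1 n (2 * sumn w - 1) w == n %/ comp1 w.
have meetsP n : n %/ comp1 w <= max_ccc (size w).+1 n (2 * sumn w - 1) w -> meets n.
  by move=> le; rewrite /meets eqn_leq le max_ccc_johnson.
(* From [K] on the powers of two attain every quotient, so only finitely many lengths need testing
   and the least n0 exists constructively. *)
pose Q n0 := all meets (iota n0 (K - n0)).
have QP n0 : reflect (meets_johnson_from w n0) (Q n0).
  apply: (iffP allP) => [Qn n n_ge|mj n]; last first.
    by rewrite mem_iota => /andP[/mj E _]; apply/eqP.
  case: (leqP K n) => Kn; first exact/eqP/meetsP/codeK.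
  by apply/eqP/Qn; rewrite mem_iota; lia.
have exQ : exists n0, Q n0.
  by exists K; apply/QP => n /codeK/meetsP/eqP.
case: (ex_minnP exQ) => N /QP QN minN; exists N; split.
- by split=> // n0 /QP/minN.
- exact: bound_lt QN.
move=> w_le _; apply/eqP; rewrite eq_le bound_lt // andbT Nccc_boundE //.
have [] := sE w_ok w'_gt0; have := L_ge2 w_ok w'_gt0.
rewrite -/w; set L := lambda_nat w; set s := s_nat w => L2 sumE s_lt.
have L3 : L <= 3.
  have /andP[_] := lambda_nat_bounds (w1_gt0 : 0 < comp1 w).
  by rewrite -/L; move: w_le; rewrite /comp1 /=; nia.
set b := (L * (L - 1) * w1 - 2 * (L - 1) * s + 1) * w1 - (2 * s) %/ L.
suff /QP/minN : meets_johnson_from w b.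
  rewrite -PoszM subzn; first by rewrite lez_nat.
  have := leq_divM (2 * s) L; move: (_ %/ L) => f fL; have : f <= s by nia.
  by rewrite addn1 mulSn => fs; apply: leq_trans (leq_addr _ _); lia.
have w'_le := tail_le w_ok; have sum'_gt0 := tail_gt0 w_ok w'_gt0.
move: sumE @b; rewrite /=; have [->|->] : L = 2 \/ L = 3 by lia.
  move=> sumE n n_ge; apply/eqP/meetsP; apply: (@code_lambda2 w1) => //; first by lia.
  by apply: leq_trans n_ge; rewrite mulKn //; nia.
move=> sumE n n_ge; apply/eqP/meetsP.
apply: (@code_lambda3 w1 (w1 - s) s) => //; try lia.
Qed.
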